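(* For every $\epsilon>0$ there is $N_0(\epsilon)$ such that for all $N\ge N_0(\epsilon)$ and all $A,B\subseteq[N]=\{1,\dots,N\}$ with $|A|,|B|\ge(\tfrac38+\epsilon)N$, the sumset $A+B$ contains a perfect square. Quantitatively, $$\#\{(a,b)\in A\times B : a+b\in S\}\ \ge\ 10^{-6}\epsilon^3N^{3/2},$$ where $S=\{m^2:m\in\mathbb{N}\}$ is the set of positive perfect squares. *)

(* Defs.v *)
From mathcomp Require Import all_boot all_order all_algebra.
From mathcomp Require Import reals.
Set Implicit Arguments. Unset Strict Implicit. Unset Printing Implicit Defensive.

Definition is_pos_square (n : nat) : bool :=
  [exists m : 'I_n.+1, (0 < (m : nat)) && ((m : nat) ^ 2 == n)].

Definition subset_1N (N : nat) (A : {set 'I_N.+1}) : Prop :=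
  forall x : 'I_N.+1, x \in A -> 0 < (x : nat).

Definition square_pairs (N : nat) (A B : {set 'I_N.+1}) : nat :=
  #|[set p : 'I_N.+1 * 'I_N.+1 | (p.1 \in A) && (p.2 \in B)
        && is_pos_square (p.1 + p.2)]|.

(* Main.v *)
(* Cut the integers into blocks and the blocks into residue classes modulo Q = 2^k. If A and B have
   densities x and y in two such cells, with residues s and t, and s + t = r^2 mod Q, then the number
   of (a, b) in the cells with a + b = (r + Qn)^2 for some n is at least (3xy - (1-x)(1-y))/6 times
   the expected number of squares, up to a small error. Indeed, replace B on its cell by its average
   along a much finer modulus and then by coarser averages: the coarsest one gives the main term xy,
   the changes of scale are negligible by van der Corput's inequality, except for one change of
   modulus, which is made negligible by choosing Q by an energy-increment pigeonhole, and the
   remaining part has, by van der Corput with three shifts, second moment at most a third of the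
   variance y(1-y). Cauchy-Schwarz against the variance x(1-x) of A, and AM-GM, give the bound.

   So if there are few solutions, 3xy <= (1-x)(1-y) for almost all pairs of cells with s + t in the
   class 1 mod 8, 4 mod 32 or 16 mod 128, all of which consist of squares modulo Q. Let X_i(u) be the
   proportion of cells of residue i mod 8 with x >= u, and Y_i(u) that of residue -i with
   y > (1-u)/(1+2u). Up to a small error, X_{i+1} or Y_i vanishes, X_i + Y_i <= 1 and
   X_{i+4} + Y_i <= 1. A finite check bounds sum X + sum Y by 6 when both families have two nonzero
   members; otherwise sum X + c sum Y or c sum X + sum Y is at most 8 for all c in [1, 3]. Integrating
   over u shows that the two average densities cannot both exceed 3/8. *)

(* The constant 3/8 cannot be lowered: the classes 3, 6, 7 mod 8 for [A] and 0, 4, 7 mod 8 for [B]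
   have only the sums 2, 3, 5, 6, 7, whereas squares are 0, 1 or 4 mod 8. The factor 1/3 decides the
   criterion for a pair of cells. Van der Corput with U shifts gains 1/U, provided that the function
   sums to zero along progressions of difference 2 Q^2 u for all 0 < u < U. Averages modulo a power
   of two achieve this for u = 1 and u = 2; u = 3 would force the prime 3 into the modulus, and then
   1 mod 8, 4 mod 32 and 16 mod 128 would no longer guarantee a square modulo Q. Hence three shifts,
   and 3xy > (1-x)(1-y). The same restriction creates the troublesome change of modulus, from 4 Q^2
   to Q over blocks of one length: differencing a sequence (r + Qn)^2 produces only multiples of 2
   Q^2 and cannot cancel it. It is charged to an energy that is bounded in total, so among
   sufficiently many steps Q -> 4 Q^2, which stay within powers of two, one is cheap. *)
From Stdlib Require PeanoNat.
Require Import Defs.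
From mathcomp Require Import all_boot all_order all_algebra.
From mathcomp Require Import boolp classical_sets reals.
From mathcomp Require Import zify ring lra.
Import Order.TTheory GRing.Theory Num.Theory.
Set Implicit Arguments. Unset Strict Implicit. Unset Printing Implicit Defensive.

(** * Square roots modulo powers of two *)

(* The pairs [(8 * 4 ^ e, 4 ^ e)]: a number congruent to [4 ^ e] mod [8 * 4 ^ e] is a 2-adic square. *)
Definition square_types : seq (nat * nat) := [:: (8, 1); (32, 4); (128, 16)]%N.

(** Hensel lifting at 2. As [2 * y] is even, one lifts by [2 ^ k.+2]: adding it to [y] changes
    [y ^ 2] by an odd multiple of [2 ^ k.+3] and so repairs the parity of the defect. The multiples
    [a] and [b] on the two sides express a congruence without subtraction, and [a + b] carries the
    parity of the defect. *)
Lemma odd_square_lift h k : exists y a b,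
  odd y /\ (y ^ 2 + a * 2 ^ k.+3 = 8 * h + 1 + b * 2 ^ k.+3)%N.
Proof.
elim: k => [|k [y [a [b [yo E]]]]].
  by exists 1%N, h, 0%N; split=> //; ring.
have [abo|abe] := boolP (odd (a + b)); last first.
  exists y, ((a + b)./2), b; split=> //.
  have := odd_double_half (a + b); rewrite (negbTE abe) add0n => abE.
  have -> : ((a + b)./2 * 2 ^ k.+4 = (a + b) * 2 ^ k.+3)%N by rewrite -{2}abE -muln2 [(2 ^ k.+4)%N]expnS; ring.
  by rewrite mulnDl addnA E (expnS 2 k.+3); ring.
pose z := (y + 2 ^ k.+2)%N.
pose b' := (b + y + 2 ^ k.+1)%N.
have E' : (z ^ 2 + a * 2 ^ k.+3 = 8 * h + 1 + b' * 2 ^ k.+3)%N.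
  have -> : (z ^ 2 + a * 2 ^ k.+3 = (y ^ 2 + a * 2 ^ k.+3) + y * 2 ^ k.+3 + 2 ^ k.+1 * 2 ^ k.+3)%N.
    by rewrite /z !expnS; ring.
  by rewrite E /b'; ring.
have : ~~ odd (a + b').
  by rewrite /b' !addnA !oddD in abo *; rewrite yo oddX /= addbT addbF; rewrite abo.
move=> abe; exists z, ((a + b')./2), b'; split; first by rewrite /z oddD yo oddX.
have := odd_double_half (a + b'); rewrite (negbTE abe) add0n => abE.
have -> : ((a + b')./2 * 2 ^ k.+4 = (a + b') * 2 ^ k.+3)%N by rewrite -{2}abE -muln2 [(2 ^ k.+4)%N]expnS; ring.
by rewrite mulnDl addnA E' (expnS 2 k.+3); ring.
Qed.

(** One root [y] of the odd part yields the distinct roots [2 ^ e * y + g * j], where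
    [2 ^ e.+1 * g = Q]: the cross term is then a multiple of [Q], and [Q] divides [g ^ 2] because
    [2 * e + 2 <= k]. *)
Lemma pow2_root_family e h k (Q := (2 ^ k)%N) : (2 ^ (2 * e + 3) %| Q)%N ->
  (2 ^ e.+1 <= #|[pred r : 'I_Q | r ^ 2 == 2 ^ (2 * e) * (8 * h + 1) %[mod Q]]|)%N.
Proof.
rewrite dvdn_Pexp2l // => ek.
have [y [a [b [yo E]]]] := odd_square_lift h (k - 3).
have Q0 : (0 < Q)%N by rewrite expn_gt0.
pose g := (2 ^ (k - e.+1))%N.
have gQ : (2 ^ e.+1 * g = Q)%N by rewrite /g -expnD subnKC //; move: ek; clear; lia.
have kE : (2 ^ (k - 3).+3 = Q)%N by rewrite /Q; congr (2 ^ _)%N; move: ek; clear; lia.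
rewrite kE in E.
pose F (j : 'I_(2 ^ e.+1)) : 'I_Q := Ordinal (ltn_pmod (2 ^ e * y + g * j) Q0).
have Finj : injective F.
  move=> i j /(congr1 val) /= /eqP; rewrite eqn_modDl -gQ mulnC [(_ * j)%N]mulnC -!muln_modl.
  rewrite eqn_mul2r expn_eq0 /= => /eqP; rewrite !modn_small // => ij; exact: val_inj.
rewrite -[leqLHS]card_ord -(card_imset predT Finj); apply: subset_leq_card.
apply/fintype.subsetP => r /imsetP[j _ ->]; rewrite inE /= modnXm.
have g2 : (g ^ 2 = Q * 2 ^ (k - 2 * e.+1))%N.
  by rewrite /g /Q -expnM -expnD; congr (2 ^ _)%N; move: ek; clear; lia.
have -> : ((2 ^ e * y + g * j) ^ 2 = (2 ^ (2 * e) * y ^ 2) + (y * j + 2 ^ (k - 2 * e.+1) * j ^ 2) * Q)%N.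
  transitivity (2 ^ (2 * e) * y ^ 2 + y * j * (2 ^ e.+1 * g) + g ^ 2 * j ^ 2)%N.
    by rewrite (mulnC 2%N e) expnM; move: (nat_of_ord j) => j'; rewrite [(2 ^ e.+1)%N]expnS; ring.
  by rewrite gQ g2; ring.
rewrite addnC modnMDl -(modnMDl (2 ^ (2 * e) * a) (_ * y ^ 2)) -(modnMDl (2 ^ (2 * e) * b) (_ * (_ + 1))).
by rewrite -!mulnA -!mulnDr addnC E addnC.
Qed.

(** Here V = 2^(2e+3) with e <= 2, and there are at least 2^(e+1) roots; the worst ratio 2^(3e+5) is
    2^11 = 2048. The factor [V ^ 2] will offset the sparsity of pairs of cells lying in two fixed
    classes modulo [V]. *)
Lemma pow2_square_roots k V c x (Q := (2 ^ k)%N) :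
  (128 %| Q)%N -> (V, c) \in square_types -> x = c %[mod V] ->
  (V ^ 2 <= 2048 * #|[pred r : 'I_Q | r ^ 2 == x %[mod Q]]|)%N.
Proof.
move=> Q128 Vc xc.
have [e e2 [VE cE]] : exists2 e, (e <= 2)%N & V = (2 ^ (2 * e + 3))%N /\ c = (2 ^ (2 * e))%N.
  by move: Vc; rewrite !inE => /or3P[] /eqP[-> ->]; [exists 0%N|exists 1%N|exists 2%N].
have VQ : (2 ^ (2 * e + 3) %| Q)%N.
  apply: dvdn_trans Q128; rewrite -[128%N]/(2 ^ 7)%N dvdn_Pexp2l //; move: e2; clear; lia.
have cV : (c < V)%N by rewrite VE cE ltn_exp2l //; clear; lia.
have xE : x = (2 ^ (2 * e) * (8 * (x %/ V) + 1))%N.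
  by rewrite {1}(divn_eq x V) xc (modn_small cV) VE cE expnD; ring.
have := pow2_root_family (x %/ V) VQ; rewrite -xE => h.
apply: leq_trans (_ : 2048 * 2 ^ e.+1 <= _)%N; last by rewrite leq_mul2l h orbT.
by rewrite VE; move: e2; clear; case: e => [|[|[|]]].
Qed.

Local Open Scope ring_scope.

(** * Cauchy-Schwarz and sums along progressions *)

Lemma ler_of_sqr (R : realDomainType) (x y : R) : 0 <= y -> x ^+ 2 <= y ^+ 2 -> x <= y.
Proof. by move=> y0 xy; nra. Qed.

Lemma sqr_sum_mul_le (R : realDomainType) (I : Type) (r : seq I) (P : pred I) (x y : I -> R) :
  (\sum_(i <- r | P i) x i * y i) ^+ 2 <=
  (\sum_(i <- r | P i) x i ^+ 2) * (\sum_(i <- r | P i) y i ^+ 2).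
Proof.
elim: r => [|i r IH]; first by rewrite !big_nil mul0r expr0n.
rewrite !big_cons; case: ifP => // _.
have X0 : 0 <= \sum_(i <- r | P i) x i ^+ 2 by apply: sumr_ge0 => *; exact: sqr_ge0.
have Y0 : 0 <= \sum_(i <- r | P i) y i ^+ 2 by apply: sumr_ge0 => *; exact: sqr_ge0.
move: IH X0 Y0; set S := \sum_(i <- r | P i) _; set X := \sum_(i <- r | P i) _.
set Y := \sum_(i <- r | P i) _ => IH X0 Y0.
have h : S * (x i * y i) *+ 2 <= X * y i ^+ 2 + Y * x i ^+ 2.
  apply: ler_of_sqr.
    by rewrite addr_ge0 // mulr_ge0 // sqr_ge0.
  have h1 : S ^+ 2 * (x i * y i) ^+ 2 <= X * Y * (x i * y i) ^+ 2.
    by apply: ler_wpM2r => //; exact: sqr_ge0.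
  have h2 := sqr_ge0 (X * y i ^+ 2 - Y * x i ^+ 2).
  by lra.
by lra.
Qed.

Lemma norm_sum_le_card (R : realDomainType) (f : nat -> R) (a b : nat) :
  (forall x, `|f x| <= 1) -> `|\sum_(a <= i < b) f i| <= (b - a)%:R.
Proof.
move=> f1; apply: le_trans (ler_norm_sum _ _ _) _.
apply: le_trans (ler_sum _ (fun i _ => f1 i)) _.
by rewrite sumr_const_nat.
Qed.

Lemma sum_nat_shift (R : nmodType) (F : nat -> R) (a b : nat) :
  \sum_(a <= i < a + b) F i = \sum_(i < b) F (a + i)%N.
Proof.
rewrite -{1}[a]add0n big_addn addKn big_mkord.
by apply: eq_bigr => i _; rewrite addnC.
Qed.

Lemma sum_nat_split (R : nmodType) (F : nat -> R) (a b : nat) :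
  \sum_(0 <= i < a + b) F i = \sum_(0 <= i < a) F i + \sum_(i < b) F (a + i)%N.
Proof. by rewrite (@big_cat_nat _ _ _ a) /= ?leq_addr ?sum_nat_shift. Qed.

(** Aligned periods of [rho] terms sum to zero, so every initial sum of the progression is at most
    [rho] in size; an arbitrary segment is a difference of two initial sums. *)
Lemma ap_sum_bound (R : realDomainType) (f : nat -> R) (sg rho : nat) :
  (0 < sg)%N -> (0 < rho)%N -> (forall x, `|f x| <= 1) ->
  (forall j y, (y < sg)%N -> \sum_(i < rho) f (j * (sg * rho) + y + sg * i)%N = 0) ->
  forall y L, `|\sum_(0 <= i < L) f (y + sg * i)%N| <= (2 * rho)%:R.
Proof.
move=> sg0 rho0 f1 f0 y L.
set y0 := (y %% sg)%N; set k := (y %/ sg)%N.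
have yE : y = (y0 + sg * k)%N by rewrite /y0 /k addnC mulnC -divn_eq.
have y0lt : (y0 < sg)%N by rewrite ltn_mod.
pose F n := \sum_(0 <= i < n) f (y0 + sg * i)%N.
have F0 j : F (j * rho)%N = 0.
  elim: j => [|j IH]; first by rewrite /F big_geq.
  rewrite /F mulSnr sum_nat_split -[X in X + _]/(F (j * rho)%N) IH add0r.
  rewrite -[RHS](f0 j y0 y0lt); apply: eq_bigr => i _; congr f; ring.
have Fb n : `|F n| <= rho%:R.
  rewrite (divn_eq n rho) /F sum_nat_split.
  rewrite -[X in `|X + _|]/(F (n %/ rho * rho)%N) F0 add0r.
  rewrite -(big_mkord xpredT (fun i => f (y0 + sg * (n %/ rho * rho + i))%N)).
  apply: le_trans (@norm_sum_le_card _ (fun i => f (y0 + sg * (n %/ rho * rho + i))%N) 0 (n %% rho) _) _ => //.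
  by rewrite subn0 ler_nat ltnW // ltn_mod.
have -> : \sum_(0 <= i < L) f (y + sg * i)%N = F (k + L)%N - F k.
  rewrite /F sum_nat_split addrC addKr big_mkord.
  by apply: eq_bigr => i _; congr f; rewrite yE; ring.
apply: le_trans (ler_normB _ _) _.
by rewrite mul2n -addnn natrD lerD.
Qed.

Lemma sum_nat_supp (R : nmodType) (F : nat -> R) (a b c d : nat) :
  (a <= c)%N -> (d <= b)%N -> (forall n, ~~ (c <= n < d)%N -> F n = 0) ->
  \sum_(a <= n < b) F n = \sum_(c <= n < d) F n.
Proof.
move=> ac db F0; case: (leqP c d) => [cd|dc].
  rewrite (@big_cat_nat _ _ _ c) //=; last exact: leq_trans cd db.
  rewrite (@big_cat_nat _ _ _ d c b) //= big_nat big1 ?add0r; last first.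
    by move=> i ilt; apply: F0; lia.
  rewrite [X in _ + X]big_nat [X in _ + X]big1 ?addr0 //.
  by move=> i ilt; apply: F0; lia.
rewrite [RHS]big_geq ?(ltnW dc) //.
by rewrite big1 // => i _; apply: F0; lia.
Qed.

Lemma sum_nat_indicator_le (R : realDomainType) (a b c d : nat) :
  \sum_(a <= n < b) ((c <= n < d)%N)%:R <= (d - c)%:R :> R.
Proof.
have -> : (d - c)%:R = \sum_(0 <= n < maxn b d) ((c <= n < d)%N)%:R :> R.
  rewrite (@sum_nat_supp _ _ 0 (maxn b d) c d) ?leq_maxr //; last first.
    by move=> n /negbTE ->.
  rewrite (eq_big_nat _ _ (F2 := fun=> 1)); last by move=> i ->.
  by rewrite sumr_const_nat.
case: (leqP a b) => [ab|ba]; last by rewrite big_geq ?(ltnW ba) // sumr_ge0.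
rewrite (@big_cat_nat _ _ _ a 0 (maxn b d)) //=; last by lia.
rewrite (@big_cat_nat _ _ _ b a (maxn b d)) //= ?leq_maxl //.
have h1 : 0 <= \sum_(0 <= i < a) ((c <= i < d)%N)%:R :> R by apply: sumr_ge0.
have h2 : 0 <= \sum_(b <= i < maxn b d) ((c <= i < d)%N)%:R :> R by apply: sumr_ge0.
lra.
Qed.

(** Substitute [x = m - a]. Truncated subtraction sends all [a >= m] to 0, which is why [f] has to
    vanish at 0. *)
Lemma correlation_shift (R : pzSemiRingType) (f : nat -> R) (X m m' Z : nat) :
  f 0%N = 0 -> (forall x, (X <= x)%N -> f x = 0) ->
  (X <= m)%N -> (m <= m')%N -> (m < Z)%N ->
  \sum_(0 <= a < Z) f (m - a)%N * f (m' - a)%N =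
  \sum_(0 <= x < X) f x * f (x + (m' - m))%N.
Proof.
move=> f0 fX Xm mm' mZ.
rewrite (@sum_nat_supp _ _ 0 Z 0 m.+1) //; last first.
  move=> n nm; have -> : (m - n)%N = 0%N by lia.
  by rewrite f0 mul0r.
rewrite big_nat_rev /= add0n.
rewrite -(@sum_nat_supp _ _ 0 m.+1 0 X) //; last first.
- by move=> n nX; rewrite fX ?mul0r //; lia.
- exact: leqW.
apply: eq_big_nat => x xm; congr (f _ * f _); lia.
Qed.

(** * Van der Corput's inequality along the squares of a progression *)

Section VanDerCorput.

Variables (R : realFieldType) (f : nat -> R) (r Q U H n1 L w X Z K rho : nat).
Variables (l : R) (P : pred nat).

Let m n := ((r + Q * n) ^ 2)%N.

Hypotheses (Q0 : (0 < Q)%N) (H0 : (0 < H)%N).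
Hypotheses (f0 : f 0%N = 0) (f1 : forall x, `|f x| <= 1).
Hypothesis fX : forall x, (X <= x)%N -> f x = 0.
Hypothesis fl : \sum_(0 <= x < X) `|f x| <= l.
Hypothesis big : (X <= m n1)%N.
Hypothesis hZ : (m (n1 + L + U * H) < Z)%N.
Hypothesis hK : (n1 + L <= K)%N.
Hypothesis window : forall a, P a -> exists nu, forall n, f (m n - a)%N != 0 ->
  (nu <= n < nu + w)%N && (n1 + U * H <= n < n1 + L)%N.
Hypothesis zero_sum : forall u, (0 < u < U)%N -> exists rh, [/\ (0 < rh <= rho)%N &
  forall j y, (y < 2 * Q ^ 2 * u * H)%N ->
   \sum_(i < rh) f (j * (2 * Q ^ 2 * u * H * rh) + y + 2 * Q ^ 2 * u * H * i)%N = 0].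

Let S a := \sum_(0 <= n < K) f (m n - a)%N.
Let Psi a n := \sum_(u < U) f (m (n + u * H) - a)%N.

(** Every contributing [n] lies at least [U * H] above the start [n1] of the range, so translating
    by [u * H] loses no term. *)
Let S_shift a : P a -> U%:R * S a = \sum_(n1 <= n < n1 + L) Psi a n.
Proof.
move=> Pa; have [nu nuP] := window Pa.
have supp n : ~~ (n1 + U * H <= n < n1 + L)%N -> f (m n - a)%N = 0.
  by move=> hn; apply/eqP; apply: contraNT hn => /nuP /andP[].
have E (u : 'I_U) : \sum_(n1 <= n < n1 + L) f (m (n + u * H) - a)%N = S a; last first.
  rewrite exchange_big (eq_bigr _ (fun u _ => E u)) sumr_const card_ord.
  by rewrite mulr_natl.
rewrite /S (@sum_nat_supp _ _ 0 K (n1 + U * H) (n1 + L)) //.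
have uU : (u * H <= U * H)%N by rewrite leq_mul2r ltnW ?orbT.
have -> : \sum_(n1 <= n < n1 + L) f (m (n + u * H) - a)%N =
          \sum_(n1 + u * H <= n < n1 + L + u * H) f (m n - a)%N by rewrite big_addn addnK.
by rewrite (@sum_nat_supp _ _ (n1 + u * H) (n1 + L + u * H) (n1 + U * H) (n1 + L)) ?leq_addr ?leq_add2l.
Qed.

(** As a function of [n], [Psi a n] lives on a window of length [w + U * H], and Cauchy-Schwarz is
    applied against the indicator of that window. *)
Let S_sqr a : P a ->
  (U%:R * S a) ^+ 2 <= (w + U * H)%:R * \sum_(n1 <= n < n1 + L) Psi a n ^+ 2.
Proof.
move=> Pa; rewrite S_shift //; have [nu nuP] := window Pa.
pose ind n : R := ((nu - U * H <= n < nu + w)%N)%:R.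
have E n : Psi a n = ind n * Psi a n.
  rewrite /ind; case: (boolP (nu - U * H <= n < nu + w)%N) => [_|/negP nn]; first by rewrite mul1r.
  rewrite mul0r /Psi big1 // => u _; apply/eqP; apply: contra_notT nn => /nuP.
  have : (u * H <= U * H)%N by rewrite leq_mul2r ltnW ?orbT.
  by clear; lia.
rewrite (eq_bigr _ (fun n _ => E n)).
apply: le_trans (sqr_sum_mul_le _ _ _ _) _.
apply: ler_wpM2r; first by apply: sumr_ge0 => *; exact: sqr_ge0.
rewrite (eq_bigr ind); last by move=> n _; rewrite /ind; case: (_ && _); rewrite ?expr1n ?expr0n.
by apply: le_trans (sum_nat_indicator_le _ _ _ _ _) _; rewrite ler_nat; clear; lia.
Qed.

Let m_mono a b : (a <= b)%N -> (m a <= m b)%N.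
Proof. by move=> ab; rewrite /m leq_exp2r // leq_add2l leq_mul2l ab orbT. Qed.

Let corr u v n := \sum_(0 <= a < Z) f (m (n + u * H) - a)%N * f (m (n + v * H) - a)%N.

(** [m (n + v * H) - m (n + u * H)] is affine in [n] with slope [2 * Q ^ 2 * (v - u) * H]. For fixed
    [x] the second factor therefore runs along a progression on which [f] sums to zero over
    periods. *)
Let corr_bound u v : (u < v < U)%N ->
  `|\sum_(n1 <= n < n1 + L) corr u v n| <= l * (2 * rho)%:R.
Proof.
move=> uvU; have [| rh [rhb rh0]] := zero_sum (u := (v - u)%N); first by move: uvU; clear; lia.
have E n : (n1 <= n < n1 + L)%N -> corr u v n =
   \sum_(0 <= x < X) f x * f (x + (m (n + v * H) - m (n + u * H)))%N.
  move=> hn; rewrite /corr (@correlation_shift _ _ X) //.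
  - by apply: leq_trans big _; apply: m_mono; move: hn; clear; lia.
  - by apply: m_mono; rewrite leq_add2l leq_mul2r; move: uvU; clear; lia.
  - apply: leq_ltn_trans hZ; apply: m_mono.
    have : (u * H <= U * H)%N by rewrite leq_mul2r; move: uvU; clear; lia.
    by move: hn; clear; lia.
rewrite (eq_big_nat _ _ E) exchange_big /=.
apply: le_trans (ler_norm_sum _ _ _) _.
apply: (@le_trans _ _ (\sum_(0 <= x < X) `|f x| * (2 * rho)%:R)).
  apply: ler_sum => x _; rewrite -big_distrr normrM /=; apply: ler_wpM2l => //.
  set sg := (2 * Q ^ 2 * (v - u) * H)%N.
  rewrite sum_nat_shift.
  rewrite (eq_bigr (fun k : 'I_L => f (x + (m (n1 + v * H) - m (n1 + u * H)) + sg * k)%N)).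
    rewrite -(big_mkord xpredT (fun k => f (x + (m (n1 + v * H) - m (n1 + u * H)) + sg * k)%N)).
    apply: le_trans (@ap_sum_bound _ f sg rh _ _ f1 _ _ _) _.
    - by rewrite /sg !muln_gt0 /= Q0 H0 subn_gt0; case/andP: uvU => ->.
    - by case/andP: rhb.
    - exact: rh0.
    - by rewrite ler_nat leq_mul2l /=; case/andP: rhb.
  move=> k _; congr f.
  have -> : (m (n1 + k + v * H) - m (n1 + k + u * H) =
             (m (n1 + v * H) - m (n1 + u * H)) + sg * k)%N; last by rewrite addnA.
  have vE : v = (u + (v - u))%N by move: uvU; clear; lia.
  rewrite /sg; move: (v - u)%N vE => d ->.
  rewrite /m; set A := (r + Q * (n1 + u * H))%N.
  have -> : (r + Q * (n1 + k + (u + d) * H) = A + Q * k + Q * d * H)%N by rewrite /A; ring.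
  have -> : (r + Q * (n1 + k + u * H) = A + Q * k)%N by rewrite /A; ring.
  have -> : (r + Q * (n1 + (u + d) * H) = A + Q * d * H)%N by rewrite /A; ring.
  have -> : ((A + Q * k + Q * d * H) ^ 2 =
             (A + Q * k) ^ 2 + (2 * A * (Q * d * H) + (Q * d * H) ^ 2 + 2 * Q ^ 2 * d * H * k))%N.
    by ring.
  have -> : ((A + Q * d * H) ^ 2 = A ^ 2 + (2 * A * (Q * d * H) + (Q * d * H) ^ 2))%N by ring.
  by rewrite !addKn.
by rewrite -big_distrl /=; apply: ler_wpM2r.
Qed.

(** Expanding [Psi a n ^+ 2] gives [U] diagonal correlations, equal to the energy of [f], and
    off-diagonal ones controlled by [corr_bound]. After division by [U%:R ^+ 2] the energy carries a
    factor 1/U. *)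
Lemma van_der_corput : U%:R ^+ 2 * (\sum_(0 <= a < Z | P a) S a ^+ 2) <=
  (w + U * H)%:R * (U%:R * L%:R * (\sum_(0 <= x < X) f x ^+ 2) + U%:R ^+ 2 * (l * (2 * rho)%:R)).
Proof.
have corrE u v n : corr u v n = corr v u n by apply: eq_bigr => a _; rewrite mulrC.
rewrite big_distrr /=.
apply: (@le_trans _ _ (\sum_(0 <= a < Z | P a)
    (w + U * H)%:R * \sum_(n1 <= n < n1 + L) Psi a n ^+ 2)).
  by apply: ler_sum => a Pa; rewrite -exprMn; exact: S_sqr.
rewrite -big_distrr /=; apply: ler_wpM2l => //.
apply: (@le_trans _ _ (\sum_(0 <= a < Z) \sum_(n1 <= n < n1 + L) Psi a n ^+ 2)).
  rewrite [X in _ <= X](bigID P) /= lerDl; apply: sumr_ge0 => a _.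
  by apply: sumr_ge0 => n _; exact: sqr_ge0.
have -> : \sum_(0 <= a < Z) \sum_(n1 <= n < n1 + L) Psi a n ^+ 2 =
   \sum_(u < U) \sum_(v < U) \sum_(n1 <= n < n1 + L) corr u v n.
  rewrite exchange_big /=.
  have -> : \sum_(u < U) \sum_(v < U) \sum_(n1 <= n < n1 + L) corr u v n =
    \sum_(n1 <= n < n1 + L) \sum_(u < U) \sum_(v < U) corr u v n.
    by rewrite [RHS]exchange_big /=; apply: eq_bigr => u _; rewrite exchange_big.
  apply: eq_bigr => n _.
  have -> : \sum_(u < U) \sum_(v < U) corr u v n = \sum_(0 <= a < Z) \sum_(u < U) \sum_(v < U)
     f (m (n + u * H) - a)%N * f (m (n + v * H) - a)%N.
    by rewrite [RHS]exchange_big /=; apply: eq_bigr => u _; rewrite exchange_big.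
  apply: eq_bigr => a _; rewrite expr2 /Psi big_distrl /=; apply: eq_bigr => u _.
  by rewrite big_distrr.
have l0 : 0 <= l by apply: le_trans fl; apply: sumr_ge0.
have diag u : (u < U)%N ->
   \sum_(n1 <= n < n1 + L) corr u u n = L%:R * \sum_(0 <= x < X) f x ^+ 2.
  move=> uU; rewrite (eq_big_nat _ _ (F2 := fun=> \sum_(0 <= x < X) f x ^+ 2)).
    by rewrite sumr_const_nat addKn mulr_natl.
  move=> n hn; rewrite /corr (@correlation_shift _ _ X) //.
  - by apply: eq_bigr => x _; rewrite subnn addn0 expr2.
  - by apply: leq_trans big _; apply: m_mono; move: hn; clear; lia.
  - apply: leq_ltn_trans hZ; apply: m_mono.
    have : (u * H <= U * H)%N by rewrite leq_mul2r ltnW ?orbT.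
    by move: hn; clear; lia.
apply: (@le_trans _ _ (\sum_(u < U) (L%:R * (\sum_(0 <= x < X) f x ^+ 2) +
    U%:R * (l * (2 * rho)%:R)))); last first.
  by rewrite sumr_const card_ord -mulr_natl le_eqVlt; apply/orP; left; apply/eqP; ring.
apply: ler_sum => u _; rewrite (bigD1 u) //= diag // lerD2l.
apply: (@le_trans _ _ (\sum_(v < U | v != u) l * (2 * rho)%:R)).
  apply: ler_sum => v vu; apply: le_trans (ler_norm _) _.
  have : (v : nat) != u by [].
  rewrite neq_ltn => /orP[vu'|uv].
    by rewrite (eq_bigr _ (fun n _ => corrE u v n)); apply: corr_bound; rewrite vu' /=.
  by apply: corr_bound; rewrite uv /=.
rewrite sumr_const -[_ *+ #|_|]mulr_natl; apply: ler_wpM2r; first by rewrite mulr_ge0.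
by rewrite ler_nat -[X in (_ <= X)%N]card_ord max_card.
Qed.

End VanDerCorput.

(** [c] and [d] are the first indices whose squares reach [z] and [z + len]. Consecutive squares are
    at least [2 * Q * M0] apart above [M0 ^ 2] and at most [Q * (2 * M1 + Q)] apart below [M1 ^ 2];
    the additional [2 * Q * M0] and [+ 1] pay for the incomplete gaps at the ends. *)
Lemma square_window (r Q z len : nat) : (r < Q)%N ->
  exists c d, [/\ (c <= d)%N,
    forall n, (z <= (r + Q * n) ^ 2 < z + len)%N = (c <= n < d)%N,
    forall M0, (M0 ^ 2 <= z)%N -> ((d - c) * (2 * Q * M0) <= len + 2 * Q * M0)%N &
    forall M1, (z + len <= M1 ^ 2)%N -> (len <= (d - c + 1) * (Q * (2 * M1 + Q)))%N].
Proof.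
move=> rQ; have Q0 : (0 < Q)%N by lia.
pose m n := (r + Q * n)%N.
have ex x : exists n, (x <= m n ^ 2)%N.
  exists x; rewrite /m; apply: (@leq_trans (x ^ 2)); first by rewrite -mulnn; case: (x) => // ?; rewrite leq_pmulr.
  by rewrite leq_exp2r // (leq_trans (leq_pmull x Q0)) ?leq_addl.
have mono a b : (a <= b)%N -> (m a <= m b)%N.
  by move=> ab; rewrite leq_add2l leq_mul2l ab orbT.
have sq a b : (a ^ 2 <= b ^ 2)%N = (a <= b)%N by rewrite leq_exp2r.
have sqlt a b : (a ^ 2 < b ^ 2)%N = (a < b)%N by rewrite ltn_exp2r.
case: (ex_minnP (ex z)) => c zc cmin; case: (ex_minnP (ex (z + len)%N)) => d zd dmin.
have cP n : (z <= m n ^ 2)%N = (c <= n)%N.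
  apply/idP/idP => [|cn]; first exact: cmin.
  by apply: leq_trans zc _; rewrite sq mono.
have dP n : (z + len <= m n ^ 2)%N = (d <= n)%N.
  apply/idP/idP => [|cn]; first exact: dmin.
  by apply: leq_trans zd _; rewrite sq mono.
have cd : (c <= d)%N by rewrite -cP; apply: leq_trans zd; rewrite leq_addr.
have mD a k : m (a + k) = (m a + Q * k)%N by rewrite /m; ring.
exists c, d; split => //.
- by move=> n; rewrite cP ltnNge dP -ltnNge.
- move=> M0 M0z; case: (ltnP c d) => [lt_cd|]; last by move=> dc; rewrite (eqP (_ : d - c == 0)%N) //; move: dc; clear; lia.
  have M0c : (M0 <= m c)%N by rewrite -sq; exact: leq_trans zc.
  have dE : d = (c + (d - c).-1).+1 by move: lt_cd; clear; lia.
  have : ~~ (z + len <= m (c + (d - c).-1) ^ 2)%N by rewrite dP; move: dE; clear; lia.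
  rewrite -ltnNge mD; set k := (d - c).-1 => lt1.
  have -> : (d - c)%N = k.+1 by rewrite /k; move: lt_cd; clear; lia.
  move: lt1 M0c zc; move: (m c) => mc; clear; move=> lt1 M0c zc.
  have h1 : (Q * k * M0 <= Q * k * mc)%N by rewrite leq_mul2l M0c orbT.
  have h2 : ((mc + Q * k) ^ 2 = mc ^ 2 + (2 * (Q * k * mc) + (Q * k) ^ 2))%N by ring.
  have -> : (k.+1 * (2 * Q * M0) = 2 * (Q * k * M0) + 2 * Q * M0)%N by ring.
  rewrite leq_add2r; move: h1 h2 lt1 zc.
  move: (Q * k * M0)%N (Q * k * mc)%N ((Q * k) ^ 2)%N ((mc + Q * k) ^ 2)%N (mc ^ 2)%N.
  by clear; lia.
move=> M1 zM1.
have small n : (n < c)%N -> (m n < M1)%N.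
  by move=> nc; rewrite -sqlt; apply: leq_trans (_ : z <= _)%N; [rewrite ltnNge cP -ltnNge|exact: leq_trans (leq_addr _ _) zM1].
have small' n : (n < d)%N -> (m n < M1)%N.
  by move=> nd; rewrite -sqlt; apply: leq_trans zM1; rewrite ltnNge dP -ltnNge.
have md : (d = 0 \/ m d < M1 + Q)%N.
  case: (posnP d) => [->|d0]; [by left|right].
  have := small' d.-1; rewrite ltn_predL => /(_ d0).
  by rewrite -{2}(prednK d0) -[d.-1.+1]addn1 mD; clear; lia.
(* If [c = 0], no earlier root brackets the interval from below; the whole square [m d ^ 2] is
   estimated instead of a difference. *)
case: (posnP c) => [c0|c0].
  rewrite c0 subn0; case: md => [d0|md].
    move: zd; rewrite d0 /m muln0 addn0 add0n mul1n => zd.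
    apply: leq_trans (leq_trans (leq_addl _ _) zd) _.
    rewrite -mulnn; apply: leq_mul; first exact: ltnW.
    exact: leq_trans (ltnW rQ) (leq_addl _ _).
  apply: leq_trans (leq_trans (leq_addl _ _) zd) _.
  rewrite -mulnn; apply: (@leq_trans ((d + 1) * Q * (2 * M1 + Q))); last by rewrite mulnA.
  apply: leq_mul; last by move: md; clear; lia.
  by rewrite /m mulnDl mul1n mulnC addnC leq_add2l ltnW.
have lt1 : (m c.-1 ^ 2 < z)%N by rewrite ltnNge cP -ltnNge ltn_predL.
have lt2 := small c.-1; rewrite ltn_predL in lt2; have {}lt2 := lt2 c0.
have dE : d = (c.-1 + (d - c + 1))%N by move: cd c0; clear; lia.
case: md => [d0|md]; first by move: cd c0; rewrite d0; clear; lia.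
move: zd md; rewrite dE mD -dE.
move: lt1 lt2 ; move: (m c.-1) (d - c + 1)%N => mc k; clear -Q0; move=> lt1 lt2 zd md.
have h2 : ((mc + Q * k) ^ 2 = mc ^ 2 + (Q * k * (2 * mc + Q * k)))%N by ring.
apply: (@leq_trans (Q * k * (2 * mc + Q * k))); first by move: zd lt1; rewrite h2; clear; lia.
rewrite mulnA [(k * Q)%N]mulnC leq_mul2l; apply/orP; right.
by move: lt2 md; clear; lia.
Qed.

(** * Averages over cells *)

Lemma sum_ord_mul (R : nmodType) (F : nat -> R) (a b : nat) :
  \sum_(i < a * b) F i = \sum_(i < a) \sum_(j < b) F (i * b + j)%N.
Proof.
elim: a => [|a IH]; first by rewrite !big_ord0.
rewrite big_ord_recr /= -IH -(big_mkord xpredT F) mulSnr sum_nat_split.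
by rewrite (big_mkord xpredT F).
Qed.

Lemma sum_cells (R : nmodType) (F : nat -> R) (n W k : nat) :
  \sum_(x < n * (W * k)) F x =
  \sum_(j < n) \sum_(c < W) \sum_(i < k) F (j * (W * k) + c + W * i)%N.
Proof.
rewrite sum_ord_mul; apply: eq_bigr => j _.
rewrite mulnC (sum_ord_mul (fun x => F (j * (k * W) + x)%N)) exchange_big /=.
by apply: eq_bigr => c _; apply: eq_bigr => i _; congr F; ring.
Qed.

(* The average over the points of the block of length [W * k] around [x] that are congruent to [x] modulo [W]. *)
Definition cell_avg (R : fieldType) (k W : nat) (B : nat -> R) (x : nat) : R :=
  k%:R^-1 * \sum_(i < k) B (x %/ (W * k) * (W * k) + x %% W + W * i)%N.

Lemma cell_lt (W k c i : nat) : (c < W)%N -> (i < k)%N -> (c + W * i < W * k)%N.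
Proof.
move=> cW ik; apply: (@leq_trans (W * i.+1)); first by rewrite mulnS ltn_add2r.
by rewrite leq_mul2l ik orbT.
Qed.

Lemma cell_divn (j W k c i : nat) : (c < W)%N -> (i < k)%N ->
  ((j * (W * k) + c + W * i) %/ (W * k) = j)%N.
Proof.
move=> cW ik; have lt := cell_lt cW ik.
by rewrite -addnA divnMDl ?divn_small ?addn0 //; apply: leq_ltn_trans lt.
Qed.

Lemma cell_modn_dvd (j Q e k c i : nat) : ((j * (Q * e * k) + c + Q * e * i) %% Q = c %% Q)%N.
Proof.
have -> : (j * (Q * e * k) + c + Q * e * i = (j * e * k + e * i) * Q + c)%N by ring.
by rewrite modnMDl.
Qed.

Lemma cell_modn (j W k c i : nat) : (c < W)%N -> ((j * (W * k) + c + W * i) %% W = c)%N.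
Proof. by move=> cW; have := cell_modn_dvd j W 1 k c i; rewrite muln1 (modn_small cW). Qed.

Lemma cell_avgE (R : fieldType) (k W : nat) (B : nat -> R) (j c i : nat) :
  (c < W)%N -> (i < k)%N ->
  cell_avg k W B (j * (W * k) + c + W * i)%N = k%:R^-1 * \sum_(i < k) B (j * (W * k) + c + W * i)%N.
Proof.
move=> cW ik; rewrite /cell_avg.
by congr (_ * _); apply: eq_bigr => i' _; rewrite cell_divn // cell_modn.
Qed.

Section CellSums.

Variables (R : numFieldType) (B : nat -> R).

(** [cell_avg] is the orthogonal projection onto functions constant on cells, so test functions of
    that kind do not see it. *)
Lemma sum_mul_cell_avg (G : nat -> R) (n W k : nat) :
  (forall j c i, (c < W)%N -> (i < k)%N -> G (j * (W * k) + c + W * i)%N = G (j * (W * k) + c)%N) ->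
  \sum_(x < n * (W * k)) G x * cell_avg k W B x = \sum_(x < n * (W * k)) G x * B x.
Proof.
move=> Gc.
rewrite (sum_cells (fun x => G x * cell_avg k W B x)) (sum_cells (fun x => G x * B x)).
apply: eq_bigr => j _; apply: eq_bigr => c _.
case: (posnP k) => [->|k0]; first by rewrite !big_ord0.
rewrite (eq_bigr (fun=> G (j * (W * k) + c)%N * (k%:R^-1 * \sum_(i < k) B (j * (W * k) + c + W * i)%N))).
  rewrite sumr_const card_ord -[_ *+ k]mulr_natl mulrCA [k%:R * _]mulrA divff ?pnatr_eq0 -?lt0n // mul1r.
  by rewrite big_distrr; apply: eq_bigr => i _; rewrite /= Gc.
by move=> i _; rewrite Gc // cell_avgE.
Qed.

(** Inside a block a progression of difference [sg] is a union of [e] whole cells modulo [sg * e],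
    and averaging preserves the sum over each. This is the cancellation for the part [B - P0]
    below. *)
Lemma sum_cell_avg_fine (sg e k j y : nat) : (y < sg)%N ->
  \sum_(i < k * e) cell_avg k (sg * e) B (j * (sg * e * k) + y + sg * i)%N =
  \sum_(i < k * e) B (j * (sg * e * k) + y + sg * i)%N.
Proof.
move=> ysg.
rewrite (sum_ord_mul (fun i => cell_avg k (sg * e) B (j * (sg * e * k) + y + sg * i)%N)).
rewrite (sum_ord_mul (fun i => B (j * (sg * e * k) + y + sg * i)%N)).
rewrite exchange_big [RHS]exchange_big /=; apply: eq_bigr => i _.
have ylt : (y + sg * i < sg * e)%N by apply: cell_lt.
have E (i2 : nat) : (j * (sg * e * k) + y + sg * (i2 * e + i) =
    j * (sg * e * k) + (y + sg * i) + sg * e * i2)%N by ring.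
case: (posnP k) => [->|k0]; first by rewrite !big_ord0.
rewrite (eq_bigr (fun=> k%:R^-1 * \sum_(i2 < k) B (j * (sg * e * k) + (y + sg * i) + sg * e * i2)%N)).
  rewrite sumr_const card_ord -[_ *+ k]mulr_natl mulrA divff ?pnatr_eq0 -?lt0n // mul1r.
  by apply: eq_bigr => i2 _; rewrite E.
by move=> i2 _; rewrite E cell_avgE.
Qed.

(** A progression whose difference is a multiple of the averaging modulus spends [g] steps in each
    cell that it crosses. The result depends on [B] only through one class modulo [Q] over the whole
    stretch, so averages over two block lengths cancel each other. *)
Lemma sum_cell_avg_coarse (Q e g h j y : nat) : (0 < e)%N -> (y < Q * e)%N ->
  \sum_(i < h * g) cell_avg (e * g) Q B (j * (Q * e * (h * g)) + y + Q * e * i)%N =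
  e%:R^-1 * \sum_(i < h * (e * g)) B (j * (Q * e * (h * g)) + y %% Q + Q * i)%N.
Proof.
move=> e0 ylt; have Q0 : (0 < Q)%N by case: (Q) ylt.
case: (posnP g) => [->|g0]; first by rewrite !muln0 !big_ord0 mulr0.
rewrite (sum_ord_mul (fun i => cell_avg (e * g) Q B (j * (Q * e * (h * g)) + y + Q * e * i)%N)).
rewrite (sum_ord_mul (fun i => B (j * (Q * e * (h * g)) + y %% Q + Q * i)%N)) big_distrr /=.
apply: eq_bigr => i1 _.
rewrite (eq_bigr (fun=> (e * g)%:R^-1 *
    \sum_(i < e * g) B ((j * h + i1) * (Q * (e * g)) + y %% Q + Q * i)%N)).
  have eg S : g%:R * ((e * g)%:R^-1 * S) = e%:R^-1 * S :> R.
    by rewrite natrM; field; rewrite !pnatr_eq0 -!lt0n e0 g0.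
  rewrite sumr_const card_ord -[_ *+ g]mulr_natl eg.
  congr (_ * _); apply: eq_bigr => i _; congr B; ring.
move=> i2 _.
have -> : (j * (Q * e * (h * g)) + y + Q * e * (i1 * g + i2) =
  (j * h + i1) * (Q * (e * g)) + y %% Q + Q * (y %/ Q + e * i2))%N.
  by rewrite {1}(divn_eq y Q); ring.
rewrite cell_avgE ?ltn_mod //.
by apply: cell_lt => //; rewrite ltn_divLR // mulnC.
Qed.

End CellSums.

Lemma cell_avg_ge0 (R : numFieldType) k W (B : nat -> R) x :
  (forall y, 0 <= B y) -> 0 <= cell_avg k W B x.
Proof. by move=> B0; rewrite mulr_ge0 ?invr_ge0 ?ler0n // sumr_ge0. Qed.

Lemma cell_avg_le1 (R : numFieldType) k W (B : nat -> R) x :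
  (forall y, B y <= 1) -> cell_avg k W B x <= 1.
Proof.
move=> B1; rewrite /cell_avg; case: (posnP k) => [->|k0].
  by rewrite big_ord0 mulr0 ler01.
rewrite mulrC ler_pdivrMr ?ltr0n // mul1r.
by apply: le_trans (ler_sum _ (fun i _ => B1 _)) _; rewrite sumr_const card_ord.
Qed.

Lemma cell_avg_same (R : numFieldType) k W (B : nat -> R) x y :
  (x %/ (W * k) = y %/ (W * k))%N -> (x %% W = y %% W)%N -> cell_avg k W B x = cell_avg k W B y.
Proof. by rewrite /cell_avg => -> ->. Qed.

(** Pythagoras: both averages use blocks of the same length, so the one modulo [Q] is the projection
    of the one modulo [Q * e]. *)
Lemma energy_increment (R : realFieldType) (B : nat -> R) (n Q e k : nat) :
  \sum_(x < n * (Q * e * k)) (cell_avg k (Q * e) B x - cell_avg (e * k) Q B x) ^+ 2 =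
  \sum_(x < n * (Q * e * k)) cell_avg k (Q * e) B x ^+ 2 -
  \sum_(x < n * (Q * e * k)) cell_avg (e * k) Q B x ^+ 2.
Proof.
set P' := cell_avg k (Q * e) B; set P := cell_avg (e * k) Q B.
have h1 : \sum_(x < n * (Q * e * k)) P x * P' x = \sum_(x < n * (Q * e * k)) P x * B x.
  apply: sum_mul_cell_avg => j c i cW ik; have k0 : (0 < k)%N by case: (k) ik.
  have E : (j * (Q * e * k) + c = j * (Q * e * k) + c + Q * e * 0)%N by rewrite muln0 addn0.
  apply: cell_avg_same; last by rewrite [in RHS]E !cell_modn_dvd.
  by rewrite (mulnA Q e k) [in RHS]E !cell_divn.
have h2 : \sum_(x < n * (Q * e * k)) P x * P x = \sum_(x < n * (Q * e * k)) P x * B x.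
  rewrite -mulnA; apply: sum_mul_cell_avg => j c i cW ik.
  have k0 : (0 < e * k)%N by case: (e * k)%N ik.
  have E : (j * (Q * (e * k)) + c = j * (Q * (e * k)) + c + Q * 0)%N by rewrite muln0 addn0.
  by apply: cell_avg_same; rewrite [in RHS]E ?cell_divn ?cell_modn.
transitivity (\sum_(x < n * (Q * e * k)) (P' x ^+ 2 - (2 * (P x * P' x) - P x * P x))).
  by apply: eq_bigr => x _; ring.
rewrite sumrB sumrB -big_distrr /= h1 -h2; congr (_ - _).
rewrite mulr_natl mulr2n addrK; by apply: eq_bigr => x _; rewrite expr2.
Qed.

(** * Counting squares between two cells *)

Definition in_cell (k W j c x : nat) : bool := (x %/ (W * k) == j)%N && (x %% W == c)%N.

Lemma divn_eq_interval (x d j : nat) : (0 < d)%N -> (x %/ d == j)%N = (j * d <= x < j * d + d)%N.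
Proof. by move=> d0; rewrite eqn_leq -leq_divRL // -ltnS ltn_divLR // mulSn addnC andbC. Qed.

Lemma sum_in_cell (R : pzSemiRingType) (F : nat -> R) (n k W j c : nat) : (j < n)%N -> (c < W)%N ->
  \sum_(x < n * (W * k)) (in_cell k W j c x)%:R * F x = \sum_(i < k) F (j * (W * k) + c + W * i)%N.
Proof.
move=> jn cW; rewrite (sum_cells (fun x => (in_cell k W j c x)%:R * F x)).
rewrite (bigD1 (Ordinal jn)) //= (bigD1 (Ordinal cW)) //=.
rewrite [X in _ + X]big1 ?addr0 => [|j' j'n]; last first.
  rewrite big1 // => c' _; rewrite big1 // => i _.
  rewrite /in_cell cell_divn // (negbTE (_ : (j' : nat) != j)) ?mul0r //.
rewrite [X in _ + X]big1 ?addr0 => [|c' c'n]; last first.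
  rewrite big1 // => i _.
  by rewrite /in_cell cell_modn // (negbTE (_ : (c' : nat) != c)) ?andbF ?mul0r.
by apply: eq_bigr => i _; rewrite /in_cell cell_divn // cell_modn // !eqxx mul1r.
Qed.

Lemma in_cell_const (k W j c j' y i e g h : nat) : (0 < W)%N -> (y + W * e * i < W * e * g)%N ->
  k = (h * (e * g))%N ->
  in_cell k W j c (j' * (W * e * g) + y + W * e * i)%N = in_cell k W j c (j' * (W * e * g) + y)%N.
Proof.
move=> W0 lt kE; rewrite /in_cell.
have d0 : (0 < W * e * g)%N by apply: leq_ltn_trans lt.
have lt' : (y < W * e * g)%N by apply: leq_ltn_trans lt; rewrite leq_addr.
have E x : (x %/ (W * k) = x %/ (W * e * g) %/ h)%N.
  by rewrite -divnMA kE; congr (x %/ _)%N; ring.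
rewrite !E -addnA !divnMDl ?(divn_small lt) ?(divn_small lt') //.
have -> : (j' * (W * e * g) + (y + W * e * i) = (e * i) * W + (j' * (W * e * g) + y))%N by ring.
by rewrite modnMDl.
Qed.

Lemma variance_slack (R : realFieldType) (eta b : R) : 0 < eta -> eta <= 1 / 10 -> 0 <= b -> b <= 1 / 4 ->
  (1 + eta) * (b / 3 * (1 + eta) + eta) <= b / 3 + 3 * eta.
Proof.
move=> e0 e1 b0 b1.
have e3 : eta * b <= eta * (1 / 4) by apply: ler_wpM2l => //; exact: ltW.
have e4 : eta * eta <= eta * (1 / 10) by apply: ler_wpM2l => //; exact: ltW.
have e5 : eta * eta * b <= eta * (1 / 10) * (1 / 4).
  by apply: ler_pM => //; rewrite mulr_ge0 // ltW.
lra.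
Qed.

Section Local.

Variable R : realFieldType.
Variables (A B : nat -> R).
Hypotheses (A01 : forall x, A x = 0 \/ A x = 1) (B01 : forall x, B x = 0 \/ B x = 1).
Variables (Q r s t U H : nat) (k' k1 kmid kJ h2 hJ kI iI jJ g1 : nat).
Hypotheses (k1E : k1 = (4 * Q * k')%N) (kmidE : kmid = (h2 * k1)%N) (kJE : kJ = (hJ * kmid)%N).
Hypotheses (Q0 : (0 < Q)%N) (H0 : (0 < H)%N) (rQ : (r < Q)%N) (sQ : (s < Q)%N) (tQ : (t < Q)%N).
Hypotheses (k'0 : (0 < k')%N) (h20 : (0 < h2)%N) (hJ0 : (0 < hJ)%N) (kI0 : (0 < kI)%N) (jJ0 : (0 < jJ)%N).
Hypothesis U3 : (3 <= U)%N.
Hypothesis srt : s + t = r ^ 2 %[mod Q].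
Hypothesis gU : forall u, (0 < u < U)%N -> exists g, (k1 = 2 * Q * u * H * g)%N /\ (0 < g <= g1)%N.

Let m n := ((r + Q * n) ^ 2)%N.
Let j0 := (jJ * (Q * kJ))%N.
Let i0 := (iI * (Q * kI))%N.
Let lI := (Q * kI)%N.
Let lJ := (Q * kJ)%N.
Let lmid := (Q * kmid)%N.
Let X := (jJ.+1 * (Q * kJ))%N.

(** [w0] plays the expected number of roots [r + Q * n] whose square falls in an interval of length
    [lJ], [w] is an upper bound for that number and [eta] a relative error. Relevant indices start
    [U * H] above [n1], which leaves room for the shifts. *)
Variables (n1 L w K Z : nat) (w0 eta : R).
Let cnt z len : R := \sum_(0 <= n < K) ((z <= m n < z + len)%N)%:R.

Hypothesis hX : (X <= m n1)%N.
Hypothesis hZ : (m (n1 + L + U * H) < Z)%N.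
Hypothesis hZI : (i0 + lI <= Z)%N.
Hypothesis hK : (n1 + L <= K)%N.
Hypothesis range : forall n, (i0 + j0 <= m n < i0 + j0 + lI + lJ)%N -> (n1 + U * H <= n < n1 + L)%N.
Hypothesis window : forall z, (i0 + j0 <= z <= i0 + j0 + lI)%N ->
   exists nu, forall n, (z <= m n < z + lJ)%N -> (nu <= n < nu + w)%N.
Hypothesis midcnt : forall z, (i0 + j0 <= z)%N -> (z + lmid <= i0 + j0 + lI + lJ)%N ->
   (1 - eta) * w0 <= hJ%:R * cnt z lmid.
Hypotheses (eta0 : 0 < eta) (eta1 : eta <= 1 / 10) (w00 : 0 < w0).
Hypothesis N1 : (w + U * H)%:R <= (1 + eta) * w0.
Hypothesis N2 : L%:R * kJ%:R <= (1 + eta) * (kI%:R * w0).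
Hypothesis N3 : kJ%:R * (2 * (2 * k'))%:R <= eta * (kI%:R * w0).
Hypothesis N3' : kJ%:R * (2 * (h2 * g1))%:R <= eta * (kI%:R * w0).
Hypothesis N4 : 1 <= eta * U%:R.
Hypothesis N5 : (2 * w * kJ)%:R <= eta * (kI%:R * w0).

Let hh x : R := (in_cell kJ Q jJ t x)%:R.
Let Ps a := in_cell kI Q iI s a.
Let alpha := kI%:R^-1 * \sum_(i < kI) A (iI * (Q * kI) + s + Q * i)%N.
Let beta := kJ%:R^-1 * \sum_(i < kJ) B (jJ * (Q * kJ) + t + Q * i)%N.

(** The decomposition is [B = P2 + (P1 - P2) + (P0 - P1) + (B - P0)]. [P0] and [P1] share the block
    length [Q * k1] and differ in the modulus; [P1] and [P2] share the modulus and differ in the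
    block length. *)
Let P0 := cell_avg k' (Q * (4 * Q)) B.
Let P1 := cell_avg k1 Q B.
Let P2 := cell_avg kmid Q B.
Let f x := hh x * (B x - P0 x).
Let f1 x := hh x * (P0 x - P1 x).
Let f2 x := hh x * (P1 x - P2 x).
Let S (F : nat -> R) a := \sum_(0 <= n < K) F (m n - a)%N.

Hypothesis energy : \sum_(x < X) f1 x ^+ 2 <= eta * kJ%:R.

Let k10 : (0 < k1)%N. Proof. by rewrite k1E !muln_gt0 Q0 k'0. Qed.
Let kmid0 : (0 < kmid)%N. Proof. by rewrite kmidE muln_gt0 h20. Qed.
Let kJ0 : (0 < kJ)%N. Proof. by rewrite kJE muln_gt0 hJ0. Qed.

Let B_ge0 x : 0 <= B x. Proof. by case: (B01 x) => ->; rewrite ?ler01. Qed.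
Let B_le1 x : B x <= 1. Proof. by case: (B01 x) => ->; rewrite ?ler01. Qed.
Let A_ge0 x : 0 <= A x. Proof. by case: (A01 x) => ->; rewrite ?ler01. Qed.
Let A_le1 x : A x <= 1. Proof. by case: (A01 x) => ->; rewrite ?ler01. Qed.

Let hh01 x : hh x = 0 \/ hh x = 1.
Proof. by rewrite /hh; case: in_cell; [right|left]. Qed.

Let hh_supp x : hh x != 0 -> (j0 <= x < j0 + lJ)%N /\ (x %% Q = t)%N.
Proof.
rewrite /hh pnatr_eq0 eqb0 negbK => /andP[]; by rewrite divn_eq_interval ?muln_gt0 ?Q0 ?kJ0 // => ? /eqP.
Qed.

Let norm_diff01 (x y : R) : 0 <= x <= 1 -> 0 <= y <= 1 -> `|x - y| <= 1.
Proof. by move=> /andP[x0 x1] /andP[y0 y1]; rewrite ler_norml; lra. Qed.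

Let P01 k W x : 0 <= cell_avg k W B x <= 1.
Proof. by rewrite cell_avg_ge0 //= cell_avg_le1. Qed.

Let supp_norm (F : nat -> R) : (forall x, `|F x| <= 1) ->
  [/\ forall x, `|hh x * F x| <= 1, forall x, (X <= x)%N -> hh x * F x = 0,
      hh 0%N * F 0%N = 0, \sum_(0 <= x < X) `|hh x * F x| <= kJ%:R
    & \sum_(0 <= x < X) (hh x * F x) ^+ 2 <= kJ%:R].
Proof.
move=> F1.
have h1 x : `|hh x * F x| <= hh x.
  by case: (hh01 x) => ->; rewrite ?mul0r ?normr0 // mul1r.
have sumh : \sum_(0 <= x < X) hh x = kJ%:R.
  transitivity (\sum_(i < kJ) (1 : R)); last by rewrite sumr_const card_ord.
  rewrite big_mkord.
  rewrite -(sum_in_cell (fun=> 1) kJ (ltnSn jJ) tQ).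
  by apply: eq_bigr => x _; rewrite mulr1.
have hh1 x : hh x <= 1 by case: (hh01 x) => ->; rewrite ?ler01.
split.
- by move=> x; apply: le_trans (h1 x) _.
- move=> x Xx; apply/eqP; apply: contraTT Xx; rewrite mulf_eq0 negb_or => /andP[/hh_supp[+ _] _].
  by rewrite /X /j0 /lJ mulSn addnC -ltnNge => /andP[].
- apply/eqP; rewrite mulf_eq0; apply/orP; left; apply: contraTT isT => /hh_supp[+ _].
  by rewrite leqNgt /j0 !muln_gt0 jJ0 Q0 kJ0.
- by rewrite -sumh; apply: ler_sum => x _.
- rewrite -sumh; apply: ler_sum => x _; apply: le_trans (h1 x).
  rewrite -real_normK ?num_real //.
  by rewrite expr2 ler_piMl // (le_trans (h1 _)).
Qed.

Let Ps_bound a : Ps a -> (i0 <= a < i0 + lI)%N /\ (a %% Q = s)%N.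
Proof. by move=> /andP[]; rewrite divn_eq_interval ?muln_gt0 ?Q0 ?kI0 // => ? /eqP. Qed.

Let hit a n : Ps a -> hh (m n - a)%N != 0 ->
  [/\ (a + j0 <= m n < a + j0 + lJ)%N, (i0 + j0 <= m n < i0 + j0 + lI + lJ)%N & (a <= m n)%N].
Proof.
move=> /Ps_bound[ab _] /hh_supp[mb _].
have j00 : (0 < j0)%N by rewrite /j0 !muln_gt0 jJ0 Q0 kJ0.
by move: (m n) ab mb j00; clear; split; lia.
Qed.

(** Used three times: with a single shift for [f1], with [U] shifts by multiples of [H] for [f2],
    and with three unit shifts for [f]. *)
Let vdc_gen (G : nat -> R) (U' H' rho : nat) : (0 < H')%N -> (U' * H' <= U * H)%N ->
  (forall x, `|G x| <= 1) ->
  (forall u, (0 < u < U')%N -> exists rh, (0 < rh <= rho)%N /\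
     forall j y, (y < 2 * Q ^ 2 * u * H')%N -> \sum_(i < rh)
       hh (j * (2 * Q ^ 2 * u * H' * rh) + y + 2 * Q ^ 2 * u * H' * i)%N *
       G (j * (2 * Q ^ 2 * u * H' * rh) + y + 2 * Q ^ 2 * u * H' * i)%N = 0) ->
  U'%:R ^+ 2 * (\sum_(0 <= a < Z | Ps a) S (fun x => hh x * G x) a ^+ 2) <=
  (w + U' * H')%:R * (U'%:R * L%:R * (\sum_(0 <= x < X) (hh x * G x) ^+ 2) +
     U'%:R ^+ 2 * (kJ%:R * (2 * rho)%:R)).
Proof.
move=> H'0 UH G1 zs; have [F1 F2 F3 F4 F5] := supp_norm G1.
apply: (@van_der_corput _ (fun x => hh x * G x) r Q U' H' n1 L w X Z K rho kJ%:R Ps) => //.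
- by apply: leq_ltn_trans hZ; rewrite leq_exp2r // leq_add2l leq_mul2l leq_add2l UH orbT.
- move=> a Pa; have [ab _] := Ps_bound Pa.
  have [|nu nuP] := window (z := (a + j0)%N).
    by move: ab; clear; lia.
  exists nu => n; rewrite mulf_eq0 negb_or => /andP[/(hit Pa)[h1 h2' _] _].
  have /andP[l1 ->] := range h2'; rewrite nuP //= andbT.
  by apply: leq_trans l1; rewrite leq_add2l.
Qed.

Let Pdvd (j' y i e g h : nat) : (y + Q * e * i < Q * e * g)%N -> kJ = (h * (e * g))%N ->
  hh (j' * (Q * e * g) + y + Q * e * i)%N = hh (j' * (Q * e * g) + y)%N.
Proof. by move=> lt kJE'; rewrite /hh (in_cell_const _ _ _ Q0 lt kJE'). Qed.

(** This limits the number of shifts to three: [2 * Q ^ 2 * u] divides the modulus [4 * Q ^ 2] of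
    [P0] only for [u = 1] and [u = 2]. *)
Let zero_f u : (0 < u < 3)%N -> exists rh, (0 < rh <= 2 * k')%N /\
   forall j y, (y < 2 * Q ^ 2 * u * 1)%N -> \sum_(i < rh)
       hh (j * (2 * Q ^ 2 * u * 1 * rh) + y + 2 * Q ^ 2 * u * 1 * i)%N *
       (B (j * (2 * Q ^ 2 * u * 1 * rh) + y + 2 * Q ^ 2 * u * 1 * i)%N -
        P0 (j * (2 * Q ^ 2 * u * 1 * rh) + y + 2 * Q ^ 2 * u * 1 * i)%N) = 0.
Proof.
move=> u3; have [e [ue e0 e2]] : exists e, [/\ (u * e = 2)%N, (0 < e)%N & (e <= 2)%N].
  by case: u u3 => [|[|[]]] // _; [exists 2%N|exists 1%N].
exists (k' * e)%N; split; first by rewrite muln_gt0 k'0 e0 mulnC leq_mul2r e2 orbT.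
move=> j y; set sg := (2 * Q ^ 2 * u * 1)%N => ysg.
have sgE : (sg * e = Q * (4 * Q))%N.
  by rewrite /sg muln1 -mulnA ue; ring.
have sgQ : sg = (Q * (2 * Q * u))%N by rewrite /sg; ring.
rewrite (eq_bigr (fun i : 'I_(k' * e) => hh (j * (sg * (k' * e)) + y)%N *
  (B (j * (sg * e * k') + y + sg * i)%N - P0 (j * (sg * e * k') + y + sg * i)%N))).
  rewrite -big_distrr sumrB /= /P0 -sgE sum_cell_avg_fine // subrr mulr0 //.
move=> i _.
have -> : (sg * e * k' = sg * (k' * e))%N by ring.
congr (_ * _); rewrite sgQ; apply: (@Pdvd _ _ _ _ _ (hJ * h2)%N).
  by rewrite -sgQ; apply: cell_lt.
rewrite kJE kmidE k1E.
have -> : (2 * Q * u * (k' * e) = 2 * Q * k' * (u * e))%N by ring.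
by rewrite ue; ring.
Qed.

(** The modulus [Q] of both averages divides the difference, so [sum_cell_avg_coarse] gives the same
    value for the block lengths [Q * k1] and [Q * kmid]. *)
Let zero_f2 u : (0 < u < U)%N -> exists rh, (0 < rh <= h2 * g1)%N /\
   forall j y, (y < 2 * Q ^ 2 * u * H)%N -> \sum_(i < rh)
       hh (j * (2 * Q ^ 2 * u * H * rh) + y + 2 * Q ^ 2 * u * H * i)%N *
       (P1 (j * (2 * Q ^ 2 * u * H * rh) + y + 2 * Q ^ 2 * u * H * i)%N -
        P2 (j * (2 * Q ^ 2 * u * H * rh) + y + 2 * Q ^ 2 * u * H * i)%N) = 0.
Proof.
move=> uU; have [g [k1g /andP[g0 gg1]]] := gU uU; exists (h2 * g)%N; split.
  by rewrite muln_gt0 h20 g0 leq_mul2l gg1 orbT.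
move=> j y; set sg := (2 * Q ^ 2 * u * H)%N => ysg.
pose e := (2 * Q * u * H)%N.
have sgQ : sg = (Q * e)%N by rewrite /sg /e; ring.
have e0 : (0 < e)%N by rewrite /e !muln_gt0 Q0 H0; case/andP: uU => ->.
rewrite sgQ (eq_bigr (fun i : 'I_(h2 * g) => hh (j * (Q * e * (h2 * g)) + y)%N *
  (P1 (j * (Q * e * (h2 * g)) + y + Q * e * i)%N - P2 (j * (Q * e * (h2 * g)) + y + Q * e * i)%N))).
  rewrite -big_distrr sumrB /= /P1 /P2.
  rewrite k1g -[(2 * Q * u * H)%N]/e sum_cell_avg_coarse -?sgQ //.
  have := @sum_cell_avg_coarse R B Q e (h2 * g) 1 j y e0.
  rewrite !mul1n -sgQ => /(_ ysg) E2.
  rewrite kmidE k1g -[(2 * Q * u * H)%N]/e (_ : h2 * (e * g) = e * (h2 * g))%N; last by ring.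
  by rewrite E2 subrr mulr0.
move=> i _; congr (_ * _); apply: (@Pdvd _ _ _ _ _ hJ).
  by apply: cell_lt => //; rewrite -sgQ.
by rewrite kJE kmidE k1g -/e; ring.
Qed.

Variable theta : R.
Hypotheses (theta0 : 0 < theta) (thetaE : theta ^+ 2 = eta).

Let kJR0 : 0 < kJ%:R :> R. Proof. by rewrite ltr0n. Qed.
Let kIR0 : 0 < kI%:R :> R. Proof. by rewrite ltr0n. Qed.

Let sum_B : \sum_(x < X) hh x * B x = beta * kJ%:R.
Proof.
rewrite (sum_in_cell B kJ (ltnSn jJ) tQ) /beta mulrC mulrA divff ?mul1r //.
by rewrite pnatr_eq0 -lt0n.
Qed.

Let beta01 : 0 <= beta <= 1.
Proof.
have h0 : 0 <= \sum_(i < kJ) B (jJ * (Q * kJ) + t + Q * i)%N by apply: sumr_ge0.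
have h1 : \sum_(i < kJ) B (jJ * (Q * kJ) + t + Q * i)%N <= kJ%:R.
  by apply: le_trans (ler_sum _ (fun i _ => B_le1 _)) _; rewrite sumr_const card_ord.
by rewrite /beta mulr_ge0 ?invr_ge0 ?ler0n //= mulrC ler_pdivrMr // mul1r.
Qed.

Let alpha01 : 0 <= alpha <= 1.
Proof.
have h0 : 0 <= \sum_(i < kI) A (iI * (Q * kI) + s + Q * i)%N by apply: sumr_ge0.
have h1 : \sum_(i < kI) A (iI * (Q * kI) + s + Q * i)%N <= kI%:R.
  by apply: le_trans (ler_sum _ (fun i _ => A_le1 _)) _; rewrite sumr_const card_ord.
by rewrite /alpha mulr_ge0 ?invr_ge0 ?ler0n //= mulrC ler_pdivrMr // mul1r.
Qed.

Let XE : X = (jJ.+1 * (hJ * h2) * (Q * (4 * Q) * k'))%N.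
Proof. by rewrite /X kJE kmidE k1E; ring. Qed.

Let hh_cell j c i : (c < Q * (4 * Q))%N -> (i < k')%N ->
  hh (j * (Q * (4 * Q) * k') + c + Q * (4 * Q) * i)%N = hh (j * (Q * (4 * Q) * k') + c)%N.
Proof.
move=> cW ik; apply: (@Pdvd _ _ _ _ _ (hJ * h2)%N); first exact: cell_lt.
by rewrite kJE kmidE k1E; ring.
Qed.

Let P0_cell j c i : (c < Q * (4 * Q))%N -> (i < k')%N ->
  P0 (j * (Q * (4 * Q) * k') + c + Q * (4 * Q) * i)%N = P0 (j * (Q * (4 * Q) * k') + c)%N.
Proof.
move=> cW ik.
have E : (j * (Q * (4 * Q) * k') + c = j * (Q * (4 * Q) * k') + c + Q * (4 * Q) * 0)%N.
  by rewrite muln0 addn0.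
by rewrite [in RHS]E /P0 !cell_avgE.
Qed.

Let sum_P0 : \sum_(x < X) hh x * P0 x = beta * kJ%:R.
Proof.
by rewrite -sum_B XE /P0 sum_mul_cell_avg.
Qed.

Let sum_f : \sum_(x < X) f x = 0.
Proof.
rewrite /f (eq_bigr (fun x : 'I_X => hh x * B x - hh x * P0 x)); last by move=> x _; rewrite mulrBr.
by rewrite sumrB sum_P0 sum_B subrr.
Qed.

Let sum_h : \sum_(x < X) hh x = kJ%:R.
Proof.
transitivity (\sum_(i < kJ) (1 : R)); last by rewrite sumr_const card_ord.
rewrite -(sum_in_cell (fun=> 1) kJ (ltnSn jJ) tQ).
by apply: eq_bigr => x _; rewrite mulr1.
Qed.

(** [B] takes the values 0 and 1, so its energy on the cell is [beta * kJ], while its projection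
    [P0] has energy at least [beta ^ 2 * kJ] by Cauchy-Schwarz. *)
Let sum_f_sqr : \sum_(x < X) f x ^+ 2 <= beta * (1 - beta) * kJ%:R.
Proof.
have hh2 x : hh x * hh x = hh x by case: (hh01 x) => ->; rewrite ?mulr0 ?mulr1.
have BB x : B x * B x = B x by case: (B01 x) => ->; rewrite ?mulr0 ?mulr1.
have E : \sum_(x < X) hh x * P0 x * P0 x = \sum_(x < X) hh x * P0 x * B x.
  rewrite XE; apply: (@sum_mul_cell_avg R B (fun x => hh x * P0 x)) => j c i cW ik.
  by rewrite hh_cell // P0_cell.
have -> : \sum_(x < X) f x ^+ 2 = \sum_(x < X) (hh x * B x - (2 * (hh x * P0 x * B x) - hh x * P0 x * P0 x)).
  by apply: eq_bigr => x _; rewrite /f; case: (hh01 x) => ->; case: (B01 x) => ->; ring.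
rewrite sumrB sumrB -big_distrr /= -E sum_B.
have e1 : \sum_(x < X) hh x * (hh x * P0 x) = beta * kJ%:R.
  by rewrite -sum_P0; apply: eq_bigr => x _; rewrite mulrA hh2.
have e2 : \sum_(x < X) hh x ^+ 2 = kJ%:R.
  by rewrite -sum_h; apply: eq_bigr => x _; rewrite expr2 hh2.
have e3 : \sum_(x < X) (hh x * P0 x) ^+ 2 = \sum_(x < X) hh x * P0 x * P0 x.
  by apply: eq_bigr => x _; case: (hh01 x) => ->; ring.
have := sqr_sum_mul_le (index_enum 'I_X) xpredT (fun x : 'I_X => hh x) (fun x => hh x * P0 x).
rewrite e1 e2 e3.
set T := \sum_(x < X) _ => le1.
have : beta ^+ 2 * kJ%:R <= T.
  by rewrite -(ler_pM2l kJR0); apply: le_trans le1; rewrite le_eqVlt; apply/orP; left; apply/eqP; ring.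
lra.
Qed.

Let L0 : 0 <= L%:R :> R. Proof. exact: ler0n. Qed.

Let norm_BP0 x : `|B x - P0 x| <= 1.
Proof. by apply: norm_diff01; rewrite ?P01 ?B_ge0 ?B_le1. Qed.
Let norm_P0P1 x : `|P0 x - P1 x| <= 1.
Proof. by apply: norm_diff01; rewrite P01. Qed.
Let norm_P1P2 x : `|P1 x - P2 x| <= 1.
Proof. by apply: norm_diff01; rewrite P01. Qed.

Let w_bound x : (x <= U * H)%N -> (w + x)%:R <= (1 + eta) * w0.
Proof. by move=> xU; apply: le_trans N1; rewrite ler_nat leq_add2l. Qed.

Let UH1 : (3 <= U * H)%N.
Proof. by apply: leq_trans U3 _; rewrite leq_pmulr. Qed.

Let eta2 : eta * eta <= eta * (1 / 10).
Proof. by apply: ler_wpM2l => //; exact: ltW. Qed.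

(** With a single shift there are no correlations to cancel; the smallness comes entirely from
    [energy]. *)
Let bound_f1 : \sum_(0 <= a < Z | Ps a) S f1 a ^+ 2 <= 2 * eta * (kI%:R * w0 ^+ 2).
Proof.
have := @vdc_gen (fun x => P0 x - P1 x) 1 1 0 isT (ltnW (ltnW UH1)) norm_P0P1.
move=> /(_ (fun u hu => ltac:(by exfalso; move: hu; case: (u) => [|[]]))) .
rewrite expr1n !mul1r !muln0 !mulr0 addr0 => h; apply: le_trans h _.
have e1 : L%:R * \sum_(0 <= x < X) f1 x ^+ 2 <= eta * (1 + eta) * (kI%:R * w0).
  rewrite big_mkord.
  apply: le_trans (ler_wpM2l L0 energy) _.
  have := ler_wpM2l (ltW eta0) N2; lra.
have wb := w_bound (ltnW (ltnW UH1)).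
apply: le_trans (ler_pM _ _ wb e1) _ => //.
  by rewrite mulr_ge0 // sumr_ge0 // => x _; exact: sqr_ge0.
have N0 : 0 <= eta * (kI%:R * w0 ^+ 2) by rewrite !mulr_ge0 ?sqr_ge0 // ltW.
have -> : (1 + eta) * w0 * (eta * (1 + eta) * (kI%:R * w0)) =
  (1 + eta) ^+ 2 * (eta * (kI%:R * w0 ^+ 2)) by ring.
rewrite -mulrA; apply: ler_wpM2r => //; move: eta2 eta0 eta1; lra.
Qed.

(** The diagonal loses a factor 1/U, which [N4] turns into [eta]. Here many shifts are available,
    since [gU] supplies the divisibility for every [u < U]. *)
Let bound_f2 : \sum_(0 <= a < Z | Ps a) S f2 a ^+ 2 <= 3 * eta * (kI%:R * w0 ^+ 2).
Proof.
have := @vdc_gen (fun x => P1 x - P2 x) U H (h2 * g1) H0 (leqnn _) norm_P1P2.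
move=> /(_ zero_f2); have [_ _ _ _ F2] := supp_norm norm_P1P2.
set T := \sum_(0 <= a < Z | Ps a) _ => h.
have U0 : 0 < U%:R :> R by rewrite ltr0n; apply: leq_trans U3.
have N0 : 0 <= kI%:R * w0 by rewrite mulr_ge0 // ltW.
have e1 : L%:R * \sum_(0 <= x < X) (hh x * (P1 x - P2 x)) ^+ 2 <= (1 + eta) * (kI%:R * w0).
  by apply: le_trans (ler_wpM2l L0 F2) N2.
have e2 : U%:R * L%:R * \sum_(0 <= x < X) (hh x * (P1 x - P2 x)) ^+ 2 +
     U%:R ^+ 2 * (kJ%:R * (2 * (h2 * g1))%:R) <= U%:R ^+ 2 * (eta * (2 + eta) * (kI%:R * w0)).
  have a1 := ler_wpM2l (ltW U0) e1.
  have a2 := ler_wpM2l (sqr_ge0 U%:R) N3'.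
  have a3 : U%:R * ((1 + eta) * (kI%:R * w0)) <= U%:R ^+ 2 * (eta * (1 + eta) * (kI%:R * w0)).
    have e0 : 0 <= U%:R * ((1 + eta) * (kI%:R * w0)).
      by rewrite !mulr_ge0 ?addr_ge0 ?ler01 ?ltW.
    by have := ler_wpM2l e0 N4; lra.
  lra.
have h' := le_trans h (ler_pM (ler0n _ _) _ N1 e2).
have {}h' : U%:R ^+ 2 * T <= U%:R ^+ 2 * ((1 + eta) * w0 * (eta * (2 + eta) * (kI%:R * w0))).
  apply: le_trans (h' _) _.
    apply: addr_ge0; last by rewrite !mulr_ge0.
    apply: mulr_ge0; first by rewrite mulr_ge0 ?L0 // ltW.
    by apply: sumr_ge0 => x _; exact: sqr_ge0.
  by lra.
have : T <= (1 + eta) * w0 * (eta * (2 + eta) * (kI%:R * w0)).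
  by rewrite -(ler_pM2l (exprn_gt0 2 U0)).
move=> h3; apply: le_trans h3 _.
have N1' : 0 <= eta * (kI%:R * w0 ^+ 2) by rewrite !mulr_ge0 ?sqr_ge0 // ltW.
have -> : (1 + eta) * w0 * (eta * (2 + eta) * (kI%:R * w0)) =
  ((1 + eta) * (2 + eta)) * (eta * (kI%:R * w0 ^+ 2)) by ring.
rewrite -[3 * eta * _]mulrA; apply: ler_wpM2r => //; move: eta2 eta0 eta1; lra.
Qed.

(* With only three shifts, van der Corput bounds the second moment of [f] by a third of the variance of [B]. *)
Let bound_f : \sum_(0 <= a < Z | Ps a) S f a ^+ 2 <=
  (beta * (1 - beta) / 3 + 3 * eta) * (kI%:R * w0 ^+ 2).
Proof.
have := @vdc_gen (fun x => B x - P0 x) 3 1 (2 * k') isT UH1 norm_BP0 zero_f.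
set T := \sum_(0 <= a < Z | Ps a) _; rewrite big_mkord => h.
have /andP[b0 b1] := beta01.
have N0 : 0 <= kI%:R * w0 by rewrite mulr_ge0 // ltW.
have bb0 : 0 <= beta * (1 - beta) by rewrite mulr_ge0 // subr_ge0.
have e1 : L%:R * \sum_(x < X) f x ^+ 2 <= beta * (1 - beta) * ((1 + eta) * (kI%:R * w0)).
  apply: le_trans (ler_wpM2l L0 sum_f_sqr) _.
  by have := ler_wpM2l bb0 N2; lra.
have wb := w_bound UH1.
have e2 : 3 * L%:R * \sum_(x < X) f x ^+ 2 + 3 ^+ 2 * (kJ%:R * (2 * (2 * k'))%:R) <=
   9 * ((beta * (1 - beta) / 3 * (1 + eta) + eta) * (kI%:R * w0)).
  by move: N3 e1; lra.
have h' := le_trans h (ler_pM (ler0n _ _) _ wb e2).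
have h3 : T <= (1 + eta) * w0 * ((beta * (1 - beta) / 3 * (1 + eta) + eta) * (kI%:R * w0)).
  suff /h' : 0 <= 3 * L%:R * \sum_(x < X) f x ^+ 2 + 3 ^+ 2 * (kJ%:R * (2 * (2 * k'))%:R) by lra.
  by rewrite addr_ge0 ?mulr_ge0 ?exprn_ge0 ?ler0n ?sumr_ge0 // => x _; exact: sqr_ge0.
apply: le_trans h3 _.
have N1' : 0 <= (kI%:R * w0 ^+ 2) by rewrite !mulr_ge0 ?sqr_ge0 // ltW.
have -> : (1 + eta) * w0 * ((beta * (1 - beta) / 3 * (1 + eta) + eta) * (kI%:R * w0)) =
  ((1 + eta) * (beta * (1 - beta) / 3 * (1 + eta) + eta)) * (kI%:R * w0 ^+ 2) by ring.
apply: ler_wpM2r => //.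
have bb1 : beta * (1 - beta) <= 1 / 4 by have := sqr_ge0 (beta - 1 / 2); lra.
exact: variance_slack.
Qed.

Let sum_Ps (F : nat -> R) : \sum_(0 <= a < Z | Ps a) F a =
  \sum_(i < kI) F (iI * (Q * kI) + s + Q * i)%N.
Proof.
rewrite -(sum_in_cell F kI (ltnSn iI) sQ) big_mkcond /=.
have E a : (if Ps a then F a else 0) = (Ps a)%:R * F a.
  by case: (Ps a); rewrite ?mul1r ?mul0r.
rewrite (eq_bigr _ (fun a _ => E a)).
rewrite (@sum_nat_supp _ _ 0 Z 0 (iI.+1 * (Q * kI))) ?big_mkord //.
  by rewrite mulSn addnC.
move=> a aZ; rewrite (negbTE (_ : ~~ Ps a)) ?mul0r //.
apply: contra aZ => /Ps_bound[/andP[_ +] _].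
by rewrite /i0 /lI mulSn addnC.
Qed.

Let resid a n : Ps a -> (a <= m n)%N -> ((m n - a) %% Q = t)%N.
Proof.
move=> /Ps_bound[_ as_] an; apply/eqP; rewrite -(modn_small tQ).
rewrite -(eqn_modDl a) subnKC //.
have -> : (m n = r ^ 2 %[mod Q])%N.
  rewrite /m; have -> : ((r + Q * n) ^ 2 = (2 * r * n + Q * n ^ 2) * Q + r ^ 2)%N by ring.
  by rewrite modnMDl.
by rewrite -srt -[X in _ == X]modnDml as_.
Qed.

(** [P2] is constant on the [hJ] sub-blocks of the cell, and by [midcnt] each translated sub-block
    receives nearly its share [w0 / hJ] of the roots. This holds for each [a] separately. *)
Let main_term a : Ps a -> (1 - eta) * w0 * beta <= S (fun x => hh x * P2 x) a.
Proof.
move=> Pa; have [ab _] := Ps_bound Pa.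
pose phi mu : R := kmid%:R^-1 * \sum_(i < kmid) B ((jJ * hJ + mu) * (Q * kmid) + t + Q * i)%N.
have phi0 mu : 0 <= phi mu by rewrite mulr_ge0 ?invr_ge0 ?ler0n // sumr_ge0.
have sum_phi : \sum_(mu < hJ) phi mu = hJ%:R * beta.
  rewrite -big_distrr /=.
  have -> : \sum_(mu < hJ) \sum_(i < kmid) B ((jJ * hJ + mu) * (Q * kmid) + t + Q * i)%N =
    kJ%:R * beta.
    rewrite /beta mulrA divff ?pnatr_eq0 -?lt0n // mul1r.
    pose G i := B (jJ * (Q * kJ) + t + Q * i)%N.
    rewrite -(big_mkord xpredT G) [X in \sum_(0 <= i < X) _]kJE big_mkord /G.
    rewrite (sum_ord_mul (fun i => B (jJ * (Q * kJ) + t + Q * i)%N)).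
    by apply: eq_bigr => mu _; apply: eq_bigr => i _; congr B; rewrite kJE; ring.
  by rewrite kJE natrM; field; rewrite pnatr_eq0 -lt0n.
have split x : hh x * P2 x = \sum_(mu < hJ) (in_cell kmid Q (jJ * hJ + mu) t x)%:R * phi mu.
  rewrite /hh /in_cell; case: (eqVneq (x %% Q)%N t) => [xt|_]; last first.
    rewrite andbF mul0r big1 // => mu _; by rewrite andbF mul0r.
  set q := (x %/ (Q * kmid))%N.
  have -> : (x %/ (Q * kJ) = q %/ hJ)%N by rewrite /q -divnMA kJE; congr (x %/ _)%N; ring.
  have qlt : (q %% hJ < hJ)%N by rewrite ltn_mod.
  have eqq (mu : 'I_hJ) : (q == jJ * hJ + mu)%N = (q %/ hJ == jJ)%N && (mu == Ordinal qlt).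
    apply/eqP/andP => [qE|[/eqP <- /eqP ->]]; last by rewrite /= -divn_eq.
    split; first by rewrite qE divnMDl // divn_small // addn0.
    by apply/eqP/val_inj; rewrite /= qE modnMDl modn_small.
  rewrite (bigD1 (Ordinal qlt)) //= big1 ?addr0 => [|mu mun]; last first.
    by rewrite eqq (negbTE mun) andbF mul0r.
  have := eqq (Ordinal qlt); rewrite /= eqxx andbT => ->; rewrite andbT.
  case: (eqVneq (q %/ hJ)%N jJ) => [qj|]; last by rewrite !mul0r.
  by rewrite !mul1r /P2 /cell_avg -/q xt /phi -qj -divn_eq.
have cell n mu : (mu < hJ)%N -> in_cell kmid Q (jJ * hJ + mu) t (m n - a)%N =
   (a + (j0 + mu * lmid) <= m n < a + (j0 + mu * lmid) + lmid)%N.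
  move=> mulH; have z0 : (0 < j0)%N by rewrite /j0 !muln_gt0 jJ0 Q0 kJ0.
  rewrite /in_cell divn_eq_interval ?muln_gt0 ?Q0 ?kmid0 //.
  have -> : ((jJ * hJ + mu) * (Q * kmid) = j0 + mu * lmid)%N by rewrite /j0 /lmid kJE; ring.
  apply/andP/idP => [[h _]|h].
    by move: h z0; rewrite -/lmid; move: (m n) (mu * lmid)%N; clear; lia.
  split; first by move: h z0; rewrite -/lmid; move: (m n) (mu * lmid)%N; clear; lia.
  by rewrite resid //; move: h; clear; lia.
have mid mu : (mu < hJ)%N -> (1 - eta) * w0 <= hJ%:R * cnt (a + (j0 + mu * lmid)) lmid.
  move=> muh; apply: midcnt; first by move: ab; clear; lia.
  have : (mu * lmid + lmid <= lJ)%N.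
    rewrite -mulSnr; apply: leq_trans (leq_mul muh (leqnn _)) _.
    by rewrite /lmid /lJ kJE; apply/eq_leq; ring.
  by move: ab; move: (mu * lmid)%N; clear; lia.
have hJR : 0 < hJ%:R :> R by rewrite ltr0n.
have -> : S (fun x => hh x * P2 x) a =
   \sum_(mu < hJ) phi mu * cnt (a + (j0 + mu * lmid)) lmid.
  rewrite /S (eq_bigr _ (fun n _ => split (m n - a)%N)) exchange_big /=.
  apply: eq_bigr => mu _; rewrite /cnt big_distrr /=; apply: eq_bigr => n _.
  by rewrite mulrC cell.
rewrite -(ler_pM2l hJR) big_distrr /=.
have -> : hJ%:R * ((1 - eta) * w0 * beta) = (1 - eta) * w0 * (hJ%:R * beta) by ring.
rewrite -sum_phi big_distrr /=; apply: ler_sum => mu _.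
by rewrite [leRHS]mulrCA [leLHS]mulrC; apply: ler_wpM2l => //; exact: mid.
Qed.

(** For fixed [n], as [a] runs through the cell of [A], [m n - a] sweeps the whole cell of [B],
    where [f] sums to zero. Exceptions are the [n] for which [m n] falls in one of two intervals of
    length [lJ], starting at [z1] and [z2]; there are at most [w] of each kind, and each costs at
    most [kJ]. *)
Let boundary : `|\sum_(0 <= a < Z | Ps a) S f a| <= (2 * w * kJ)%:R.
Proof.
have [F1 F2' F3' F4 _] := supp_norm norm_BP0.
have F2 x : (X <= x)%N -> f x = 0 := F2' x.
have F3 : f 0%N = 0 := F3'.
have f_supp x : f x != 0 -> hh x != 0 by rewrite mulf_eq0 negb_or => /andP[].
rewrite exchange_big /=; apply: le_trans (ler_norm_sum _ _ _) _.
pose z1 := (i0 + j0)%N; pose z2 := (i0 + j0 + lI)%N.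
have cnt_w z : (i0 + j0 <= z <= i0 + j0 + lI)%N -> cnt z lJ <= w%:R.
  move=> /window[nu nuP]; apply: (@le_trans _ _ (\sum_(0 <= n < K) ((nu <= n < nu + w)%N)%:R)).
    apply: ler_sum => n _; rewrite ler_nat.
    by move: (nuP n); case: (z <= m n < z + lJ)%N => // ->.
  by apply: le_trans (sum_nat_indicator_le _ _ _ _ _) _; rewrite addKn.
have sumabs M : \sum_(0 <= a < Z) `|f (M - a)%N| <= kJ%:R.
  apply: le_trans F4.
  apply: (@le_trans _ _ (\sum_(0 <= a < Z + M.+1) `|f (M - a)%N|)).
    by rewrite sum_nat_split lerDl; apply: sumr_ge0.
  rewrite (@sum_nat_supp _ _ 0 (Z + M.+1) 0 M.+1) ?leq_addl //; last first.
    move=> a aM; have -> : (M - a = 0)%N by move: aM; clear; lia.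
    by rewrite F3 normr0.
  rewrite big_nat_rev /= add0n.
  apply: (@le_trans _ _ (\sum_(0 <= x < M.+1 + X) `|f x|)).
    rewrite sum_nat_split.
    have -> : \sum_(0 <= a < M.+1) `|f (M - (M.+1 - a.+1))%N| = \sum_(0 <= a < M.+1) `|f a|.
      by apply: eq_big_nat => a aM; congr (`|f _|); move: aM; clear; lia.
    by rewrite lerDl; apply: sumr_ge0.
  rewrite (@sum_nat_supp _ _ 0 (M.+1 + X) 0 X) ?leq_addl // => x xX.
  by rewrite F2 ?normr0 //; move: xX; clear; lia.
have Tn n : `|\sum_(0 <= a < Z | Ps a) f (m n - a)%N| <=
   kJ%:R * (((z1 <= m n < z1 + lJ)%N)%:R + ((z2 <= m n < z2 + lJ)%N)%:R).
  case: (boolP ((z1 <= m n < z1 + lJ) || (z2 <= m n < z2 + lJ))%N) => [h12|].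
    apply: (@le_trans _ _ kJ%:R); last first.
      by case/orP: h12 => ->; rewrite ?addr0 ?add0r ler_peMr ?lerDl ?lerDr.
    apply: le_trans (ler_norm_sum _ _ _) _; apply: le_trans (sumabs (m n)).
    by rewrite [leRHS](bigID Ps) /= lerDl; apply: sumr_ge0.
  rewrite negb_or => /andP[h1 h2'].
  rewrite (negbTE h1) (negbTE h2') addr0 mulr0.
  have [out|ins] := boolP ((m n < z1) || (z2 + lJ <= m n))%N.
    rewrite big1 ?normr0 // => a Pa; apply/eqP; apply: contraTT out => /f_supp /(hit Pa)[_ + _].
    by rewrite /z1 /z2; move: (m n); clear; lia.
  suff -> : \sum_(0 <= a < Z | Ps a) f (m n - a)%N = 0 by rewrite normr0.
  have {}ins : (i0 + j0 + lJ <= m n < i0 + j0 + lI)%N.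
    by move: ins h1 h2'; rewrite /z1 /z2; move: (m n); clear; lia.
  have E a : (a <= m n)%N -> (m n - a < X)%N -> (j0 <= m n - a)%N -> ~~ Ps a -> f (m n - a)%N = 0.
    move=> an ltX gej nPa; apply/eqP; apply: contraNT nPa => /f_supp /hh_supp[_ xt].
    rewrite /Ps /in_cell divn_eq_interval ?muln_gt0 ?Q0 ?kI0 //.
    apply/andP; split.
      move: ltX ins gej an; rewrite /X mulSn -/j0 -/lJ -/i0 -/lI.
      by move: (m n); clear; lia.
    rewrite -(modn_small sQ) -(eqn_modDr t) srt.
    have mr : (m n = r ^ 2 %[mod Q])%N.
      rewrite /m; have -> : ((r + Q * n) ^ 2 = (2 * r * n + Q * n ^ 2) * Q + r ^ 2)%N by ring.
      by rewrite modnMDl.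
    by rewrite -xt modnDmr subnKC // mr.
  have -> : \sum_(0 <= a < Z | Ps a) f (m n - a)%N = \sum_(0 <= a < Z + (m n).+1) f (m n - a)%N.
    have nP a : ~~ Ps a -> f (m n - a)%N = 0.
      move=> nPa; case: (leqP a (m n)) => an; last first.
        by have -> : (m n - a = 0)%N by move: an; clear; lia.
      case: (ltnP (m n - a) X) => [lt|ge]; last by rewrite F2.
      case: (leqP j0 (m n - a)) => [ge|ltj]; first exact: E.
      apply/eqP; apply: contraTT ltj => /f_supp /hh_supp[/andP[+ _] _].
      by rewrite -leqNgt.
    rewrite [RHS]sum_nat_split [X in _ = X + _](bigID Ps) /=.
    rewrite [X in _ + X + _]big1 ?addr0 ?[X in _ + X]big1 ?addr0 // => i _; apply: nP.
    apply/negP => /Ps_bound[/andP[_ +] _].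
    by move: hZI; clear; lia.
  rewrite (@sum_nat_supp _ _ 0 (Z + (m n).+1) 0 (m n).+1) ?leq_addl //; last first.
    move=> a aM; have -> : (m n - a = 0)%N by move: aM; clear; lia.
    by rewrite F3.
  rewrite big_nat_rev /= add0n.
  have -> : \sum_(0 <= a < (m n).+1) f (m n - ((m n).+1 - a.+1))%N = \sum_(0 <= a < (m n).+1) f a.
    by apply: eq_big_nat => a aM; congr (f _); move: aM; move: (m n); clear; lia.
  rewrite (@sum_nat_supp _ _ 0 (m n).+1 0 X) //; last first.
  - by move=> x xX; rewrite F2 //; move: xX; clear; lia.
  - by rewrite /X mulSn -/j0 -/lJ; move: ins; move: (m n); clear; lia.
  by rewrite big_mkord sum_f.
apply: le_trans (ler_sum _ (fun n _ => Tn n)) _.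
rewrite -big_distrr big_split /= -/(cnt z1 lJ) -/(cnt z2 lJ).
rewrite natrM mulrC; apply: ler_wpM2r => //; rewrite mul2n -addnn natrD.
by apply: lerD; apply: cnt_w; rewrite /z1 /z2 ?leqnn ?leq_addr.
Qed.

(** Against [f], [A] is split into its mean [alpha], treated by [boundary], and a fluctuation of
    variance [alpha * (1 - alpha)]. AM-GM gives away half of the main term [alpha * beta] and
    [(1 - alpha) * (1 - beta) / 6]. The errors are [2 * theta] each from [f1] and [f2], [theta] each
    from the two parts against [f], and [theta / 3] from the main term. *)
Lemma local_count :
  kI%:R * w0 * (alpha * beta / 2 - (1 - alpha) * (1 - beta) / 6 - 7 * theta) <=
  \sum_(0 <= a < Z | Ps a) A a * S (fun x => hh x * B x) a.
Proof.
pose N := kI%:R * w0.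
have N0 : 0 < N by rewrite mulr_gt0.
have /andP[al0 al1] := alpha01; have /andP[b0 b1] := beta01.
have t1 : theta <= 1 / 3 by move: eta1; rewrite -thetaE => h; nra.
have etath : eta <= theta / 3 by rewrite -thetaE; have := ler_wpM2l (ltW theta0) t1; lra.
have dec a : S (fun x => hh x * B x) a =
   S (fun x => hh x * P2 x) a + S f1 a + S f2 a + S f a.
  rewrite /S -!big_split /=; apply: eq_bigr => n _; rewrite /f /f1 /f2; ring.
rewrite (eq_bigr (fun a => A a * S (fun x => hh x * P2 x) a + A a * S f1 a + A a * S f2 a +
   ((A a - alpha) * S f a + alpha * S f a))); last by move=> a _; rewrite dec; ring.
rewrite !big_split /= -big_distrr /=.
have sumA : \sum_(0 <= a < Z | Ps a) A a = alpha * kI%:R.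
  by rewrite sum_Ps /alpha mulrC mulrA divff ?mul1r // pnatr_eq0 -lt0n.
have sumA2 : \sum_(0 <= a < Z | Ps a) A a ^+ 2 = alpha * kI%:R.
  rewrite -sumA; apply: eq_bigr => a _.
  by case: (A01 a) => ->; rewrite ?expr0n ?expr1n.
have sumAv : \sum_(0 <= a < Z | Ps a) (A a - alpha) ^+ 2 = alpha * (1 - alpha) * kI%:R.
  transitivity (\sum_(0 <= a < Z | Ps a) (A a ^+ 2 - (2 * alpha) * A a + alpha ^+ 2)).
    by apply: eq_bigr => a _; ring.
  rewrite big_split sumrB /= -big_distrr /= sumA sumA2 sum_Ps sumr_const card_ord.
  by rewrite -[_ *+ kI]mulr_natl; ring.
have main : N * ((1 - eta) * (alpha * beta)) <=
    \sum_(0 <= a < Z | Ps a) A a * S (fun x => hh x * P2 x) a.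
  have -> : N * ((1 - eta) * (alpha * beta)) = (1 - eta) * w0 * beta * (alpha * kI%:R).
    by rewrite /N; ring.
  rewrite -sumA big_distrr /=; apply: ler_sum => a Pa.
  by rewrite mulrC; apply: ler_wpM2l => //; exact: main_term.
have cs (F G : nat -> R) c d : 0 <= c -> \sum_(0 <= a < Z | Ps a) F a ^+ 2 <= d * kI%:R ->
   \sum_(0 <= a < Z | Ps a) G a ^+ 2 <= c * (kI%:R * w0 ^+ 2) ->
   (\sum_(0 <= a < Z | Ps a) F a * G a) ^+ 2 <= N ^+ 2 * (d * c).
  move=> c0 h1 h2'; apply: le_trans (sqr_sum_mul_le _ _ _ _) _.
  apply: le_trans (ler_pM _ _ h1 h2') _; try by apply: sumr_ge0 => *; exact: sqr_ge0.
  by rewrite le_eqVlt; apply/orP; left; apply/eqP; rewrite /N; ring.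
have small (F : nat -> R) c : 0 <= c <= 3 -> \sum_(0 <= a < Z | Ps a) F a ^+ 2 <=
    c * eta * (kI%:R * w0 ^+ 2) -> - (N * (2 * theta)) <= \sum_(0 <= a < Z | Ps a) A a * F a.
  move=> /andP[c0 c3] hF.
  have ce0 : 0 <= c * eta by rewrite mulr_ge0 // ltW.
  have := cs A F (c * eta) 1 ce0 _ hF; rewrite sumA2 => /(_ _) h.
  rewrite lerNl; apply: ler_of_sqr; first by rewrite !mulr_ge0 ?ltW.
  rewrite sqrrN; apply: le_trans (h _) _.
    by apply: ler_wpM2r.
  rewrite [leRHS]exprMn; apply: ler_wpM2l; first exact: sqr_ge0.
  by rewrite [leRHS]exprMn thetaE mul1r; apply: ler_wpM2r; [exact: ltW|lra].
have e1 := small _ 2 _ bound_f1; have {}e1 := e1 ltac:(lra).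
have e2 := small _ 3 _ bound_f2; have {}e2 := e2 ltac:(lra).
have bb0 : 0 <= beta * (1 - beta) by rewrite mulr_ge0 // subr_ge0.
have e3 : - (N * ((alpha * beta + (1 - alpha) * (1 - beta) / 3) / 2 + theta)) <=
    \sum_(0 <= a < Z | Ps a) (A a - alpha) * S f a.
  have XY0 : 0 <= alpha * beta by rewrite mulr_ge0.
  have XY1 : 0 <= (1 - alpha) * (1 - beta) by rewrite mulr_ge0 // subr_ge0.
  have c0 : 0 <= beta * (1 - beta) / 3 + 3 * eta by move: eta0; lra.
  have := cs (fun a => A a - alpha) (S f) _ (alpha * (1 - alpha)) c0 _ bound_f.
  rewrite sumAv lexx => /(_ isT) h.
  rewrite lerNl; apply: ler_of_sqr.
    by apply: mulr_ge0; [exact: ltW|move: XY0 XY1 theta0; lra].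
  rewrite sqrrN; apply: le_trans h _; rewrite [leRHS]exprMn; apply: ler_wpM2l; first exact: sqr_ge0.
  have aa1 : alpha * (1 - alpha) <= 1 / 4 by have := sqr_ge0 (alpha - 1 / 2); lra.
  have h1 : alpha * (1 - alpha) * eta <= 1 / 4 * theta ^+ 2.
    by rewrite thetaE; apply: ler_wpM2r => //; exact: ltW.
  (* AM-GM: [sqrt (x y (1 - x) (1 - y) / 3) <= (x y + (1 - x) (1 - y) / 3) / 2] *)
  have h2' := sqr_ge0 (alpha * beta - (1 - alpha) * (1 - beta) / 3).
  have h3 : 0 <= theta * (alpha * beta + (1 - alpha) * (1 - beta) / 3).
    by apply: mulr_ge0; [exact: ltW|move: XY0 XY1; lra].
  have h4 := sqr_ge0 theta.
  move: h1 h2' h3 h4; set Xab := alpha * beta; set Y := (1 - alpha) * (1 - beta).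
  move=> h1 h2' h3 h4.
  have -> : alpha * (1 - alpha) * (beta * (1 - beta) / 3 + 3 * eta) =
     Xab * Y / 3 + 3 * (alpha * (1 - alpha) * eta) by rewrite /Xab /Y; ring.
  move: (alpha * (1 - alpha) * eta) h1 => z h1.
  by move: (Xab) (Y) h2' h3 => x y h2' h3; lra.
have e4 : - (N * theta) <= alpha * \sum_(0 <= a < Z | Ps a) S f a.
  have h1 : `|\sum_(0 <= a < Z | Ps a) S f a| <= N * theta.
    apply: le_trans boundary _; apply: le_trans N5 _; rewrite mulrC; apply: ler_wpM2l; first exact: ltW.
    by apply: le_trans etath _; move: theta0; lra.
  have : `|alpha * \sum_(0 <= a < Z | Ps a) S f a| <= N * theta.
    rewrite normrM (ger0_norm al0); apply: le_trans h1.
    exact: ler_piMl.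
  by rewrite ler_norml => /andP[].
have : N * (eta * (alpha * beta)) <= N * (theta / 3).
  apply: ler_wpM2l; first exact: ltW.
  apply: le_trans etath; rewrite ler_piMr ?(ltW eta0) //.
  by rewrite mulr_ile1.
move: main e1 e2 e3 e4; rewrite -/N.
move: (\sum_(0 <= a < Z | Ps a) A a * S (fun x => hh x * P2 x) a) => s1.
move: (\sum_(0 <= a < Z | Ps a) A a * S f1 a) => s2.
move: (\sum_(0 <= a < Z | Ps a) A a * S f2 a) => s3.
move: (\sum_(0 <= a < Z | Ps a) (A a - alpha) * S f a) => s4.
move: (alpha * \sum_(0 <= a < Z | Ps a) S f a) => s5.
have : 0 <= N * theta by rewrite mulr_ge0 // ltW.
lra.
Qed.

End Local.

(** * Combinatorics of densities in residue classes *)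

Fixpoint bit_seqs (n : nat) : seq (seq bool) :=
  if n is n'.+1 then [seq true :: s | s <- bit_seqs n'] ++ [seq false :: s | s <- bit_seqs n']
  else [:: [::]].

Lemma mem_bit_seqs (s : seq bool) : s \in bit_seqs (size s).
Proof.
elim: s => //= b s IH; rewrite mem_cat; apply/orP.
by case: b; [left|right]; apply/mapP; exists s.
Qed.

(** Positions at which the two densities add up to at most about 1, by the sum conditions for the
    classes 0 and 4 modulo 8. *)
Definition incompatible_pairs : seq (nat * nat) :=
  [seq (i, i) | i <- iota 0 8] ++ [seq ((i + 4) %% 8, i)%N | i <- iota 0 8].

(** Bits mark the classes whose density exceeds a small threshold. Each incompatible pair lowers the
    total by about 1, and two pairs can both be charged when they share no position: hence 6 bits, 7
    with one pair, or 8 with two disjoint pairs. Both sequences need two bits: a single class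
    against seven others has 8 bits but no two disjoint pairs. *)
Definition stable_bits_ok (u v : seq bool) : bool :=
  let n := (count id u + count id v)%N in
  let ps := [seq p <- incompatible_pairs | nth false u p.1 && nth false v p.2] in
  [&& all (fun i => ~~ (nth false u ((i + 1) %% 8) && nth false v i)) (iota 0 8),
      2 <= count id u & 2 <= count id v]%N ==>
  [|| n <= 6, (n <= 7) && (ps != [::]) |
    (n <= 8) && has (fun p => has (fun q => (p.1 != q.1) && (p.2 != q.2)) ps) ps]%N.

Lemma all_stable_bits_ok : all (fun u => all (stable_bits_ok u) (bit_seqs 8)) (bit_seqs 8).
Proof. by vm_compute. Qed.

Lemma stable_bits (u v : seq bool) : size u = 8%N -> size v = 8%N -> stable_bits_ok u v.
Proof.
move=> su sv; have mu := mem_bit_seqs u; have mv := mem_bit_seqs v.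
rewrite su in mu; rewrite sv in mv.
by have /allP/(_ _ mu)/allP/(_ _ mv) := all_stable_bits_ok.
Qed.

Lemma count_mkseq (p : nat -> bool) (n : nat) :
  count id (mkseq p n) = (\sum_(i < n) (p i : nat))%N.
Proof.
rewrite -sum1_count /mkseq big_map big_mkcond /= -(big_mkord xpredT (fun i => p i : nat)).
by rewrite /index_iota subn0; apply: eq_bigr => i _; case: (p i).
Qed.

Section StablePairs.

Variables (R : realFieldType) (X Y : nat -> R) (k : R).
Hypotheses (k0 : 0 <= k) (k1 : k <= 1).
Hypotheses (Xper : forall i, X (i + 8)%N = X i) (Yper : forall i, Y (i + 8)%N = Y i).
Hypotheses (X01 : forall i, 0 <= X i <= 1) (Y01 : forall i, 0 <= Y i <= 1).
Hypothesis T1 : forall i, X (i + 1)%N <= k \/ Y i <= k.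
Hypothesis T0 : forall i, X i + Y i <= 1 + k.
Hypothesis T4 : forall i, X (i + 4)%N + Y i <= 1 + k.

Let u := mkseq (fun i => k < X i) 8.
Let v := mkseq (fun i => k < Y i) 8.

(** [dX] and [dY] measure how far a value lies below its rounding to [k] or 1. The rounded total is
    16k plus [1 - k] per bit, and each incompatible pair contributes slack [1 - k]. Effectively 6
    bits remain: 16k + 6(1 - k) = 6 + 10k. *)
Lemma stable_pair_middle : (2 <= count id u)%N -> (2 <= count id v)%N ->
  \sum_(i < 8) X i + \sum_(i < 8) Y i <= 6 + 10 * k.
Proof.
move=> cu cv.
have su : size u = 8%N by rewrite size_mkseq.
have sv : size v = 8%N by rewrite size_mkseq.
have modX i : X (i %% 8)%N = X i.
  rewrite {2}(divn_eq i 8); elim: (i %/ 8)%N => [|d IH]; first by rewrite mul0n add0n.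
  by rewrite IH -Xper; congr X; rewrite mulSn; lia.
pose dX i := k + (1 - k) * (k < X i)%R%:R - X i.
pose dY i := k + (1 - k) * (k < Y i)%R%:R - Y i.
have dX0 i : 0 <= dX i.
  by rewrite /dX; case: ltP => h; have /andP[? ?] := X01 i; rewrite ?mulr1 ?mulr0; lra.
have dY0 i : 0 <= dY i.
  by rewrite /dY; case: ltP => h; have /andP[? ?] := Y01 i; rewrite ?mulr1 ?mulr0; lra.
have cuE : (count id u)%:R = \sum_(i < 8) (k < X i)%R%:R :> R by rewrite /u count_mkseq natr_sum.
have cX : \sum_(i < 8) dX i = 8 * k + (1 - k) * (count id u)%:R - \sum_(i < 8) X i.
  by rewrite cuE sumrB big_split sumr_const card_ord -big_distrr /= -[k *+ 8]mulr_natl.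
have cvE : (count id v)%:R = \sum_(i < 8) (k < Y i)%R%:R :> R by rewrite /v count_mkseq natr_sum.
have cY : \sum_(i < 8) dY i = 8 * k + (1 - k) * (count id v)%:R - \sum_(i < 8) Y i.
  by rewrite cvE sumrB big_split sumr_const card_ord -big_distrr /= -[k *+ 8]mulr_natl.
have mono m : (count id u + count id v <= m + 6)%N -> (1 - k) * m%:R <= \sum_(i < 8) dX i + \sum_(i < 8) dY i ->
    \sum_(i < 8) X i + \sum_(i < 8) Y i <= 6 + 10 * k.
  rewrite cX cY -(ler_nat R) !natrD => h1 h2.
  have k1' : 0 <= 1 - k by rewrite subr_ge0.
  by have := ler_wpM2l k1' h1; lra.
have SX0 : 0 <= \sum_(i < 8) dX i by apply: sumr_ge0.
have SY0 : 0 <= \sum_(i < 8) dY i by apply: sumr_ge0.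
have uE i : (i < 8)%N -> nth false u i = (k < X i) by move=> i8; rewrite nth_mkseq.
have vE i : (i < 8)%N -> nth false v i = (k < Y i) by move=> i8; rewrite nth_mkseq.
have pairP p : p \in [seq p <- incompatible_pairs | nth false u p.1 && nth false v p.2] ->
    [/\ (p.1 < 8)%N, (p.2 < 8)%N & 1 - k <= dX p.1 + dY p.2].
  rewrite mem_filter => /andP[/andP[up vp]].
  have common i j : (i < 8)%N -> (j < 8)%N -> X i + Y j <= 1 + k ->
     nth false u i -> nth false v j -> 1 - k <= dX i + dY j.
    by move=> i8 j8 XY; rewrite uE // vE // /dX /dY => -> ->; rewrite !mulr1; lra.
  rewrite mem_cat => /orP[] /mapP[i]; rewrite mem_iota => /andP[_ i8] pE.
    by rewrite pE /= in up vp *; split => //; apply: common.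
  rewrite pE /= in up vp *; have m8 : ((i + 4) %% 8 < 8)%N by rewrite ltn_mod.
  by split => //; apply: common => //; rewrite modX.
have := stable_bits su sv; rewrite /stable_bits_ok; move/implyP => /(_ _) H.
have {H} : [|| count id u + count id v <= 6, (count id u + count id v <= 7) && ([seq p <- incompatible_pairs | nth false u p.1 && nth false v p.2] != [::]) |
    (count id u + count id v <= 8) && has (fun p => has (fun q => (p.1 != q.1) && (p.2 != q.2)) [seq p <- incompatible_pairs | nth false u p.1 && nth false v p.2]) [seq p <- incompatible_pairs | nth false u p.1 && nth false v p.2]]%N.
  apply: H; rewrite cu cv !andbT; apply/allP => i; rewrite mem_iota => /andP[_ i8].
  rewrite uE ?ltn_mod // vE // modX; apply/negP => /andP[h1 h2].
  by case: (T1 i); apply/negP; rewrite -ltNge.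
case/or3P => [h|/andP[h]|/andP[h]].
- by apply: (mono 0%N) => //; rewrite mulr0 addr_ge0.
- case: [seq _ <- _ | _] pairP => // p s pairP _.
  have [p1 p2 pk] := pairP p (mem_head _ _).
  apply: (mono 1%N) => //; rewrite mulr1.
  have h1 : dX p.1 <= \sum_(i < 8) dX i by rewrite (bigD1 (Ordinal p1)) //= lerDl sumr_ge0.
  have h2 : dY p.2 <= \sum_(i < 8) dY i by rewrite (bigD1 (Ordinal p2)) //= lerDl sumr_ge0.
  lra.
move=> /hasP[p /pairP[p1 p2 pk] /hasP[q /pairP[q1 q2 qk] /andP[d1 d2]]].
apply: (mono 2%N) => //.
have h1 : dX p.1 + dX q.1 <= \sum_(i < 8) dX i.
  rewrite (bigD1 (Ordinal p1)) //= (bigD1 (Ordinal q1)) /=; last by rewrite eq_sym.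
  by rewrite addrA lerDl sumr_ge0.
have h2 : dY p.2 + dY q.2 <= \sum_(i < 8) dY i.
  rewrite (bigD1 (Ordinal p2)) //= (bigD1 (Ordinal q2)) /=; last by rewrite eq_sym.
  by rewrite addrA lerDl sumr_ge0.
lra.
Qed.

End StablePairs.

(* The set [{i | k < Y i}] has at most one element [i0]; the three constraints then cap [X] at three places. *)
Lemma stable_pair_end (R : realFieldType) (X Y : nat -> R) (k lam : R) (s1 s2 : nat -> 'I_8) :
  0 <= k -> k <= 1 -> 1 <= lam <= 3 ->
  (forall i, X i <= 1) -> (forall i, Y i <= 1) ->
  (forall i, (i < 8)%N -> [/\ s1 i != s2 i, s1 i != i :> nat & s2 i != i :> nat]) ->
  (forall i, (i < 8)%N -> X (s1 i) <= k \/ Y i <= k) ->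
  (forall i, (i < 8)%N -> X i + Y i <= 1 + k) ->
  (forall i, (i < 8)%N -> X (s2 i) + Y i <= 1 + k) ->
  (count id (mkseq (fun i => k < Y i)%R 8) <= 1)%N ->
  \sum_(i < 8) X i + lam * \sum_(i < 8) Y i <= 8 + 8 * k * lam.
Proof.
move=> k0 k1 /andP[lam1 lam3] X1 Y1 sneq T1 T0 T4 cv.
have lam0 : 0 <= lam by lra.
have [/existsP[i0 i0k]|] := boolP [exists i : 'I_8, k < Y i]; last first.
  move=> /existsPn nY.
  have hX : \sum_(i < 8) X i <= 8.
    by apply: (@le_trans _ _ (\sum_(i < 8) 1)); [exact: ler_sum|rewrite sumr_const card_ord].
  have hY : \sum_(i < 8) Y i <= 8 * k.
    apply: (@le_trans _ _ (\sum_(i < 8) k)); last by rewrite sumr_const card_ord -[_ *+ 8]mulr_natl.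
    by apply: ler_sum => i _; rewrite leNgt nY.
  by have := ler_wpM2l lam0 hY; lra.
have others (i : 'I_8) : i != i0 -> Y i <= k.
  move=> ii0; rewrite leNgt; apply/negP => ik.
  by move: cv; rewrite count_mkseq (bigD1 i0) // (bigD1 i) //= ik i0k.
have [n12 n10 n20] := sneq i0 (ltn_ord i0).
have hY : \sum_(i < 8) Y i <= 7 * k + Y i0.
  rewrite (bigD1 i0) //= addrC lerD2r.
  apply: (@le_trans _ _ (\sum_(i < 8 | i != i0) k)); first by apply: ler_sum.
  by rewrite sumr_const -[_ *+ _]mulr_natl cardC1 card_ord.
have hX : \sum_(i < 8) X i <= 5 + k + 2 * (1 + k - Y i0).
  rewrite (bigD1 i0) //= (bigD1 (s1 i0)) //= (bigD1 (s2 i0)) /=; last by rewrite n20 eq_sym n12.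
  have h1 : X (s1 i0) <= k by case: (T1 _ (ltn_ord i0)) => // h; move: i0k; rewrite ltNge h.
  have h2 := T0 _ (ltn_ord i0); have h3 := T4 _ (ltn_ord i0).
  have h4 : \sum_(i < 8 | (i != i0) && (i != s1 i0) && (i != s2 i0)) X i <= 5.
    apply: (@le_trans _ _ (\sum_(i < 8 | (i != i0) && (i != s1 i0) && (i != s2 i0)) 1)).
      exact: ler_sum.
    rewrite sumr_const (_ : #|_| = 5%N) //.
    have -> : #|[pred i : 'I_8 | (i != i0) && (i != s1 i0) && (i != s2 i0)]| =
              #|~: [set i0; s1 i0; s2 i0]|.
      by apply: eq_card => i; rewrite !inE !negb_or.
    have m20 : s2 i0 != i0 := n20; have m10 : s1 i0 != i0 := n10.
    have c3 : #|[set i0; s1 i0; s2 i0]| = 3%N.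
      rewrite finset.setUC cardsU1 cards2 !inE (negbTE m20) [s2 i0 == _]eq_sym (negbTE n12).
      by rewrite [i0 == _]eq_sym m10.
    by have /eqP := cardsC [set i0; s1 i0; s2 i0]; rewrite card_ord c3 -[8%N]/(3 + 5)%N eqn_add2l => /eqP.
  lra.
have hl := ler_wpM2l lam0 hY.
(* Raising [Y i0] gains [lam] times the increase but lowers two caps on [X] by as much, so the net
   rate is [lam - 2]; [lam <= 3] makes it at most 1. *)
have h5 : (lam - 2) * (Y i0 - k) <= 1 * (1 - k).
  apply: (@le_trans _ _ (1 * (Y i0 - k))).
    by apply: ler_wpM2r; [rewrite subr_ge0 ltW|lra].
  by have := Y1 i0; lra.
lra.
Qed.

(** * Averages as integrals over levels *)

Lemma truncE (R : realType) (x : R) : 0 <= x -> exists m : nat, m%:R <= x < m%:R + 1.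
Proof. by move=> x0; exists (Num.trunc x); have := trunc_itv x0; rewrite -[X in _ < X]natr1. Qed.

Lemma sum_grid_ge (R : realType) (x : R) (n : nat) : (0 < n)%N -> 0 <= x <= 1 ->
  n%:R * x - 1 <= \sum_(0 <= k < n) ((0 < k)%N && (k%:R / n%:R <= x))%:R.
Proof.
move=> n0 /andP[x0 x1]; have nR : 0 < n%:R :> R by rewrite ltr0n.
have [m /andP[m1 m2]] := truncE (mulr_ge0 (ltW nR) x0).
pose M := minn m n.-1.
have hM : n%:R * x - 1 <= M%:R.
  rewrite /M /minn; case: ltnP => _; first by move: m2; lra.
  have : n%:R * x <= n%:R * 1 by apply: ler_wpM2l => //; exact: ltW.
  have nE : n%:R = n.-1%:R + 1 :> R by rewrite natr1 prednK.
  by move: nE; lra.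
apply: le_trans hM _.
have -> : M%:R = \sum_(0 <= k < n) ((1 <= k < M.+1)%N)%:R :> R.
  rewrite (@sum_nat_supp _ _ 0 n 1 M.+1) //; last first.
  - by move=> k /negbTE ->.
  - by rewrite /M; move: n0; clear; lia.
  rewrite (eq_big_nat _ _ (F2 := fun=> 1)); last by move=> i ->.
  by rewrite sumr_const_nat subSS subn0.
apply: ler_sum => k _; rewrite ler_nat.
case: (boolP (1 <= k < M.+1)%N) => // /andP[k0 kM]; rewrite k0 /=.
rewrite ler_pdivrMr // mulrC lt0b; apply: le_trans m1; rewrite ler_nat.
by move: kM; rewrite /M; clear; lia.
Qed.

Lemma sum_grid_gt (R : realType) (x : R) (n : nat) : (0 < n)%N -> 0 <= x <= 1 ->
  n%:R * x - 2 <= \sum_(0 <= k < n) ((0 < k)%N && (1 - k%:R / n%:R < x))%:R.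
Proof.
move=> n0 /andP[x0 x1]; have nR : 0 < n%:R :> R by rewrite ltr0n.
have [m /andP[m1 m2]] := truncE (mulr_ge0 (ltW nR) x0).
have mn : (m <= n)%N.
  rewrite -(ler_nat R); apply: le_trans m1 _.
  by rewrite -[leRHS]mulr1; apply: ler_wpM2l => //; exact: ltW.
have hM : n%:R * x - 2 <= (m - 1)%:R.
  case: (m) m2 => [|m'] m2; first by rewrite sub0n; move: m2; lra.
  by rewrite subn1 /=; move: m2; rewrite -[in X in X -> _]natr1; lra.
apply: le_trans hM _.
have -> : (m - 1)%:R = \sum_(0 <= k < n) (((n - m).+1 <= k < n)%N)%:R :> R.
  rewrite (@sum_nat_supp _ _ 0 n (n - m).+1 n) //; last by move=> k /negbTE ->.
  rewrite (eq_big_nat _ _ (F2 := fun=> 1)); last by move=> i ->.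
  by rewrite sumr_const_nat; congr (_ *+ _); move: mn; clear; lia.
apply: ler_sum => k _; rewrite ler_nat.
case: (boolP ((n - m).+1 <= k < n)%N) => // /andP[k0 kM].
have -> /= : (0 < k)%N by move: k0; clear; lia.
rewrite lt0b; have h : (n < k + m)%N by move: k0 mn; clear; lia.
rewrite -(ltr_nat R) natrD in h.
rewrite -(ltr_pM2l nR) mulrBr mulr1 mulrCA divff ?gt_eqF // mulr1.
by move: m1; lra.
Qed.

(** Integrated over the level [y], the indicators of [y <= X x] and [1 - y < Z x] give [X x] and
    [Z x]. The integral is replaced by a sum over the grid [k / n], whose total error [D] does not
    depend on [n]; then [n] is taken large. *)
Lemma layer_cake (R : realType) (TA TB : finType) (X : TA -> R) (Z : TB -> R) (c1 c2 C : R) :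
  0 <= c1 -> 0 <= c2 -> 0 <= C ->
  (forall x, 0 <= X x <= 1) -> (forall x, 0 <= Z x <= 1) ->
  (forall y, 0 < y -> y < 1 ->
     c1 * (\sum_x (y <= X x)%R%:R) + c2 * (\sum_x (1 - y < Z x)%R%:R) <= C) ->
  c1 * (\sum_x X x) + c2 * (\sum_x Z x) <= C.
Proof.
move=> c10 c20 C0 X01 Z01 hC; rewrite leNgt; apply/negP => lt.
set T := c1 * _ + _ in lt; pose D : R := c1 * #|TA|%:R + 2 * c2 * #|TB|%:R.
have D0 : 0 <= D by rewrite addr_ge0 // !mulr_ge0.
have TC : 0 < T - C by rewrite subr_gt0.
have := archi_boundP (divr_ge0 D0 (ltW TC)); set n := Num.bound _ => nD.
have n0 : (0 < n)%N by rewrite lt0n; apply: contraTneq nD => ->; rewrite -leNgt divr_ge0 // ltW.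
have nR : 0 < n%:R :> R by rewrite ltr0n.
rewrite ltr_pdivrMr // in nD.
suff : n%:R * T - D <= n%:R * C by lra.
pose SA k : R := \sum_x ((0 < k)%N && (k%:R / n%:R <= X x))%:R.
pose SB k : R := \sum_x ((0 < k)%N && (1 - k%:R / n%:R < Z x))%:R.
have hA : n%:R * (\sum_x X x) - #|TA|%:R <= \sum_(0 <= k < n) SA k.
  rewrite exchange_big big_distrr /= -sum1_card natr_sum -sumrB.
  by apply: ler_sum => x _; apply: sum_grid_ge.
have hB : n%:R * (\sum_x Z x) - 2 * #|TB|%:R <= \sum_(0 <= k < n) SB k.
  rewrite exchange_big big_distrr /= -sum1_card natr_sum big_distrr -sumrB /=.
  by apply: ler_sum => x _; rewrite mulr1; apply: sum_grid_gt.
have h1 : \sum_(0 <= k < n) (c1 * SA k + c2 * SB k) <= n%:R * C.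
  rewrite mulr_natl -[n in leRHS]subn0 -sumr_const_nat big_nat [leRHS]big_nat.
  apply: ler_sum => k /andP[_ kn]; case: (posnP k) => [k0|k0].
    by rewrite /SA /SB !big1 ?mulr0 ?addr0 // => x _; rewrite k0.
  have kR : 0 < k%:R :> R by rewrite ltr0n.
  apply: le_trans (hC (k%:R / n%:R) _ _).
  - by rewrite /SA /SB k0.
  - by rewrite divr_gt0.
  - by rewrite ltr_pdivrMr // mul1r ltr_nat.
rewrite big_split -!big_distrr /= in h1.
have h2 := ler_wpM2l c10 hA; have h3 := ler_wpM2l c20 hB.
by rewrite /T /D; lra.
Qed.

(** * Normalised densities in residue classes *)

Section Density.

Variables (R : realType) (T : finType) (c : T -> nat).

(** The factor [V] makes a full residue class have density 1 when [c] is equidistributed modulo [V],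
    so densities of finer classes average to those of coarser ones. *)
Definition density (V v : nat) (p : pred T) : R :=
  V%:R / #|T|%:R * #|[pred x | (c x == v %[mod V])%N && p x]|%:R.

Hypothesis T0 : (0 < #|T|)%N.
Let TR : 0 < #|T|%:R :> R. Proof. by rewrite ltr0n. Qed.

Lemma density_ge0 V v p : 0 <= density V v p.
Proof. by rewrite !mulr_ge0 ?invr_ge0 ?ler0n. Qed.

Lemma density_mono V v (p q : pred T) : subpred p q -> density V v p <= density V v q.
Proof.
move=> pq; apply: ler_wpM2l; first by rewrite mulr_ge0 ?invr_ge0 ?ler0n.
by rewrite ler_nat; apply: subset_leq_card; apply/fintype.subsetP => x; rewrite !inE => /andP[-> /pq ->].
Qed.

Lemma density_mod V v v' p : (v = v' %[mod V])%N -> density V v p = density V v' p.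
Proof. by rewrite /density => ->. Qed.

Lemma density_refine V k v p : (0 < V)%N -> (0 < k)%N ->
  density V v p = k%:R^-1 * \sum_(j < k) density (V * k) (v + V * j) p.
Proof.
move=> V0 k0; rewrite /density -big_distrr /= natrM.
have E (x : T) : ((c x == v %[mod V])%N && p x : nat) =
   (\sum_(j < k) ((c x == v + V * j %[mod V * k])%N && p x : nat))%N.
  case: (p x); last by rewrite andbF big1 // => j _; rewrite andbF.
  under eq_bigr do rewrite andbT.
  rewrite andbT; case: (boolP (c x == v %[mod V])%N) => [cv|ncv]; last first.
    rewrite big1 // => j _; apply/eqP; rewrite eqb0; apply: contra ncv => /eqP h.
    have := congr1 (modn^~ V) h; rewrite !modn_dvdm ?dvdn_mulr // => ->.
    by rewrite addnC mulnC modnMDl.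
  pose D := ((c x + V * k * v - v) %/ V)%N.
  have vle : (v <= c x + V * k * v)%N.
    by apply: leq_trans (leq_addl _ _); rewrite leq_pmull // muln_gt0 V0.
  have DE : (c x + V * k * v = v + V * D)%N.
    rewrite /D [(V * (_ %/ _))%N]mulnC divnK ?subnKC //.
    by rewrite -eqn_mod_dvd // -mulnA [(V * _)%N]mulnC addnC modnMDl.
  have Dk : (D %% k < k)%N by rewrite ltn_mod.
  have jE (j : 'I_k) : (c x == v + V * j %[mod V * k])%N = (j == Ordinal Dk).
    have -> : (c x = v + V * D %[mod V * k])%N.
      by rewrite -DE [(V * k * v)%N]mulnC addnC modnMDl.
    rewrite eqn_modDl -!muln_modr eqn_pmul2l //.
    by rewrite (modn_small (ltn_ord j)) eq_sym.
  rewrite (bigD1 (Ordinal Dk)) //= big1 => [|j jn]; last by rewrite jE (negbTE jn).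
  by have := jE (Ordinal Dk); rewrite /= eqxx => ->.
have -> : \sum_(j < k) (#|[pred x | (c x == v + V * j %[mod V * k])%N && p x]|)%:R =
   (#|[pred x | (c x == v %[mod V])%N && p x]|)%:R :> R.
  rewrite -natr_sum; congr (_%:R).
  have cardE (q : pred T) : #|q| = (\sum_x (q x : nat))%N.
    by rewrite -sum1_card big_mkcond; apply: eq_bigr => x _; rewrite unfold_in; case: (q x).
  rewrite cardE (eq_bigr _ (fun x _ => E x)) exchange_big /=.
  by apply: eq_bigr => j _; rewrite cardE.
by field; rewrite !pnatr_eq0 -!lt0n k0 T0.
Qed.

End Density.

(** Equidistribution is given modulo 128; the bound is immediate there and descends to modulus 8 by
    averaging. *)
Lemma density_le1 (R : realType) (T : finType) (c : T -> nat) (v : nat) (p : pred T) :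
  (0 < #|T|)%N ->
  (forall v, (v < 128)%N -> (#|[pred x | c x %% 128 == v]| * 128 = #|T|)%N) ->
  density R c 8 v p <= 1.
Proof.
move=> T0 fib; have TR : 0 < #|T|%:R :> R by rewrite ltr0n.
have h w : density R c 128 w p <= 1.
  rewrite /density mulrAC ler_pdivrMr // mul1r -natrM ler_nat -(fib (w %% 128)%N) ?ltn_mod //.
  rewrite mulnC leq_mul2r; apply/orP; right; apply: subset_leq_card.
  by apply/fintype.subsetP => x; rewrite !inE => /andP[].
rewrite (@density_refine _ _ _ T0 8 16) // mulrC ler_pdivrMr // mul1r.
apply: (@le_trans _ _ (\sum_(j < 16) 1)); first by apply: ler_sum => j _; exact: h.
by rewrite sumr_const card_ord.
Qed.

Lemma sum_density8 (R : realType) (T : finType) (c : T -> nat) (p : pred T) :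
  (0 < #|T|)%N -> \sum_(i < 8) density R c 8 i p = 8 / #|T|%:R * \sum_x (p x)%:R.
Proof.
move=> T0; have := @density_refine R T c T0 1 8 0 p isT isT.
rewrite (eq_bigr (fun i : 'I_8 => density R c 8 i p)) => [|i _]; last by rewrite add0n !mul1n.
move=> h; have {h} -> : \sum_(i < 8) density R c 8 i p = 8 * density R c 1 0 p.
  by rewrite h mulrA divff ?mul1r // pnatr_eq0.
rewrite /density mul1r -mulrA; congr (_ * (_ * _)).
rewrite -natr_sum -sum1_card big_mkcond /=; congr (_%:R).
by apply: eq_bigr => x _; rewrite inE !modn1 eqxx; case: (p x).
Qed.

(** * Level regimes and the curve 3 x y = (1 - x) (1 - y) *)

Lemma downward_threshold (R : realType) (P : R -> bool) :
  (forall y y', 0 < y -> y' < 1 -> y <= y' -> P y' -> P y) ->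
  exists p, [/\ 0 <= p <= 1, forall y, 0 < y -> y < p -> P y &
     forall y, y < 1 -> p < y -> ~~ P y].
Proof.
(* Adjoining 0 keeps the set nonempty when [P] fails at all levels, so that its supremum exists. *)
move=> Pdown; pose E : set R := [set y | y = 0 \/ [/\ 0 < y, y < 1 & P y]]%classic.
have E0 : E 0 by left.
have ub : has_sup E by split; [exists 0|exists 1 => y [->|[_ /ltW]] //; rewrite ler01].
exists (sup E); split.
- rewrite (sup_upper_bound ub) //=; apply: ge_sup; first by exists 0.
  by move=> y [->|[_ /ltW]] //; rewrite ler01.
- move=> y y0 yp; have d0 : 0 < sup E - y by rewrite subr_gt0.
  have [e [->|[e0 e1 Pe]]] := sup_adherent d0 ub.
    by rewrite subKr => /(lt_trans y0); rewrite ltxx.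
  by rewrite subKr => ye; apply: Pdown Pe => //; exact: ltW.
- move=> y y1 py; apply/negP => Py.
  have y0 : 0 < y by apply: le_lt_trans py; apply: (sup_upper_bound ub).
  have : y <= sup E by apply: (sup_upper_bound ub); right.
  by rewrite leNgt py.
Qed.

(** The largest density that may face [y] when 3 x y <= (1 - x) (1 - y). This is the bipartite form
    of Hoffman's ratio bound, with relative second singular value 1/sqrt 3. *)
Definition hoffman (R : fieldType) (y : R) : R := (1 - y) / (1 + 2 * y).

Definition clamp (R : realDomainType) (l h x : R) : R := Num.min (Num.max x l) h.

Lemma clamp_ge (R : realDomainType) (l h x : R) : l <= h -> l <= clamp l h x <= h.
Proof. by move=> lh; rewrite /clamp le_min le_max lexx orbT lh /= ge_min lexx orbT. Qed.

Lemma clamp_ge_inv (R : realDomainType) (l h x y : R) : l < y -> y <= clamp l h x -> y <= x.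
Proof. by move=> ly; rewrite /clamp le_min le_max => /andP[/orP[//|yl] _]; move: ly; rewrite ltNge yl. Qed.

Lemma clamp_gt_inv (R : realDomainType) (l h x y : R) : l <= y -> y < clamp l h x -> y < x.
Proof. by move=> ly; rewrite /clamp lt_min lt_max => /andP[/orP[//|yl] _]; move: ly; rewrite leNgt yl. Qed.

Lemma clampE (R : realDomainType) (l h x : R) : l <= h ->
  clamp l h x = if x <= l then l else if x <= h then x else h.
Proof.
move=> lh; rewrite /clamp; case: (leP x l) => [xl|lx]; first by rewrite min_l.
by case: (leP x h) => // ?.
Qed.

Lemma clamp_telescope (R : realDomainType) (t u v w x : R) :
  t <= u -> u <= v -> v <= w -> t <= x -> x <= w ->
  x - t = (clamp t u x - t) + (clamp u v x - u) + (clamp v w x - v).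
Proof.
move=> tu uv vw tx xw; rewrite !clampE // xw.
case: (leP x t) => h1; case: (leP x u) => h2; case: (leP x v) => h3; lra.
Qed.

Lemma hoffman_convex (R : realFieldType) (y0 y1 th : R) : 0 <= y0 -> y0 <= y1 -> 0 <= th <= 1 ->
  hoffman (y0 + th * (y1 - y0)) <= (1 - th) * hoffman y0 + th * hoffman y1.
Proof.
move=> h0 h1 /andP[t0 t1]; rewrite /hoffman.
have u0 : 0 < 1 + 2 * y0 by lra.
have u1 : 0 < 1 + 2 * y1 by lra.
have d0 : 0 <= th * (y1 - y0) by rewrite mulr_ge0 // subr_ge0.
have u : 0 < 1 + 2 * (y0 + th * (y1 - y0)) by lra.
rewrite -subr_ge0.
have -> : (1 - th) * ((1 - y0) / (1 + 2 * y0)) + th * ((1 - y1) / (1 + 2 * y1)) -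
   (1 - (y0 + th * (y1 - y0))) / (1 + 2 * (y0 + th * (y1 - y0))) =
   6 * th * (1 - th) * (y1 - y0) ^+ 2 /
   ((1 + 2 * y0) * (1 + 2 * y1) * (1 + 2 * (y0 + th * (y1 - y0)))).
  by field; rewrite !gt_eqF.
apply: divr_ge0; last by rewrite !mulr_ge0 // ltW.
by rewrite !mulr_ge0 ?sqr_ge0 // subr_ge0.
Qed.

Lemma hoffman_decr (R : realFieldType) (y0 y1 : R) : 0 <= y0 -> y0 <= y1 -> hoffman y1 <= hoffman y0.
Proof.
move=> h0 h1; rewrite /hoffman -subr_ge0.
have u0 : 0 < 1 + 2 * y0 by lra.
have u1 : 0 < 1 + 2 * y1 by lra.
have -> : (1 - y0) / (1 + 2 * y0) - (1 - y1) / (1 + 2 * y1) =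
   3 * (y1 - y0) / ((1 + 2 * y0) * (1 + 2 * y1)) by field; rewrite !gt_eqF.
by rewrite divr_ge0 ?mulr_ge0 ?subr_ge0 // ltW.
Qed.

(** A layer cake restricted to levels of [a] in [[y0, y1]] and of [b] in [[hoffman y1, hoffman y0]],
    both run through linearly. By convexity the chord lies above the curve, so exceeding the chord
    implies exceeding [hoffman]. The factor [(1 + 2 * y0) * (1 + 2 * y1) / 3] is the inverse of the
    chord's slope in absolute value. *)
Lemma regime_sum (R : realType) (TA TB : finType) (a : TA -> R) (b : TB -> R) (y0 y1 c1 c2 C : R) :
  0 <= y0 -> y0 <= y1 -> 0 <= c1 -> 0 <= c2 -> 0 <= C ->
  (forall y, y0 < y -> y < y1 ->
     c1 * (\sum_x (y <= a x)%R%:R) + c2 * (\sum_x (hoffman y < b x)%R%:R) <= C) ->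
  c1 * (\sum_x (clamp y0 y1 (a x) - y0)) +
  c2 * ((1 + 2 * y0) * (1 + 2 * y1) / 3) *
    (\sum_x (clamp (hoffman y1) (hoffman y0) (b x) - hoffman y1)) <= C * (y1 - y0).
Proof.
move=> h0 h1 c10 c20 C0 hC; have g01 := hoffman_decr h0 h1.
case: (eqVneq y0 y1) => [e|ne].
  have clamp0 (z x : R) : clamp z z x - z = 0.
    by rewrite clampE //; case: (leP x z) => _; rewrite subrr.
  by rewrite -e subrr mulr0 !big1 ?mulr0 ?addr0 // => x _; rewrite clamp0.
have lt01 : y0 < y1 by rewrite lt_neqAle ne.
have d0 : 0 < y1 - y0 by rewrite subr_gt0.
have u0 : 0 < 1 + 2 * y0 by lra.
have u1 : 0 < 1 + 2 * y1 by lra.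
have gE : hoffman y0 - hoffman y1 = 3 * (y1 - y0) / ((1 + 2 * y0) * (1 + 2 * y1)).
  by rewrite /hoffman; field; rewrite !gt_eqF.
have g0 : 0 < hoffman y0 - hoffman y1 by rewrite gE divr_gt0 ?mulr_gt0.
pose X x := (clamp y0 y1 (a x) - y0) / (y1 - y0).
pose Z x := (clamp (hoffman y1) (hoffman y0) (b x) - hoffman y1) / (hoffman y0 - hoffman y1).
have X01 x : 0 <= X x <= 1.
  have /andP[l1 l2] := clamp_ge (a x) h1.
  by rewrite /X divr_ge0 ?subr_ge0 //= ler_pdivrMr // mul1r lerD2r.
have Z01 x : 0 <= Z x <= 1.
  have /andP[l1 l2] := clamp_ge (b x) g01.
  by rewrite /Z divr_ge0 ?subr_ge0 //= ler_pdivrMr // mul1r lerD2r.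
have := @layer_cake R TA TB X Z c1 c2 C c10 c20 C0 X01 Z01.
have -> : \sum_x X x = (\sum_x (clamp y0 y1 (a x) - y0)) / (y1 - y0) by rewrite big_distrl.
have -> : \sum_x Z x = (\sum_x (clamp (hoffman y1) (hoffman y0) (b x) - hoffman y1)) /
   (hoffman y0 - hoffman y1) by rewrite big_distrl.
move=> /(_ _) h.
have {h} : c1 * ((\sum_x (clamp y0 y1 (a x) - y0)) / (y1 - y0)) +
   c2 * ((\sum_x (clamp (hoffman y1) (hoffman y0) (b x) - hoffman y1)) / (hoffman y0 - hoffman y1)) <= C.
  apply: h => th t0 t1.
  have y0y : y0 < y0 + th * (y1 - y0) by rewrite ltrDl mulr_gt0.
  have yy1 : y0 + th * (y1 - y0) < y1.
    rewrite -ltrBDl -subr_gt0.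
    have -> : y1 - y0 - th * (y1 - y0) = (1 - th) * (y1 - y0) by ring.
    by rewrite mulr_gt0 // subr_gt0.
  apply: le_trans (hC _ y0y yy1); apply: lerD.
    apply: ler_wpM2l => //; apply: ler_sum => x _; rewrite ler_nat.
    case: (boolP (th <= X x)) => // hx; rewrite lt0b.
    apply: (clamp_ge_inv (l := y0) (h := y1)) => //.
    by move: hx; rewrite /X ler_pdivlMr // lerBrDl.
  apply: ler_wpM2l => //; apply: ler_sum => x _; rewrite ler_nat.
  case: (boolP (1 - th < Z x)) => // hx; rewrite lt0b.
  have cv : hoffman (y0 + th * (y1 - y0)) <= (1 - th) * hoffman y0 + th * hoffman y1.
    by apply: hoffman_convex => //; rewrite !ltW.
  apply: le_lt_trans cv _.
  apply: (clamp_gt_inv (l := hoffman y1) (h := hoffman y0)).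
    rewrite -subr_ge0.
    have -> : (1 - th) * hoffman y0 + th * hoffman y1 - hoffman y1 =
       (1 - th) * (hoffman y0 - hoffman y1) by ring.
    by rewrite mulr_ge0 ?ltW // subr_gt0.
  move: hx; rewrite /Z ltr_pdivlMr // => hx; lra.
set SA := \sum_x (clamp y0 y1 _ - _); set SB := \sum_x (_ - hoffman y1).
move=> h; have := ler_wpM2r (ltW d0) h; rewrite mulrDl.
have -> : c1 * (SA / (y1 - y0)) * (y1 - y0) = c1 * SA by field; rewrite gt_eqF.
have -> // : c2 * (SB / (hoffman y0 - hoffman y1)) * (y1 - y0) =
   c2 * ((1 + 2 * y0) * (1 + 2 * y1) / 3) * SB.
by rewrite gE; field; rewrite !gt_eqF // subr_gt0.
Qed.

(* Equal to [3 x y - (1 - x) (1 - y)]; its zero set is the graph of [hoffman]. *)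
Definition edge_gain (R : pzRingType) (x y : R) : R := 2 * x * y + x + y - 1.

(** The left side adds up the bounds for the levels in [[0, q]], [[q, p]] and [[p, 1]]; the right
    side is what averages of [3 / 8 + k] require. For [k = 0] equality occurs at [p = 1], [q = 0],
    so strictness has to come from [k]. *)
Lemma threshold_inequality (R : realFieldType) (p q k : R) :
  0 <= q -> q <= p -> p <= 1 -> 0 < k ->
  q * (8 + 8 * k * (1 + 2 * p)) + (p - q) * (6 + 10 * k) +
    (1 - p) * (8 * ((1 + 2 * q) / 3) + 8 * k) <
  (3 + 8 * k) * (1 + (1 + 2 * p) * (1 + 2 * q) / 3).
Proof.
move=> q0 qp p1 k0.
(* At [k = 0] the right side minus the left is 4/3 times this expression. The square completed below
   comes from 7 p^2 - 5 p + 1, which has no real root. *)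
have pos : 0 <= 1 - p - 4 * q + 7 * p * q.
  have p0 : 0 <= p by exact: le_trans qp.
  case: (eqVneq p 0) => [p00|pn0].
    have -> : q = 0 by apply/eqP; rewrite eq_le q0 -p00 qp.
    by rewrite p00; lra.
  have {}p0 : 0 < p by rewrite lt_neqAle eq_sym pn0.
  rewrite -(pmulr_rge0 _ p0).
  have -> : p * (1 - p - 4 * q + 7 * p * q) = (p - q) * (1 - p) + q * (7 * (p - 5 / 14) ^+ 2 + 3 / 28).
    by field.
  apply: addr_ge0; first by rewrite mulr_ge0 ?subr_ge0.
  by apply: mulr_ge0 => //; have := sqr_ge0 (p - 5 / 14); lra.
have pq : p * q <= q by rewrite ler_piMl.
have pos2 : 0 < k * (8 + 10 * p + 22 * q - 16 * (p * q)).
  by rewrite mulr_gt0 //; lra.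
lra.
Qed.

(** * Contradiction from a scarcity of rich pairs of cells *)

Section Comb.

Variables (R : realType) (TA TB : finType) (cA : TA -> nat) (cB : TB -> nat).
Variables (a : TA -> R) (b : TB -> R) (k d : R).
Hypotheses (TA0 : (0 < #|TA|)%N) (TB0 : (0 < #|TB|)%N).
Hypothesis fibA : forall v, (v < 128)%N -> (#|[pred x | cA x %% 128 == v]| * 128 = #|TA|)%N.
Hypothesis fibB : forall v, (v < 128)%N -> (#|[pred x | cB x %% 128 == v]| * 128 = #|TB|)%N.
Hypotheses (k0 : 0 < k) (d0 : 0 < d).
Hypotheses (a01 : forall x, 0 <= a x <= 1) (b01 : forall x, 0 <= b x <= 1).
Hypothesis avgA : #|TA|%:R * (3 / 8 + k + d) <= \sum_x a x.
Hypothesis avgB : #|TB|%:R * (3 / 8 + k + d) <= \sum_x b x.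

Let rich_pairs (V v w : nat) : pred (TA * TB) :=
  [pred z | [&& (cA z.1 == v %[mod V])%N, (cB z.2 == w %[mod V])%N & 2 * d <= edge_gain (a z.1) (b z.2)]].

Hypothesis poor : forall V c v w, (V, c) \in square_types -> (v + w = c %[mod V])%N ->
  (V ^ 2 * #|rich_pairs V v w|)%:R < k ^+ 2 * (#|TA| * #|TB|)%:R.

(** Lowering both densities by [d] turns the borderline case on the curve [hoffman] into an
    [edge_gain] of at least [2 * d], and the averages stay at least [3 / 8 + k]. *)
Let a' x := Num.max (a x - d) 0.
Let b' x := Num.max (b x - d) 0.

Let TAR : 0 < #|TA|%:R :> R. Proof. by rewrite ltr0n. Qed.
Let TBR : 0 < #|TB|%:R :> R. Proof. by rewrite ltr0n. Qed.

Let a'01 x : 0 <= a' x <= 1.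
Proof.
have /andP[h0 h1] := a01 x; rewrite /a' le_max lexx orbT /= ge_max ler01 andbT.
by move: d0; lra.
Qed.
Let b'01 x : 0 <= b' x <= 1.
Proof.
have /andP[h0 h1] := b01 x; rewrite /b' le_max lexx orbT /= ge_max ler01 andbT.
by move: d0; lra.
Qed.

Let sumA' : #|TA|%:R * (3 / 8 + k) <= \sum_x a' x.
Proof.
apply: (@le_trans _ _ (\sum_x (a x - d))); last by apply: ler_sum => x _; rewrite le_max lexx.
by rewrite sumrB sumr_const -[d *+ _]mulr_natl; move: avgA; lra.
Qed.
Let sumB' : #|TB|%:R * (3 / 8 + k) <= \sum_x b' x.
Proof.
apply: (@le_trans _ _ (\sum_x (b x - d))); last by apply: ler_sum => x _; rewrite le_max lexx.
by rewrite sumrB sumr_const -[d *+ _]mulr_natl; move: avgB; lra.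
Qed.

Let k1 : k <= 1.
Proof.
have : #|TA|%:R * (3 / 8 + k + d) <= #|TA|%:R * 1.
  apply: le_trans avgA _; rewrite mulr1 -sum1_card natr_sum.
  by apply: ler_sum => x _; case/andP: (a01 x).
by rewrite ler_pM2l //; move: d0; lra.
Qed.

Let pA y : pred TA := fun x => y <= a' x.
Let pB y : pred TB := fun x => hoffman y < b' x.

Let rich y x z : 0 < y -> y < 1 -> pA y x -> pB y z -> 2 * d <= edge_gain (a x) (b z).
Proof.
move=> y0 y1; rewrite /pA /pB => hx hz.
have u0 : 0 < 1 + 2 * y by lra.
have g0 : 0 < hoffman y by rewrite divr_gt0 // subr_gt0.
have gE : 2 * y * hoffman y + y + hoffman y - 1 = 0 by rewrite /hoffman; field; rewrite gt_eqF.
have ax : y + d <= a x.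
  by move: hx; rewrite /a' le_max => /orP[|]; [rewrite lerBrDr|rewrite leNgt y0].
have bz : hoffman y + d <= b z.
  have := ltW hz; rewrite /b' le_max => /orP[|]; first by rewrite lerBrDr.
  by rewrite leNgt g0.
have : (y + d) * (hoffman y + d) <= a x * b z.
  by apply: ler_pM => //; rewrite addr_ge0 // ltW.
have yd : 0 <= y * d by rewrite mulr_ge0 // ltW.
have gd : 0 <= hoffman y * d by rewrite mulr_ge0 // ltW.
have dd : 0 <= d * d by rewrite mulr_ge0 // ltW.
by rewrite /edge_gain; lra.
Qed.

(** If both level sets had density above [k], their product would consist of rich pairs and would
    have at least [k ^+ 2 / V ^ 2] of all pairs, contrary to [poor]. *)
Let poor_level V c v w y : (V, c) \in square_types -> (v + w = c %[mod V])%N -> 0 < y -> y < 1 ->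
  density R cA V v (pA y) <= k \/ density R cB V w (pB y) <= k.
Proof.
move=> Vc vw y0 y1; case: (leP (density R cA V v (pA y)) k) => hA; [by left|].
case: (leP (density R cB V w (pB y)) k) => hB; [by right|exfalso].
have := poor Vc vw; apply/negP; rewrite -leNgt.
have h := ltW (ltr_pM (ltW k0) (ltW k0) hA hB); rewrite -expr2 in h.
rewrite -ler_pdivlMr ?ltr0n ?muln_gt0 ?TA0 //; apply: le_trans h _.
rewrite /density.
set P := [pred x | _ && pA y x]; set Q := [pred x | _ && pB y x].
have PQ : (#|P| * #|Q| <= #|rich_pairs V v w|)%N.
  rewrite -cardX; apply: subset_leq_card; apply/fintype.subsetP => -[x z].
  rewrite !inE /= => /andP[/andP[-> hx] /andP[-> hz]] /=.
  exact: rich hx hz.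
have -> : V%:R / #|TA|%:R * #|P|%:R * (V%:R / #|TB|%:R * #|Q|%:R) =
  (V ^ 2 * (#|P| * #|Q|))%:R / (#|TA| * #|TB|)%:R :> R.
  by rewrite !natrM; field; rewrite !gt_eqF.
by rewrite ler_pM2r ?invr_gt0 ?ltr0n ?muln_gt0 ?TA0 // ler_nat leq_mul2l PQ orbT.
Qed.

Let X y i := density R cA 8 i (pA y).
(** The multiplier 7 is -1 modulo 8: the classes [i + e] and [7 * i] add up to [e]. *)
Let Y y i := density R cB 8 (7 * i) (pB y).

Let X01 y i : 0 <= X y i <= 1.
Proof. by rewrite /X density_ge0 density_le1. Qed.
Let Y01 y i : 0 <= Y y i <= 1.
Proof. by rewrite /Y density_ge0 density_le1. Qed.
Let Xper y i : X y (i + 8)%N = X y i.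
Proof. by apply: density_mod; rewrite modnDr. Qed.
Let Yper y i : Y y (i + 8)%N = Y y i.
Proof. by apply: density_mod; rewrite mulnDr -[(7 * 8)%N]/(8 * 7)%N addnC mulnC modnMDl mulnC. Qed.

Let T1 y i : 0 < y -> y < 1 -> X y (i + 1)%N <= k \/ Y y i <= k.
Proof.
move=> y0 y1; apply: (@poor_level 8 1) => //.
by rewrite (_ : i + 1 + 7 * i = i * 8 + 1)%N ?modnMDl //; ring.
Qed.

(* Classes modulo 8 are averages of [n] finer classes, matched to each other. *)
Let matched n e m c y i : (0 < n)%N -> (8 * n, c)%N \in square_types ->
  (e + 8 * (m + n.-1) = c %[mod 8 * n])%N ->
  0 < y -> y < 1 -> X y (i + e)%N + Y y i <= 1 + k.
Proof.
move=> n0 nc hc y0 y1; have nR : 0 < n%:R :> R by rewrite ltr0n.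
have n8 : (8 * n - 1 = 8 * n.-1 + 7)%N by move: n0; clear; case: n => // n _ /=; lia.
(* [8 * n - 1] acts as -1 modulo [8 * n], so [i] drops out of the sums. The subclass [j] of one side
   is matched with the subclass [n - 1 - j] of the other, whence a constant sum
   [e + 8 * (m + n.-1)]. *)
pose w0 := (8 * m + (8 * n - 1) * i)%N.
have w0E : (7 * i = w0 %[mod 8])%N.
  rewrite /w0; have -> : (8 * m + (8 * n - 1) * i = (n.-1 * i + m) * 8 + 7 * i)%N.
    by rewrite n8; ring.
  by rewrite modnMDl.
rewrite /X /Y (density_mod _ _ _ w0E) !(@density_refine _ _ _ _ 8 n) // -/w0.
rewrite [\sum_(j < n) density R cB _ _ _](reindex_inj rev_ord_inj) -mulrDr -big_split /=.
rewrite mulrC ler_pdivrMr // mulrC.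
apply: (@le_trans _ _ (\sum_(j < n) (1 + k))); last by rewrite sumr_const card_ord -[_ *+ n]mulr_natl.
apply: ler_sum => j _.
have d1 v (T : finType) (c' : T -> nat) p : (0 < #|T|)%N ->
   (forall v, (v < 128)%N -> (#|[pred x | c' x %% 128 == v]| * 128 = #|T|)%N) ->
   (8 * n %| 128)%N -> density R c' (8 * n) v p <= 1.
  move=> T0 fib /dvdnP[q qE].
  have q0 : (0 < q)%N by case: (q) qE.
  have TR : 0 < #|T|%:R :> R by rewrite ltr0n.
  have h w : density R c' 128 w p <= 1.
    rewrite /density mulrAC ler_pdivrMr // mul1r -natrM ler_nat -(fib (w %% 128)%N) ?ltn_mod //.
    rewrite mulnC leq_mul2r; apply/orP; right; apply: subset_leq_card.
    by apply/fintype.subsetP => x; rewrite !inE => /andP[].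
  have qR : 0 < q%:R :> R by rewrite ltr0n.
  rewrite (@density_refine _ _ _ T0 (8 * n) q) ?muln_gt0 ?n0 // mulrC ler_pdivrMr // mul1r.
  apply: (@le_trans _ _ (\sum_(j < q) 1)); last by rewrite sumr_const card_ord.
  by apply: ler_sum => j' _; rewrite mulnC -qE; exact: h.
have dv : (8 * n %| 128)%N.
  by move: nc; rewrite !inE => /or3P[] /eqP[-> _].
have hA := d1 (i + e + 8 * j)%N _ _ (pA y) TA0 fibA dv.
have hB := d1 (w0 + 8 * (n - j.+1))%N _ _ (pB y) TB0 fibB dv.
case: (@poor_level _ _ (i + e + 8 * j)%N (w0 + 8 * (n - j.+1))%N y nc _ y0 y1).
- rewrite /w0; have -> : (i + e + 8 * j + (8 * m + (8 * n - 1) * i + 8 * (n - j.+1)) =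
    i * (8 * n) + (e + 8 * (m + n.-1)))%N; last by rewrite modnMDl.
  have nE : n = (j + (n - j.+1)).+1 by move: (ltn_ord j); clear; lia.
  have n1 : (n.-1 = j + (n - j.+1))%N by rewrite {1}nE.
  rewrite n8; move: nE n1; move: (n - j.+1)%N => r; move: (nat_of_ord j) => j' nE n1.
  by rewrite n1 nE -[(j' + r).+1]addn1; clear; ring.
- by move=> h; rewrite addrC; apply: lerD.
- by move=> h; apply: lerD.
Qed.

(** Not all of 0 mod 8 consists of squares, so its 16 subclasses modulo 128 are matched to reach the
    sum 8 (3 + 15) = 144, which is 16 mod 128. *)
Let T0 y i : 0 < y -> y < 1 -> X y i + Y y i <= 1 + k.
Proof.
move=> y0 y1; rewrite -{1}[i]addn0; exact: (@matched 16 0 3 16). Qed.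

(** Likewise 4 + 8 (1 + 3) = 36 is 4 mod 32. *)
Let T4 y i : 0 < y -> y < 1 -> X y (i + 4)%N + Y y i <= 1 + k.
Proof. by move=> y0 y1; apply: (@matched 4 4 1 4). Qed.

Let bitsX y := mkseq (fun i => k < X y i) 8.
Let bitsY y := mkseq (fun i => k < Y y i) 8.
Let DA y := (2 <= count id (bitsX y))%N.
Let DB y := (2 <= count id (bitsY y))%N.

Let DA_down y y' : 0 < y -> y' < 1 -> y <= y' -> DA y' -> DA y.
Proof.
move=> _ _ yy' h; apply: leq_trans h _; rewrite /bitsX !count_mkseq; apply: leq_sum => i _.
case: (ltP k (X y' i)) => // h; have -> // : k < X y i.
apply: lt_le_trans h _; apply: density_mono => x; exact: le_trans.
Qed.

Let DB_up y y' : 0 < y -> y' < 1 -> y <= y' -> ~~ DB y' -> ~~ DB y.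
Proof.
move=> y0 _ yy'; apply: contra => h; apply: leq_trans h _; rewrite /bitsY !count_mkseq.
apply: leq_sum => i _; case: (ltP k (Y y i)) => // h; have -> // : k < Y y' i.
apply: lt_le_trans h _; apply: density_mono => x; apply: le_lt_trans.
by apply: hoffman_decr => //; exact: ltW.
Qed.

Let sumX y : \sum_(i < 8) X y i = 8 / #|TA|%:R * \sum_x (y <= a' x)%R%:R.
Proof. exact: sum_density8. Qed.

Let sumY y : \sum_(i < 8) Y y i = 8 / #|TB|%:R * \sum_x (hoffman y < b' x)%R%:R.
Proof.
rewrite -(@sum_density8 R TB cB (pB y) TB0) !big_ord_recr !big_ord0 /= /Y.
have E i j : (i = j %[mod 8])%N -> density R cB 8 i (pB y) = density R cB 8 j (pB y).
  by move=> h; apply: density_mod.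
rewrite (E (7 * 0) 0)%N // -[(7 * 1)%N]/7%N (E (7 * 2) 6)%N // (E (7 * 3) 5)%N //.
rewrite (E (7 * 4) 4)%N // (E (7 * 5) 3)%N // (E (7 * 6) 2)%N // (E (7 * 7) 1)%N //.
ring.
Qed.

Let middle y : 0 < y -> y < 1 -> DA y -> DB y ->
  8 / #|TA|%:R * (\sum_x (y <= a' x)%R%:R) + 8 / #|TB|%:R * (\sum_x (hoffman y < b' x)%R%:R) <= 6 + 10 * k.
Proof.
move=> y0 y1 hA hB; rewrite -sumX -sumY.
apply: stable_pair_middle => //; try exact: ltW.
- by move=> i; apply: T1.
- by move=> i; apply: T0.
- by move=> i; apply: T4.
Qed.

Let shift8 e (i : nat) : 'I_8 := Ordinal (ltn_pmod (i + e) (isT : 0 < 8)%N).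

Let shift8_neq i : (i < 8)%N ->
  [/\ shift8 1 i != shift8 4 i, shift8 1 i != i :> nat & shift8 4 i != i :> nat].
Proof. by case: i => [|[|[|[|[|[|[|[|i]]]]]]]]. Qed.

Let shift8_neq' i : (i < 8)%N ->
  [/\ shift8 7 i != shift8 4 i, shift8 7 i != i :> nat & shift8 4 i != i :> nat].
Proof. by case: i => [|[|[|[|[|[|[|[|i]]]]]]]]. Qed.

Let Xmod y i : X y (i %% 8)%N = X y i.
Proof. by apply: density_mod; rewrite modn_mod. Qed.
Let Ymod y i : Y y (i %% 8)%N = Y y i.
Proof. by apply: density_mod; rewrite modnMmr. Qed.

Let low y lam : 0 < y -> y < 1 -> 1 <= lam <= 3 -> ~~ DB y ->
  8 / #|TA|%:R * (\sum_x (y <= a' x)%R%:R) + lam * (8 / #|TB|%:R) * (\sum_x (hoffman y < b' x)%R%:R) <=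
  8 + 8 * k * lam.
Proof.
move=> y0 y1 hl hB; rewrite -[lam * _ * _]mulrA -sumX -sumY.
apply: (@stable_pair_end _ (X y) (Y y) k lam (shift8 1) (shift8 4)) => //; try exact: ltW.
- by move=> i; case/andP: (X01 y i).
- by move=> i; case/andP: (Y01 y i).
- by move=> i _; rewrite /= Xmod; apply: T1.
- by move=> i _; apply: T0.
- by move=> i _; rewrite /= Xmod; apply: T4.
- by move: hB; rewrite /DB -ltnNge.
Qed.

(** The roles of the two families are exchanged. The constraint linking [X] at [i + 1] with [Y] at
    [i] then shifts the index of [Y] by -1, hence [shift8 7]; the shift by 4 is its own inverse. *)
Let high y lam : 0 < y -> y < 1 -> 1 <= lam <= 3 -> ~~ DA y ->
  lam * (8 / #|TA|%:R) * (\sum_x (y <= a' x)%R%:R) + 8 / #|TB|%:R * (\sum_x (hoffman y < b' x)%R%:R) <=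
  8 + 8 * k * lam.
Proof.
move=> y0 y1 hl hA; rewrite -[lam * _ * _]mulrA -sumX -sumY addrC.
apply: (@stable_pair_end _ (Y y) (X y) k lam (shift8 7) (shift8 4)) => //; try exact: ltW.
- by move=> i; case/andP: (Y01 y i).
- by move=> i; case/andP: (X01 y i).
- by move=> i _; rewrite /= Ymod; case: (@T1 y (i + 7)%N y0 y1); rewrite -?addnA ?Xper; [right|left].
- by move=> i _; rewrite addrC; apply: T0.
- by move=> i _; rewrite /= Ymod addrC -Xper -[(i + 8)%N]/(i + (4 + 4))%N addnA; apply: T4.
- by move: hA; rewrite /DA -ltnNge.
Qed.

(* The levels [y] at which at least two classes mod 8 of [A] are large form an initial segment, those at
   which at least two classes of [B] are large a final one; their endpoints [p] and [q] separate the
   regimes [high], [middle] and [low]. *)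
Lemma poor_false : False.
Proof.
have [p0 [/andP[p00 p01] pl ph]] := downward_threshold DA_down.
have [q [/andP[q0 q1] ql qh]] := downward_threshold DB_up.
(* The maximum secures [q <= p]; the middle regime is empty when [p0] lies below [q]. *)
pose p := Num.max p0 q.
have qp : q <= p by rewrite le_max lexx orbT.
have p1 : p <= 1 by rewrite ge_max p01.
have pp : 0 <= p by exact: le_trans qp.
pose c1 : R := 8 / #|TA|%:R; pose c2 : R := 8 / #|TB|%:R.
have c10 : 0 <= c1 by rewrite divr_ge0 // ltW.
have c20 : 0 <= c2 by rewrite divr_ge0 // ltW.
have g0 : hoffman (0 : R) = 1 by rewrite /hoffman mulr0 subr0 addr0 divr1.
have g1 : hoffman (1 : R) = 0 by rewrite /hoffman subrr mul0r.
have k0' := ltW k0.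
have e0 : 0 <= 8 + 8 * k * (1 + 2 * p) by rewrite addr_ge0 // !mulr_ge0 // addr_ge0 // mulr_ge0.
(* The weights [1 + 2 * p] here and [lam = 3 / (1 + 2 * q)] in [R2] are chosen so that, after
   rescaling [R2], all three regimes have the same coefficients [c1] and [c2 * K] and can be added.
   Both weights lie in [1, 3]. *)
have R0 : c1 * (\sum_x (clamp 0 q (a' x) - 0)) + (1 + 2 * p) * c2 * ((1 + 2 * 0) * (1 + 2 * q) / 3) *
    (\sum_x (clamp (hoffman q) (hoffman 0) (b' x) - hoffman q)) <= (8 + 8 * k * (1 + 2 * p)) * (q - 0).
  apply: regime_sum => //; first by rewrite mulr_ge0 // addr_ge0 // mulr_ge0.
  move=> y y0 yq; apply: low => //; [exact: lt_le_trans yq q1| |exact: ql].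
  by apply/andP; split; lra.
have R1 : c1 * (\sum_x (clamp q p (a' x) - q)) + c2 * ((1 + 2 * q) * (1 + 2 * p) / 3) *
    (\sum_x (clamp (hoffman p) (hoffman q) (b' x) - hoffman p)) <= (6 + 10 * k) * (p - q).
  apply: regime_sum => //; first by rewrite addr_ge0 // mulr_ge0.
  move=> y qy yp; have y0 : 0 < y by exact: le_lt_trans qy.
  have y1 : y < 1 by exact: lt_le_trans p1.
  apply: middle => //; last by rewrite -[DB y]negbK; apply: qh.
  by apply: pl => //; move: yp; rewrite /p lt_max => /orP[//|yq]; move: qy; rewrite ltNge ltW.
pose lam := 3 / (1 + 2 * q).
have u0 : 0 < 1 + 2 * q by lra.
have lam13 : 1 <= lam <= 3.
  by rewrite /lam ler_pdivlMr // ler_pdivrMr //; apply/andP; split; lra.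
have R2 : lam * c1 * (\sum_x (clamp p 1 (a' x) - p)) + c2 * ((1 + 2 * p) * (1 + 2 * 1) / 3) *
    (\sum_x (clamp (hoffman 1) (hoffman p) (b' x) - hoffman 1)) <= (8 + 8 * k * lam) * (1 - p).
  have lam0 : 0 <= lam by case/andP: lam13 => h _; exact: le_trans h.
  have e2 : 0 <= 8 + 8 * k * lam by apply: addr_ge0 => //; do 2 (apply: mulr_ge0 => //).
  apply: regime_sum => //; first by rewrite mulr_ge0.
  move=> y py y1; have y0 : 0 < y by exact: le_lt_trans py.
  apply: high => //; apply: ph => //; apply: le_lt_trans py.
  by rewrite le_max lexx.
have sA : \sum_x a' x = \sum_x (clamp 0 q (a' x) - 0) + \sum_x (clamp q p (a' x) - q) +
    \sum_x (clamp p 1 (a' x) - p).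
  rewrite -!big_split /=; apply: eq_bigr => x _; have /andP[h0 h1] := a'01 x.
  by rewrite -clamp_telescope // subr0.
have gp0 : 0 <= hoffman p by rewrite -g1; apply: hoffman_decr.
have gpq : hoffman p <= hoffman q by apply: hoffman_decr.
have gq1 : hoffman q <= 1 by rewrite -g0; apply: hoffman_decr.
have sB : \sum_x b' x = \sum_x (clamp (hoffman q) (hoffman 0) (b' x) - hoffman q) +
    \sum_x (clamp (hoffman p) (hoffman q) (b' x) - hoffman p) +
    \sum_x (clamp (hoffman 1) (hoffman p) (b' x) - hoffman 1).
  rewrite g0 g1 -!big_split /=; apply: eq_bigr => x _; have /andP[h0 h1] := b'01 x.
  by rewrite addrC [X in _ + X]addrC addrA -clamp_telescope // subr0.
move: sA sB R0 R1 R2.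
set A0 := \sum_x (clamp 0 q _ - _); set A1 := \sum_x (clamp q p _ - _); set A2 := \sum_x (clamp p 1 _ - _).
set B0 := \sum_x (_ - hoffman q); set B1 := \sum_x (_ - hoffman p); set B2 := \sum_x (_ - hoffman 1).
move=> sA sB R0 R1 R2.
pose K := (1 + 2 * p) * (1 + 2 * q) / 3.
have K0 : 0 <= K by rewrite divr_ge0 // mulr_ge0 // addr_ge0 // mulr_ge0.
have {}R2 : c1 * A2 + c2 * K * B2 <= (1 - p) * (8 * ((1 + 2 * q) / 3) + 8 * k).
  have r0 : 0 <= (1 + 2 * q) / 3 by rewrite divr_ge0 // ltW.
  have := ler_wpM2l r0 R2.
  have -> : (1 + 2 * q) / 3 * (lam * c1 * A2 + c2 * ((1 + 2 * p) * (1 + 2 * 1) / 3) * B2) =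
    c1 * A2 + c2 * K * B2 by rewrite /lam /K; field; rewrite gt_eqF.
  have -> // : (1 + 2 * q) / 3 * ((8 + 8 * k * lam) * (1 - p)) =
    (1 - p) * (8 * ((1 + 2 * q) / 3) + 8 * k) by rewrite /lam; field; rewrite gt_eqF.
have {}R0 : c1 * A0 + c2 * K * B0 <= q * (8 + 8 * k * (1 + 2 * p)).
  apply: le_trans (le_trans _ R0) _; last by lra.
  by rewrite le_eqVlt; apply/orP; left; apply/eqP; rewrite /K; field.
have {}R1 : c1 * A1 + c2 * K * B1 <= (p - q) * (6 + 10 * k).
  apply: le_trans (le_trans _ R1) _; last by lra.
  by rewrite le_eqVlt; apply/orP; left; apply/eqP; rewrite /K; field.
have hA : 3 + 8 * k <= c1 * (A0 + A1 + A2).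
  have := ler_wpM2l c10 sumA'; rewrite -sA; apply: le_trans.
  by rewrite le_eqVlt; apply/orP; left; apply/eqP; rewrite /c1; field; rewrite gt_eqF.
have hB : 3 + 8 * k <= c2 * (B0 + B1 + B2).
  have := ler_wpM2l c20 sumB'; rewrite -sB; apply: le_trans.
  by rewrite le_eqVlt; apply/orP; left; apply/eqP; rewrite /c2; field; rewrite gt_eqF.
have := threshold_inequality q0 qp p1 k0; rewrite -/K.
have := ler_wpM2l K0 hB; lra.
Qed.

End Comb.

Lemma many_rich_pairs (R : realType) (TA TB : finType) (cA : TA -> nat) (cB : TB -> nat)
  (a : TA -> R) (b : TB -> R) (k d : R) :
  (0 < #|TA|)%N -> (0 < #|TB|)%N ->
  (forall v, (v < 128)%N -> (#|[pred x | cA x %% 128 == v]| * 128 = #|TA|)%N) ->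
  (forall v, (v < 128)%N -> (#|[pred x | cB x %% 128 == v]| * 128 = #|TB|)%N) ->
  0 < k -> 0 < d -> (forall x, 0 <= a x <= 1) -> (forall x, 0 <= b x <= 1) ->
  #|TA|%:R * (3 / 8 + k + d) <= \sum_x a x ->
  #|TB|%:R * (3 / 8 + k + d) <= \sum_x b x ->
  exists V c v w, [/\ (V, c) \in square_types, (v + w = c %[mod V])%N &
    k ^+ 2 * (#|TA| * #|TB|)%:R <= (V ^ 2 * #|[pred z : TA * TB |
      [&& (cA z.1 == v %[mod V])%N, (cB z.2 == w %[mod V])%N & 2 * d <= edge_gain (a z.1) (b z.2)]]|)%:R].
Proof.
move=> TA0 TB0 fA fB k0 d0 a01 b01 avA avB; apply: contrapT => nex.
apply: (@poor_false R TA TB cA cB a b k d) => // V c v w Vc vw.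
by rewrite ltNge; apply/negP => h; apply: nex; exists V, c, v, w.
Qed.

(** * Choice of scales *)

(* Scales in powers of [n]: [N] is about [n ^ 20], so the roots are of size [n ^ 10]; the blocks of [A]
   have length [n ^ 18], those of [B] length [n ^ 15], the two scales at which [B] is averaged are
   [n ^ 11] and [n ^ 7], and the van der Corput shifts are multiples of [n ^ 4]. The factor [U`!] makes
   all the common differences [2 * Q ^ 2 * u * n ^ 4], [u < U], divide the averaging length. *)
Section Scale.

Variables (R : realFieldType) (A B : nat -> R).
Hypotheses (A01 : forall x, A x = 0 \/ A x = 1) (B01 : forall x, B x = 0 \/ B x = 1).
Variables (Q U n c0 D M0 M1 r s t iI jJ : nat) (eta theta : R).
Hypotheses (rQ : (r < Q)%N) (sQ : (s < Q)%N) (tQ : (t < Q)%N) (jJ0 : (0 < jJ)%N) (U3 : (3 <= U)%N).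
Hypotheses (c00 : (0 < c0)%N) (D0 : (0 < D)%N) (nE : n = (4 * Q ^ 2 * U`! * c0)%N).
Hypothesis srt : (s + t = r ^ 2 %[mod Q])%N.
Hypotheses (eta0 : 0 < eta) (eta1 : eta <= 1 / 10) (theta0 : 0 < theta) (thetaE : theta ^+ 2 = eta).
Hypothesis etaU : 1 <= eta * U%:R.
Hypothesis large : 100 * (Q ^ 2 * U * D ^ 2)%:R <= eta * n%:R.
Let i0 := (iI * n ^ 18)%N.
Let j0 := (jJ * n ^ 15)%N.
Hypothesis i0_large : (n ^ 20 <= D ^ 2 * i0)%N.
Hypotheses (M0S : (M0 ^ 2 <= i0 + j0)%N) (M1S : (i0 + j0 + n ^ 18 + n ^ 15 <= M1 ^ 2)%N).
Hypotheses (M0n : (n ^ 10 <= D * M0)%N) (M1n : (M1 <= 3 * n ^ 10)%N) (M01 : (M0 <= M1)%N).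
Hypothesis M0M1 : 8 * (M1 - M0)%:R <= eta * M0%:R.

(** By the factorisation [nE], [Q * k1 = n ^ 7]; the further factors give block lengths [n ^ 11],
    [n ^ 15] and [n ^ 18]. *)
Let k' := (U`! * c0 * n ^ 6)%N.
Let k1 := (4 * Q * k')%N.
Let kmid := (n ^ 4 * k1)%N.
Let kJ := (n ^ 4 * kmid)%N.
Let kI := (n ^ 3 * kJ)%N.
Let m x := ((r + Q * x) ^ 2)%N.
Let H := (n ^ 4)%N.
(** Near [M1 ^ 2] the squares of the progression are about [2 * Q * M1] apart, so this is the
    expected number in an interval of length [n ^ 15]. *)
Variable w0 : R.
Hypothesis w0_def : w0 = n%:R ^+ 15 / (2 * Q%:R * M1%:R).

Let Q0 : (0 < Q)%N. Proof. exact: leq_ltn_trans rQ. Qed.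
Let U0 : (0 < U)%N. Proof. exact: leq_trans U3. Qed.
Let n0 : (0 < n)%N. Proof. by rewrite nE !muln_gt0 Q0 fact_gt0 c00. Qed.

Let Qk1 : (Q * k1 = n ^ 7)%N.
Proof. by rewrite /k1 /k' (expnS n 6) {2}nE; ring. Qed.
Let Qkmid : (Q * kmid = n ^ 11)%N.
Proof. by rewrite /kmid mulnCA Qk1 -expnD. Qed.
Let QkJ : (Q * kJ = n ^ 15)%N.
Proof. by rewrite /kJ mulnCA Qkmid -expnD. Qed.
Let QkI : (Q * kI = n ^ 18)%N.
Proof. by rewrite /kI mulnCA QkJ -expnD. Qed.

Let nR : 0 < n%:R :> R. Proof. by rewrite ltr0n. Qed.
Let QR : 1 <= Q%:R :> R. Proof. by rewrite ler1n. Qed.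
Let UR : 3 <= U%:R :> R. Proof. by rewrite ler_nat. Qed.
Let DR : 1 <= D%:R :> R. Proof. by rewrite ler1n. Qed.

Let large_of (x : nat) : (x <= Q ^ 2 * U * D ^ 2)%N -> 100 * x%:R <= eta * n%:R.
Proof. by move=> h; apply: le_trans large; rewrite ler_pM2l // ler_nat. Qed.

Let QUD (a b : nat) : (a <= 2)%N -> (b <= 2)%N -> (Q ^ a * U * D ^ b <= Q ^ 2 * U * D ^ 2)%N.
Proof.
move=> a2 b2; apply: leq_mul; last by rewrite leq_pexp2l.
by apply: leq_mul => //; rewrite leq_pexp2l.
Qed.

Let large1 : 100 * (Q%:R * U%:R * D%:R) <= eta * n%:R.
Proof. by have := QUD (leqnSn 1) (leqnSn 1); rewrite !expn1 => /large_of; rewrite !natrM. Qed.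

Let large2 : 100 * (Q%:R * U%:R) <= eta * n%:R.
Proof. by have := QUD (leqnSn 1) (leq0n 2); rewrite expn1 muln1 => /large_of; rewrite !natrM. Qed.

Let n1000 : 1000 <= n%:R :> R.
Proof.
have : eta * n%:R <= 1 / 10 * n%:R by apply: ler_wpM2r => //; exact: ltW.
have : 3 <= Q%:R * U%:R :> R by rewrite -[3]mul1r; apply: ler_pM.
by move: large2; lra.
Qed.

Let M00 : (0 < M0)%N.
Proof. by rewrite lt0n; apply: contraTneq M0n => ->; rewrite muln0 -ltnNge expn_gt0 n0. Qed.
Let M10 : (0 < M1)%N. Proof. exact: leq_trans M01. Qed.

Let m0 : 0 < M0%:R :> R. Proof. by rewrite ltr0n. Qed.
Let m1 : 0 < M1%:R :> R. Proof. by rewrite ltr0n. Qed.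
Let q0 : 0 < Q%:R :> R. Proof. by rewrite ltr0n. Qed.

Let m1n : M1%:R <= 3 * n%:R ^+ 10 :> R.
Proof. by rewrite -natrX -natrM ler_nat. Qed.

Let w00 : 0 < w0.
Proof. by rewrite w0_def divr_gt0 ?exprn_gt0 // !mulr_gt0. Qed.

Let w0E : w0 * (2 * Q%:R * M1%:R) = n%:R ^+ 15.
Proof. by rewrite w0_def divfK // gt_eqF // !mulr_gt0. Qed.

Let w0_ge : n%:R ^+ 5 <= 6 * Q%:R * w0.
Proof.
have p10 : 0 < n%:R ^+ 10 :> R by rewrite exprn_gt0.
rewrite -(ler_pM2r p10) -exprD -w0E.
have -> : w0 * (2 * Q%:R * M1%:R) = 2 * Q%:R * w0 * M1%:R by ring.
have -> : 6 * Q%:R * w0 * n%:R ^+ 10 = 2 * Q%:R * w0 * (3 * n%:R ^+ 10) by ring.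
by apply: ler_wpM2l => //; rewrite !mulr_ge0 // ltW.
Qed.

Let Un4 : U%:R * n%:R ^+ 4 <= eta / 16 * w0.
Proof.
have p4 : 0 < n%:R ^+ 4 :> R by rewrite exprn_gt0.
have h1 : 100 * (Q%:R * U%:R) * n%:R ^+ 4 <= eta * n%:R ^+ 5.
  by rewrite [n%:R ^+ 5]exprS [leRHS]mulrA; apply: ler_wpM2r large2; exact: ltW.
have h2 := ler_wpM2l (ltW eta0) w0_ge.
rewrite -(ler_pM2l q0).
have p : 0 <= Q%:R * (eta * w0) by rewrite !mulr_ge0 // ltW.
have p' : 0 <= Q%:R * (U%:R * n%:R ^+ 4) :> R by rewrite -natrX -!natrM ler0n.
by move: h1 h2 p p'; lra.
Qed.

Let n4 : n%:R ^+ 4 <= eta / 48 * w0.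
Proof.
have p4 : 0 < n%:R ^+ 4 :> R by rewrite exprn_gt0.
have := ler_wpM2r (ltW p4) UR; have := Un4; lra.
Qed.

Let ratio : n%:R ^+ 15 / (2 * Q%:R * M0%:R) <= (1 + eta / 8) * w0.
Proof.
rewrite ler_pdivrMr ?mulr_gt0 // -w0E.
have h : M1%:R <= (1 + eta / 8) * M0%:R.
  by have := M0M1; rewrite natrB //; lra.
have p : 0 <= w0 * (2 * Q%:R) by rewrite !mulr_ge0 // ltW.
by have := ler_wpM2l p h; lra.
Qed.

Let w := (n ^ 15 %/ (2 * Q * M0) + 1)%N.

Let w_le : w%:R <= (1 + eta / 8) * w0 + 1.
Proof.
rewrite natrD lerD2r; apply: le_trans ratio.
rewrite ler_pdivlMr ?mulr_gt0 // -!natrM -natrX ler_nat -mulnA; exact: leq_trunc_div.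
Qed.

Let N1 : (w + U * H)%:R <= (1 + eta) * w0.
Proof.
rewrite natrD natrM /H natrX.
have := w_le; have := Un4; have := n4.
have : 1 <= n%:R ^+ 4 :> R by rewrite exprn_ege1 // ler1n.
have : 0 < eta * w0 by rewrite mulr_gt0.
lra.
Qed.

Let n3 : 1000 <= n%:R ^+ 3 :> R.
Proof.
by apply: le_trans n1000 _; rewrite exprS ler_peMr ?ler0n // exprn_ege1 // ler1n.
Qed.

Let eta_n3 : 100 <= eta * n%:R ^+ 3.
Proof.
have : 100 <= eta * n%:R.
  have : 1 <= Q%:R * U%:R :> R by rewrite -natrM ler1n muln_gt0 Q0.
  by have := large2; lra.
move=> h; apply: le_trans h _; rewrite exprS mulrA ler_peMr ?exprn_ege1 ?ler1n //.
by rewrite mulr_ge0 // ltW.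
Qed.

Let kJR : kJ%:R * Q%:R = n%:R ^+ 15 :> R.
Proof. by rewrite -natrM mulnC QkJ natrX. Qed.

Let kIw : kI%:R * w0 = kJ%:R * (n%:R ^+ 3 * w0).
Proof. by rewrite /kI natrM natrX; ring. Qed.

Let kJ0 : 0 <= kJ%:R :> R. Proof. exact: ler0n. Qed.

Let N5 : (2 * w * kJ)%:R <= eta * (kI%:R * w0).
Proof.
rewrite kIw natrM natrM.
have -> : eta * (kJ%:R * (n%:R ^+ 3 * w0)) = eta * n%:R ^+ 3 * w0 * kJ%:R by ring.
apply: ler_wpM2r => //.
have := ler_wpM2r (ltW w00) eta_n3; have := w_le; have := n4; have := eta1.
have : 1 <= n%:R ^+ 4 :> R by rewrite exprn_ege1 // ler1n.
have : eta * w0 <= 1 / 10 * w0 by apply: ler_wpM2r => //; exact: ltW.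
lra.
Qed.

Let n7 : n%:R ^+ 7 <= eta / 4 * (n%:R ^+ 3 * w0).
Proof.
have p3 : 0 <= n%:R ^+ 3 :> R by rewrite exprn_ge0.
rewrite -[7%N]/(3 + 4)%N exprD [leRHS]mulrCA; apply: ler_wpM2l => //.
have : 0 < eta * w0 by rewrite mulr_gt0.
by have := n4; lra.
Qed.

Let N3 : kJ%:R * (2 * (2 * k'))%:R <= eta * (kI%:R * w0).
Proof.
rewrite kIw mulrCA; apply: ler_wpM2l => //.
apply: (@le_trans _ _ (4 * n%:R ^+ 7)); last by have := n7; lra.
rewrite mulnA natrM; apply: ler_wpM2l => //; rewrite -natrX ler_nat.
rewrite -Qk1 /k1 mulnA; apply: leq_pmull; rewrite !muln_gt0 Q0 //.
Qed.

Let g1 := (2 * U`! * c0 * n ^ 2)%N.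

Let N3' : kJ%:R * (2 * (n ^ 4 * g1))%:R <= eta * (kI%:R * w0).
Proof.
rewrite kIw mulrCA; apply: ler_wpM2l => //.
apply: (@le_trans _ _ (4 * n%:R ^+ 7)); last by have := n7; lra.
have g1n : (n ^ 4 * g1 <= n ^ 7)%N.
  rewrite (expnD n 4 3) leq_mul2l; apply/orP; right.
  have -> : (n ^ 3 = g1 * (2 * Q ^ 2))%N by rewrite /g1 (expnS n 2) {1}nE; ring.
  by apply: leq_pmulr; rewrite !muln_gt0 Q0.
rewrite natrM; move: g1n; rewrite -(ler_nat R) natrX.
have : 0 <= n%:R ^+ 7 :> R by rewrite -natrX.
lra.
Qed.

Let gU u : (0 < u < U)%N -> exists g, (k1 = 2 * Q * u * H * g)%N /\ (0 < g <= g1)%N.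
Proof.
move=> /andP[u0 uU]; have /dvdnP[f fE] : (u %| U`!)%N by apply: dvdn_fact; rewrite u0 ltnW.
have f0 : (0 < f)%N by rewrite lt0n; apply: contraTneq (fact_gt0 U) => f0; rewrite fE f0.
exists (2 * f * c0 * n ^ 2)%N; split.
  by rewrite /k1 /k' /H fE (expnD n 4 2); ring.
rewrite !muln_gt0 f0 c00 n0 /= /g1.
by rewrite !leq_mul2r; apply/orP; right; apply/orP; right; rewrite leq_mul2l fE leq_pmulr.
Qed.

Let M0_large : 100 * (Q * U)%:R * n%:R ^+ 9 <= M0%:R :> R.
Proof.
have D' : 0 < D%:R :> R by rewrite ltr0n.
have h : n%:R ^+ 10 <= D%:R * M0%:R :> R by rewrite -natrX -natrM ler_nat.
rewrite -(ler_pM2l D'); apply: le_trans h.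
have p9 : 0 <= n%:R ^+ 9 :> R by rewrite exprn_ge0.
rewrite [leRHS]exprS mulrA; apply: ler_wpM2r => //.
have := large1; rewrite natrM.
have : eta * n%:R <= 1 / 10 * n%:R by apply: ler_wpM2r => //; exact: ltW.
have : 0 < n%:R :> R by [].
lra.
Qed.

Let QUM0 : (100 * (Q * U * n ^ 9) <= M0)%N.
Proof. by have := M0_large; rewrite -natrX -!natrM ler_nat -!mulnA. Qed.

Let n_ge : (1000 <= n)%N.
Proof. by rewrite -(ler_nat R). Qed.

Let n_big : (1000 * (Q ^ 2 * U * D ^ 2) <= n)%N.
Proof.
have : eta * n%:R <= 1 / 10 * n%:R by apply: ler_wpM2r => //; exact: ltW.
have := large; rewrite -(ler_nat R) [(1000 * _)%:R]natrM.
set x := (Q ^ 2 * U * D ^ 2)%:R; lra.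
Qed.

(** Moving a root back by all the shifts, that is by [Q * U * n ^ 4], lowers its square by at most
    about [2 * M1 * (Q * U * n ^ 4)]. Since [i0] absorbs this, shifted squares still exceed the
    whole cell of [B]. *)
Let i0_big : (n ^ 15 + 2 * M1 * (Q * U * n ^ 4) <= i0)%N.
Proof.
have D20 : (0 < D ^ 2)%N by rewrite expn_gt0 D0.
rewrite -(leq_pmul2l D20); apply: leq_trans i0_large.
apply: (@leq_trans (D ^ 2 * (7 * (Q * U) * n ^ 15))).
  rewrite leq_pmul2l //.
  have h1 : (2 * M1 * (Q * U * n ^ 4) <= 6 * (Q * U) * n ^ 14)%N.
    apply: (@leq_trans (2 * (3 * n ^ 10) * (Q * U * n ^ 4))).
      by rewrite leq_mul2r leq_mul2l M1n !orbT.
    by rewrite (expnD n 10 4); apply/eq_leq; ring.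
  have h2 : (6 * (Q * U) * n ^ 14 <= 6 * (Q * U) * n ^ 15)%N.
    by rewrite leq_mul2l leq_pexp2l ?orbT.
  have h3 : (n ^ 15 <= (Q * U) * n ^ 15)%N by apply: leq_pmull; rewrite muln_gt0 Q0.
  apply: leq_trans (leq_add h3 (leq_trans h1 h2)) _.
  by apply/eq_leq; ring.
apply: (@leq_trans (n * n ^ 15)); last by rewrite -expnS leq_pexp2l.
rewrite mulnA leq_mul2r; apply/orP; right; apply: leq_trans n_big.
have -> : (D ^ 2 * (7 * (Q * U)) = 7 * (Q * U * D ^ 2))%N by ring.
apply: leq_mul => //; rewrite leq_mul2r; apply/orP; right.
by rewrite leq_mul2r leq_pmull ?orbT.
Qed.

Let Qn : (Q <= n)%N.
Proof.
apply: leq_trans n_big; apply: leq_trans (_ : Q <= Q ^ 2 * U * D ^ 2)%N _; last exact: leq_pmull.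
have -> : (Q ^ 2 * U * D ^ 2 = Q * (Q * U * D ^ 2))%N by ring.
by rewrite leq_pmulr // !muln_gt0 Q0 U0 D0.
Qed.

Let Q_small : Q%:R <= eta / 2 * M1%:R :> R.
Proof.
have h1 : Q%:R * (100 * n%:R) <= M0%:R :> R.
  have : (Q * (100 * n) <= M0)%N.
    apply: leq_trans QUM0.
    have -> : (Q * (100 * n) = 100 * (Q * n))%N by ring.
    rewrite leq_mul2l -mulnA leq_mul2l; apply/orP; right; apply/orP; right.
    by rewrite (expnS n 8) mulnCA leq_pmulr // muln_gt0 U0 expn_gt0 n0.
  by rewrite -(ler_nat R) !natrM.
have h2 : 100 <= eta * n%:R.
  have : 1 <= Q%:R * U%:R :> R by rewrite -natrM ler1n muln_gt0 Q0.
  by have := large2; lra.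
have h3 : M0%:R <= M1%:R :> R by rewrite ler_nat.
have h4 := ler_wpM2l (ltW eta0) (le_trans h1 h3).
have h5 := ler_wpM2r (ltW q0) h2.
by move: h4 h5 q0; lra.
Qed.

Lemma scaled_local_count :
  \sum_(x < jJ.+1 * (Q * kJ)) ((in_cell kJ Q jJ t x)%:R *
      (cell_avg k' (Q * (4 * Q)) B x - cell_avg k1 Q B x)) ^+ 2 <= eta * kJ%:R ->
  exists Z K, kI%:R * w0 * (edge_gain (kI%:R^-1 * \sum_(i < kI) A (iI * (Q * kI) + s + Q * i)%N)
      (kJ%:R^-1 * \sum_(i < kJ) B (jJ * (Q * kJ) + t + Q * i)%N) / 6 - 7 * theta) <=
   \sum_(0 <= a < Z | in_cell kI Q iI s a) A a * \sum_(0 <= x < K)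
      (in_cell kJ Q jJ t (m x - a)%N)%:R * B (m x - a)%N.
Proof.
move=> energy.
have [c [d [cd cdP cd_up cd_low]]] := square_window (i0 + j0)%N (n ^ 18 + n ^ 15)%N rQ.
have {}cd_up := cd_up _ M0S.
have {}cd_low : (n ^ 18 + n ^ 15 <= (d - c + 1) * (Q * (2 * M1 + Q)))%N.
  by apply: cd_low; rewrite addnA.
have n9 : (n ^ 4 <= n ^ 9)%N by rewrite leq_pexp2l.
have lt_cd : (c < d)%N.
  rewrite ltnNge; apply/negP => dc; move: cd_low.
  have -> : (d - c = 0)%N by move: dc; clear; lia.
  rewrite add0n mul1n leqNgt => /negP; apply.
  apply: (@leq_ltn_trans (7 * n ^ 11)).
    apply: (@leq_trans (n * (2 * (3 * n ^ 10) + n ^ 10))).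
      apply: leq_mul => //; apply: leq_add; first by rewrite leq_mul2l M1n.
      by apply: leq_trans Qn _; rewrite -{1}[n]expn1 leq_pexp2l.
    by rewrite (expnS n 10); apply/eq_leq; ring.
  apply: (@leq_trans (n ^ 18)); last exact: leq_addr.
  rewrite -[18%N]/(7 + 11)%N expnD ltn_pmul2r ?expn_gt0 ?n0 //.
  rewrite expnS; apply: (@leq_trans n); first by apply: leq_trans n_ge.
  by apply: leq_pmulr; rewrite expn_gt0 n0.
have mc : (i0 + j0 <= m c)%N.
  by have := cdP c; rewrite leqnn lt_cd /= => /andP[].
have xM0 : (M0 <= r + Q * c)%N by rewrite -leq_sqr; exact: leq_trans mc.
have UHn : (U * H <= c)%N.
  have h1 : (Q * (100 * (U * n ^ 9)) < Q * c.+1)%N.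
    apply: leq_ltn_trans (_ : r + Q * c < _)%N; last by rewrite mulnS ltn_add2r.
    by apply: leq_trans xM0; apply: leq_trans QUM0; apply/eq_leq; ring.
  rewrite ltn_pmul2l // ltnS in h1; apply: leq_trans h1.
  apply: leq_trans (_ : U * n ^ 9 <= _)%N; first by rewrite leq_mul2l n9 orbT.
  exact: leq_pmull.
pose L := (d - c + U * H)%N.
(* The range begins [U * H] before the first relevant index, so that all shifted indices stay inside
   it. *)
pose n1 := (c - U * H)%N.
have n1c : (n1 + U * H = c)%N by rewrite subnK.
have n1L : (n1 + L = d)%N by rewrite /L addnCA n1c subnK.
pose Z := ((m (n1 + L + U * H)).+1 + (i0 + n ^ 18))%N.
exists Z, d.
have N2 : L%:R * kJ%:R <= (1 + eta) * (kI%:R * w0).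
  rewrite kIw mulrC [leRHS]mulrCA; apply: ler_wpM2l => //.
  have dcR : (d - c)%:R <= (n%:R ^+ 3 + 1) * ((1 + eta / 8) * w0) + 1.
    have qm : 0 < 2 * Q%:R * M0%:R :> R by rewrite !mulr_gt0.
    have h : (d - c)%:R * (2 * Q%:R * M0%:R) <= n%:R ^+ 18 + n%:R ^+ 15 + 2 * Q%:R * M0%:R :> R.
      by rewrite -!natrX -!natrM -!natrD ler_nat.
    rewrite -ler_pdivlMr // in h; apply: le_trans h _.
    rewrite mulrDl divff ?gt_eqF // lerD2r.
    have -> : (n%:R ^+ 18 + n%:R ^+ 15) / (2 * Q%:R * M0%:R) =
       (n%:R ^+ 3 + 1) * (n%:R ^+ 15 / (2 * Q%:R * M0%:R)) :> R.
      by rewrite mulrA; congr (_ / _); ring.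
    by apply: ler_wpM2l ratio; rewrite addr_ge0 ?exprn_ge0.
  rewrite /L natrD natrM /H natrX.
  have t1 := ler_wpM2r (ltW w00) eta_n3.
  have t2 : eta * w0 * 1000 <= eta * w0 * n%:R ^+ 3.
    by apply: ler_wpM2l => //; rewrite mulr_ge0 // ltW.
  have t3 : 1 <= n%:R ^+ 4 :> R by rewrite exprn_ege1 // ler1n.
  have := Un4; have := n4; have t4 : 0 < eta * w0 by rewrite mulr_gt0.
  move: dcR t1 t2 t3 t4 w00; lra.
have hX : (jJ.+1 * (Q * kJ) <= m n1)%N.
  rewrite QkJ mulSnr -/j0.
  (* The root at [c] may exceed [M1]; the minimum keeps the loss below [2 * M1 * y] and still has
     square at least [i0 + j0]. *)
  pose y := (Q * U * n ^ 4)%N; pose x0 := minn (r + Q * c)%N M1.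
  have yE : (r + Q * n1 = r + Q * c - y)%N.
    by rewrite /n1 mulnBr addnBA ?leq_mul2l ?UHn ?orbT // mulnA.
  have x0S : (i0 + j0 <= x0 ^ 2)%N.
    rewrite /x0; case: (leqP (r + Q * c)%N M1) => // _.
    by apply: leq_trans M1S; rewrite -addnA leq_addr.
  have x0M : (x0 <= M1)%N by rewrite geq_minr.
  apply: (@leq_trans ((x0 - y) ^ 2)); last by rewrite /m yE leq_sqr leq_sub2r // geq_minl.
  have sq : (x0 ^ 2 <= (x0 - y) ^ 2 + 2 * M1 * y)%N.
    case: (leqP y x0) => [yx|xy].
      apply: (@leq_trans ((x0 - y) ^ 2 + 2 * x0 * y)).
        by rewrite -{1 3}(subnK yx); apply: (@leq_trans ((x0 - y + y) ^ 2 + y ^ 2)); [exact: leq_addr|apply/eq_leq; ring].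
      by rewrite leq_add2l leq_mul2r leq_mul2l x0M !orbT.
    apply: leq_trans (leq_addl _ _); rewrite -mulnn; apply: leq_mul; last exact: ltnW.
    by apply: leq_trans x0M _; rewrite leq_pmull.
  have := i0_big; rewrite -/y => ib.
  move: (leq_trans x0S sq) ib; move: ((x0 - y) ^ 2)%N (2 * M1 * y)%N (n ^ 15)%N.
  by clear; lia.
have range x : (iI * (Q * kI) + jJ * (Q * kJ) <= (r + Q * x) ^ 2 <
    iI * (Q * kI) + jJ * (Q * kJ) + Q * kI + Q * kJ)%N -> (n1 + U * H <= x < n1 + L)%N.
  by rewrite n1c n1L -cdP QkI QkJ -/i0 -/j0 -addnA.
have Zm : (m (n1 + L + U * H) < Z)%N by rewrite /Z ltnS leq_addr.
have ZI : (iI * (Q * kI) + Q * kI <= Z)%N by rewrite QkI -/i0 /Z leq_addl.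
have window z : (iI * (Q * kI) + jJ * (Q * kJ) <= z <= iI * (Q * kI) + jJ * (Q * kJ) + Q * kI)%N ->
   exists nu, forall x, (z <= (r + Q * x) ^ 2 < z + Q * kJ)%N -> (nu <= x < nu + w)%N.
  rewrite QkI QkJ -/i0 -/j0 => /andP[zl _].
  have [c' [d' [cd' cdP' up' _]]] := square_window z (n ^ 15)%N rQ.
  exists c' => x; rewrite cdP' => /andP[-> xd] /=; apply: leq_trans xd _.
  have h := up' _ (leq_trans M0S zl).
  have qm : (0 < 2 * Q * M0)%N by rewrite !muln_gt0 Q0 M00.
  rewrite -leq_subLR /w addn1; move: h; case: (d' - c')%N => [|e] // h.
  rewrite mulSn addnC leq_add2r in h.
  by rewrite ltnS leq_divRL.
have midcnt z : (iI * (Q * kI) + jJ * (Q * kJ) <= z)%N ->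
   (z + Q * kmid <= iI * (Q * kI) + jJ * (Q * kJ) + Q * kI + Q * kJ)%N ->
   (1 - eta) * w0 <= (n ^ 4)%:R *
      (\sum_(0 <= x < d) ((z <= (r + Q * x) ^ 2 < z + Q * kmid)%N)%:R).
  rewrite QkI QkJ Qkmid -/i0 -/j0 => zl zu.
  have [c' [d' [cd' cdP' _ low']]] := square_window z (n ^ 11)%N rQ.
  have {}low' := low' _ (leq_trans zu M1S).
  have -> : \sum_(0 <= x < d) ((z <= (r + Q * x) ^ 2 < z + n ^ 11)%N)%:R = (d' - c')%:R :> R.
    rewrite (eq_bigr (fun x => ((c' <= x < d')%N)%:R)); last by move=> x _; rewrite cdP'.
    have [dc|lt_cd'] := leqP d' c'.
      have -> : (d' - c' = 0)%N by move: dc; clear; lia.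
      apply: big1 => x _; suff /negbTE -> : ~~ (c' <= x < d')%N by [].
      by move: dc; clear; lia.
    rewrite (@sum_nat_supp _ _ 0 d c' d') //; last by move=> x /negbTE ->.
      rewrite (eq_big_nat _ _ (F2 := fun=> 1)); last by move=> x ->.
      by rewrite sumr_const_nat.
    have : (c' <= d'.-1 < d')%N by move: lt_cd'; clear; lia.
    rewrite -cdP' => /andP[h1 h2].
    have : (c <= d'.-1 < d)%N.
      by rewrite -cdP (leq_trans zl h1) /= addnA; apply: leq_trans h2 zu.
    by move: lt_cd'; clear; lia.
  have lowR : n%:R ^+ 11 <= ((d' - c')%:R + 1) * (Q%:R * (2 * M1%:R + Q%:R)) :> R.
    by move: low'; rewrite -(ler_nat R) natrX !(natrM, natrD).
  have p4 : 0 < n%:R ^+ 4 :> R by rewrite exprn_gt0.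
  have h1 : w0 * (2 * M1%:R) <= (n%:R ^+ 4 * (d' - c')%:R + n%:R ^+ 4) * (2 * M1%:R + Q%:R).
    rewrite -(ler_pM2l q0).
    have -> : Q%:R * (w0 * (2 * M1%:R)) = n%:R ^+ 4 * n%:R ^+ 11 by rewrite -exprD -w0E; ring.
    by have := ler_wpM2l (ltW p4) lowR; lra.
  (* The rounding term [n ^ 4] costs less than half of the allowance [eta * w0]; the other half
     covers the [Q] in [2 * M1 + Q], by [Q_small]. *)
  rewrite natrX leNgt; apply/negP => h2.
  have h3 : n%:R ^+ 4 * (d' - c')%:R + n%:R ^+ 4 < (1 - eta / 2) * w0.
    by have := n4; have := mulr_gt0 eta0 w00; move: h2; lra.
  have mq : 0 < 2 * M1%:R + Q%:R :> R by rewrite addr_gt0 // mulr_gt0.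
  have := le_lt_trans h1 (_ : _ < (1 - eta / 2) * w0 * (2 * M1%:R + Q%:R)).
  rewrite ltr_pM2r // => /(_ h3).
  have := ler_wpM2l (ltW w00) Q_small.
  have := mulr_gt0 (mulr_gt0 eta0 w00) q0; have := mulr_gt0 (mulr_gt0 eta0 w00) m1.
  by move: (M1%:R : R) (Q%:R : R) => x y; lra.
have kI0 : (0 < kI)%N by rewrite /kI /kJ /kmid /k1 /k' !muln_gt0 !n0 Q0 fact_gt0 c00.
have k'0 : (0 < k')%N by rewrite /k' !muln_gt0 !n0 fact_gt0 c00.
have H0 : (0 < H)%N by rewrite expn_gt0 n0.
have key := @local_count R A B A01 B01 Q r s t U H k' k1 kmid kJ (n ^ 4) (n ^ 4) kI iI jJ g1
  erefl erefl erefl Q0 H0 sQ tQ k'0 H0 H0 kI0 jJ0 U3 srt gU n1 L w d Z w0 eta hX Zm ZI _ range window midcnt eta0 eta1 w00 N1 N2 N3 N3' etaU N5 energy theta theta0 thetaE.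
apply: le_trans (key _); last by rewrite n1L.
rewrite le_eqVlt; apply/orP; left; apply/eqP; rewrite /edge_gain; field.
by rewrite !pnatr_eq0 -!lt0n kI0 andbT /kJ /kmid /k1 /k' !muln_gt0 !n0 Q0 fact_gt0 c00.
Qed.

End Scale.

(** * Summation over cells *)

Definition isqrt (n : nat) : nat := PeanoNat.Nat.sqrt n.

Lemma isqrtP n : (isqrt n ^ 2 <= n < (isqrt n).+1 ^ 2)%N.
Proof. by have := PeanoNat.Nat.sqrt_specif n; rewrite /isqrt -!mulnn; lia. Qed.

Lemma isqrt_sqr m : isqrt (m ^ 2) = m.
Proof.
have /andP[] := isqrtP (m ^ 2); rewrite leq_sqr ltn_sqr ltnS => h1 h2.
by apply/eqP; rewrite eqn_leq h1.
Qed.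

(* Averaging modulo [Q * (4 * Q)] instead of [Q] resolves the progressions of common difference
   [2 * Q ^ 2] that arise when differencing [(r + Q * n) ^ 2]. *)
Fixpoint scale_chain (i : nat) : nat :=
  if i is j.+1 then (scale_chain j * (4 * scale_chain j))%N else 128%N.

Lemma scale_chain_pow2 i : exists k, scale_chain i = (2 ^ k)%N /\ (7 <= k)%N.
Proof.
elim: i => [|i [k [E k7]]]; first by exists 7%N.
exists (k + (2 + k))%N; rewrite /= E !expnD; split=> //.
by apply: leq_trans k7 _; rewrite leq_addr.
Qed.

Lemma scale_chain_dvd i j : (i <= j)%N -> (scale_chain i %| scale_chain j)%N.
Proof.
move=> /subnK <-; elim: (j - i)%N => [|m IH]; first by rewrite add0n.
by rewrite addSn /= dvdn_mulr.
Qed.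

(** All averages use blocks of length [n ^ 7], so consecutive differences are energy increments and
    telescope. The final energy is at most the number of points, hence one of the [T] increments is
    at most a [T]-th of it. *)
Lemma energy_pigeonhole (R : realFieldType) (B : nat -> R) (nb n T : nat) :
  (forall x, 0 <= B x <= 1) -> (0 < T)%N -> (scale_chain T %| n)%N ->
  exists2 i, (i < T)%N & T%:R * (\sum_(x < nb * n ^ 7)
    (cell_avg (n ^ 7 %/ scale_chain i.+1) (scale_chain i.+1) B x -
     cell_avg (n ^ 7 %/ scale_chain i) (scale_chain i) B x) ^+ 2) <= (nb * n ^ 7)%:R.
Proof.
move=> B01 T0 Tn.
set X := (nb * n ^ 7)%N.
pose D i := \sum_(x < X) (cell_avg (n ^ 7 %/ scale_chain i.+1) (scale_chain i.+1) B x -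
     cell_avg (n ^ 7 %/ scale_chain i) (scale_chain i) B x) ^+ 2.
pose E i := \sum_(x < X) cell_avg (n ^ 7 %/ scale_chain i) (scale_chain i) B x ^+ 2.
have DE i : (i < T)%N -> D i = E i.+1 - E i.
  move=> iT; rewrite /D /E.
  have /dvdnP[k kE] : (scale_chain i.+1 %| n ^ 7)%N.
    by apply: dvdn_trans (scale_chain_dvd iT) (dvdn_trans Tn _); rewrite dvdn_exp.
  have Q0 : (0 < scale_chain i)%N by have [l [-> _]] := scale_chain_pow2 i; rewrite expn_gt0.
  have kE' : (n ^ 7 = scale_chain i * (4 * scale_chain i) * k)%N by rewrite kE /= mulnC.
  have -> : (n ^ 7 %/ scale_chain i.+1 = k)%N by rewrite kE mulnK //= !muln_gt0 Q0.
  have -> : (n ^ 7 %/ scale_chain i = 4 * scale_chain i * k)%N by rewrite kE' -mulnA mulKn.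
  by rewrite /X kE'; exact: energy_increment.
have E01 i : 0 <= E i <= X%:R.
  rewrite sumr_ge0 /=; last by move=> x _; exact: sqr_ge0.
  apply: le_trans (_ : \sum_(x < X) 1 <= _); last by rewrite sumr_const card_ord.
  apply: ler_sum => x _; apply: exprn_ile1; last by apply: cell_avg_le1 => y; case/andP: (B01 y).
  by apply: cell_avg_ge0 => y; case/andP: (B01 y).
have [/existsP[i hi]|/existsPn no] := boolP [exists i : 'I_T, T%:R * D i <= X%:R].
  by exists i.
have : \sum_(i < T) (X%:R : R) < \sum_(i < T) T%:R * D i.
  apply: ltr_sum; last by move=> i _; rewrite ltNge no.
  by apply/hasP; exists (Ordinal T0); rewrite ?mem_index_enum.
rewrite sumr_const card_ord -big_distrr /= -[_ *+ T]mulr_natl ltr_pM2l ?ltr0n // => h.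
have S : \sum_(i < T) D i = E T - E 0%N.
  rewrite -(telescope_sumr E (leq0n T)) big_mkord; apply: eq_bigr => i _; exact: DE.
by move: h; rewrite S; have /andP[] := E01 T; have /andP[] := E01 0%N; lra.
Qed.

Lemma sum_indicator_le1 (R : numDomainType) (I : finType) (P S : pred I) :
  (forall x y, P x -> P y -> x = y) -> \sum_(x | S x) (P x)%:R <= 1 :> R.
Proof.
move=> uniqP; have [x Px|no] := pickP P; last by rewrite big1 // => x _; rewrite no.
apply: le_trans (_ : \sum_x0 (P x0)%:R <= _).
  by rewrite [leRHS](bigID S) /= lerDl sumr_ge0.
rewrite (bigD1 x) //= big1 ?Px ?addr0 // => y yx.
by case: (boolP (P y)) => // Py; rewrite (uniqP _ _ Py Px) eqxx in yx.
Qed.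

(** * From weighted local counts to pairs of elements *)

Section SquarePairs.

Variables (R : realFieldType) (N : nat).

Definition char_fun (A : {set 'I_N.+1}) (x : nat) : R := [exists a in A, (a : nat) == x]%:R.

Lemma char_fun01 A x : char_fun A x = 0 \/ char_fun A x = 1.
Proof. by rewrite /char_fun; case: existsP; [right|left]. Qed.

Lemma char_fun_ge0_le1 A x : 0 <= char_fun A x <= 1.
Proof. by case: (char_fun01 A x) => ->; rewrite lexx ler01. Qed.

Lemma sum_char_fun A X : (N < X)%N -> \sum_(x < X) char_fun A x = #|A|%:R.
Proof.
move=> NX; rewrite -(subnKC NX) big_split_ord /= [X in _ + X]big1 ?addr0 => [|x _]; last first.
  apply/eqP; rewrite pnatr_eq0 eqb0; apply/existsP => -[a /andP[_ /eqP E]].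
  by have := ltn_ord a; rewrite E -[X in (_ < X)%N]addn0 ltn_add2l ltn0.
rewrite -sum1_card natr_sum [RHS]big_mkcond /=; apply: eq_bigr => x _.
rewrite /char_fun; case: ifP => [xA|/negbT xA]; last first.
  by apply/eqP; rewrite pnatr_eq0 eqb0; apply: contra xA => /existsP[a /andP[aA /eqP/val_inj <-]].
by case: existsP => // -[]; exists x; rewrite xA eqxx.
Qed.

Definition square_pair_set (A B : {set 'I_N.+1}) : {set 'I_N.+1 * 'I_N.+1} :=
  [set p | (p.1 \in A) && (p.2 \in B) && is_pos_square (p.1 + p.2)].

(** A pair determines [a] as its first entry and [x] through the integer root of its sum, so
    [(a, x)] is counted once. As [0 < j], the cell of [B] excludes 0, which rules out the truncated
    values of the subtraction. *)
Lemma local_sum_le (A B : {set 'I_N.+1}) (kI kJ Q i s j t r Z K : nat) : (0 < j)%N -> (r < Q)%N ->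
  \sum_(0 <= a < Z | in_cell kI Q i s a) char_fun A a * \sum_(0 <= x < K)
      (in_cell kJ Q j t ((r + Q * x) ^ 2 - a)%N)%:R * char_fun B ((r + Q * x) ^ 2 - a)%N <=
  \sum_(p in square_pair_set A B)
     [&& in_cell kI Q i s p.1, in_cell kJ Q j t p.2 & isqrt (p.1 + p.2) %% Q == r]%N%:R.
Proof.
move=> j0 rQ; have Q0 : (0 < Q)%N by exact: leq_ltn_trans rQ.
pose C (p : 'I_N.+1 * 'I_N.+1) :=
  [&& in_cell kI Q i s p.1, in_cell kJ Q j t p.2 & isqrt (p.1 + p.2) %% Q == r]%N.
pose G a x (p : 'I_N.+1 * 'I_N.+1) : R := (C p)%:R * (((p.1 : nat) == a)%:R * (isqrt (p.1 + p.2) == r + Q * x)%N%:R).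
have G0 a x p : 0 <= G a x p by rewrite !mulr_ge0.
have term a x : in_cell kI Q i s a -> char_fun A a *
    ((in_cell kJ Q j t ((r + Q * x) ^ 2 - a)%N)%:R * char_fun B ((r + Q * x) ^ 2 - a)%N) <=
    \sum_(p in square_pair_set A B) G a x p.
  move=> ca; have S0 : 0 <= \sum_(p in square_pair_set A B) G a x p by apply: sumr_ge0.
  rewrite /char_fun; case: existsP => [[a' /andP[aA /eqP aE]]|_]; last by rewrite mul0r.
  subst a.
  case: existsP => [[b' /andP[bB /eqP bE]]|_]; last by rewrite !mulr0.
  case: (boolP (in_cell _ _ _ _ _)) => cb; last by rewrite mul0r mulr0.
  rewrite !mulr1.
  have b0 : (0 < b')%N.
    rewrite lt0n; apply: contraTneq cb => b0; rewrite -bE b0 /in_cell div0n.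
    by rewrite eq_sym (gtn_eqF j0).
  have abE : (a' + b' = (r + Q * x) ^ 2)%N.
    by rewrite bE subnKC //; move: b0; rewrite bE subn_gt0 => /ltnW.
  have pS : (a', b') \in square_pair_set A B.
    rewrite inE /= aA bB /= /is_pos_square.
    have z0 : (0 < r + Q * x)%N.
      by rewrite lt0n; apply/negP => /eqP z; move: abE b0; rewrite z; case: (b' : nat) => // b''; rewrite addnS.
    have zl : (r + Q * x < (a' + b').+1)%N by rewrite ltnS abE -mulnn leq_pmulr.
    by apply/existsP; exists (Ordinal zl); rewrite /= z0 abE eqxx.
  rewrite (bigD1 (a', b')) //= /G /C /= abE isqrt_sqr !eqxx ca bE cb.
  rewrite [(r + _)%N]addnC mulnC modnMDl (modn_small rQ) !eqxx !mulr1 lerDl.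
  by apply: sumr_ge0 => p _; rewrite !mulr_ge0.
apply: le_trans (_ : \sum_(0 <= a < Z | in_cell kI Q i s a) \sum_(0 <= x < K) \sum_(p in square_pair_set A B) G a x p <= _).
  by apply: ler_sum => a ca; rewrite big_distrr /=; apply: ler_sum => x _; exact: term.
under eq_bigr do rewrite exchange_big.
rewrite exchange_big; apply: ler_sum => p _; rewrite -/(C p).
apply: le_trans (_ : \sum_(0 <= a < Z) \sum_(0 <= x < K) G a x p <= _).
  by rewrite [leRHS](bigID (in_cell kI Q i s)) /= lerDl; apply: sumr_ge0 => a _; apply: sumr_ge0.
under eq_bigr do rewrite -!big_distrr /=.
rewrite -big_distrr /= ler_piMr // -big_distrl /=.
have le1 (P : pred nat) M : (forall x y, P x -> P y -> x = y) -> \sum_(0 <= x < M) (P x)%:R <= 1 :> R.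
  move=> uP; rewrite big_mkord; apply: (sum_indicator_le1 _ (P := fun x : 'I_M => P x)) => x y Px Py.
  by apply: val_inj; exact: uP.
rewrite -[leRHS]mulr1; apply: ler_pM; rewrite ?sumr_ge0 //; apply: le1.
  by move=> x y /eqP -> /eqP.
by move=> x y /eqP -> /eqP/addnI/eqP; rewrite eqn_pmul2l // => /eqP.
Qed.

(** Both cells and the residue of the root can be read off a pair, so no pair is counted twice
    across cells and roots. *)
Lemma sum_local_le (A B : {set 'I_N.+1}) (bA bB kI kJ Q : nat)
    (S : pred ((('I_bA * 'I_Q) * ('I_bB * 'I_Q)) * 'I_Q)) :
  \sum_(z | S z) \sum_(p in square_pair_set A B)
    [&& in_cell kI Q z.1.1.1 z.1.1.2 p.1, in_cell kJ Q z.1.2.1 z.1.2.2 p.2 &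
        isqrt (p.1 + p.2) %% Q == z.2]%N%:R <= (square_pairs A B)%:R :> R.
Proof.
rewrite exchange_big /= /square_pairs -/(square_pair_set A B).
apply: le_trans (_ : \sum_(p in square_pair_set A B) 1 <= _); last by rewrite sumr_const.
apply: ler_sum => p _; apply: sum_indicator_le1.
move=> [[[i s] [j t]] r] [[[i' s'] [j' t']] r'] /=.
case/and3P=> /andP[/eqP iE /eqP sE] /andP[/eqP jE /eqP tE] /eqP rE.
case/and3P=> /andP[/eqP iE' /eqP sE'] /andP[/eqP jE' /eqP tE'] /eqP rE'.
by congr (_, _, (_, _), _); apply: val_inj; rewrite /= -?iE -?sE -?jE -?tE -?rE.
Qed.

End SquarePairs.

(** * Size of the roots met by a pair of cells *)

Section RootBrackets.

Variables (R : realFieldType) (eta : R) (N n D0 S : nat).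
(** The factor 2 pays for the rounding of the root, through [M0.+1 <= 2 * M0]. *)
Let D := (2 * D0)%N.
Let M0 := isqrt S.
Let M1 := (isqrt (S + n ^ 18 + n ^ 15)).+1.
Hypotheses (D00 : (0 < D0)%N) (eta0 : 0 < eta) (eta1 : eta <= 1 / 10).
Hypotheses (large : 100 * (D ^ 2)%:R <= eta * n%:R) (S_large : (n ^ 20 <= D0 ^ 2 * S)%N).
Hypotheses (SN : (S <= 2 * N)%N) (nN : (n ^ 20 <= N)%N) (Nn : (N <= 4 * n ^ 20)%N).

Let Dn : (1000 * D ^ 2 <= n)%N.
Proof.
have : eta * n%:R <= 1 / 10 * n%:R by apply: ler_wpM2r.
rewrite -(ler_nat R) natrM; move: large; set x := (D ^ 2)%:R; lra.
Qed.

Let n_ge : (1000 <= n)%N.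
Proof. by apply: leq_trans Dn; rewrite leq_pmulr // expn_gt0 /D muln_gt0 D00. Qed.

Let n0 : (0 < n)%N. Proof. exact: leq_trans n_ge. Qed.

Lemma lower_root_sqr : (M0 ^ 2 <= S)%N.
Proof. by have /andP[] := isqrtP S. Qed.

Lemma upper_root_sqr : (S + n ^ 18 + n ^ 15 <= M1 ^ 2)%N.
Proof. by have /andP[_ /ltnW] := isqrtP (S + n ^ 18 + n ^ 15)%N. Qed.

Lemma lower_root_ge : (n ^ 10 <= D * M0)%N.
Proof.
have [_ lt] := andP (isqrtP S); rewrite -/M0 in lt.
have S0 : (0 < S)%N.
  by rewrite lt0n; apply: contraTneq S_large => ->; rewrite muln0 -ltnNge expn_gt0 n0.
have M00 : (0 < M0)%N.
  by rewrite lt0n; apply/negP => /eqP M00; move: lt; rewrite M00 exp1n ltnS leqn0 => /eqP; move: S0 => /[swap] ->.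
have : (n ^ 10 <= D0 * M0.+1)%N.
  rewrite -leq_sqr -expnM expnMn; apply: leq_trans S_large _.
  by rewrite leq_mul2l (ltnW lt) orbT.
move/leq_trans; apply; rewrite /D mulnAC mulnC leq_mul2r; apply/orP; right.
by move: M00; clear; lia.
Qed.

Lemma lower_root_le_upper : (M0 <= M1)%N.
Proof.
rewrite -leq_sqr; apply: leq_trans lower_root_sqr _; apply: leq_trans upper_root_sqr.
by rewrite -addnA leq_addr.
Qed.

Let n15 : (n ^ 15 <= n ^ 18)%N. Proof. by rewrite leq_pexp2l. Qed.

Let big20 : (1000 * n ^ 18 <= n ^ 20)%N.
Proof.
rewrite -[20%N]/(2 + 18)%N expnD leq_mul2r; apply/orP; right.
by apply: leq_trans n_ge _; rewrite -mulnn leq_pmulr.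
Qed.

(** As [S <= 2 * N], four times the square is about [8 * N] at most; the remaining [N] absorbs
    [n ^ 18], [n ^ 15] and the rounding. *)
Lemma upper_root_le : ((2 * M1) ^ 2 <= 9 * N)%N.
Proof.
have [le _] := andP (isqrtP (S + n ^ 18 + n ^ 15)%N).
rewrite /M1; move: le; set m := isqrt _ => le.
have m4 : (m <= 4 * n ^ 10)%N.
  rewrite -leq_sqr expnMn -expnM; apply: leq_trans le _.
  by move: SN Nn big20 n15; rewrite -[(10 * 2)%N]/20%N -[(4 ^ 2)%N]/16%N; move: (n ^ 20)%N (n ^ 18)%N (n ^ 15)%N; clear; lia.
have n8 : (n ^ 10 <= n ^ 18)%N by rewrite leq_pexp2l.
have n18 : (0 < n ^ 18)%N by rewrite expn_gt0 n0.
have -> : ((2 * m.+1) ^ 2 = 4 * m ^ 2 + 8 * m + 4)%N by rewrite -addn1; ring.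
move: le m4 SN nN big20 n15 n8 n18; move: (n ^ 20)%N (n ^ 18)%N (n ^ 15)%N (n ^ 10)%N (m ^ 2)%N.
by clear; lia.
Qed.

Lemma upper_root_le_n : (M1 <= 3 * n ^ 10)%N.
Proof.
rewrite -(leq_pmul2l (isT : (0 < 2)%N)) -leq_sqr; apply: leq_trans upper_root_le _.
have -> : ((2 * (3 * n ^ 10)) ^ 2 = 9 * (4 * n ^ 20))%N by rewrite -[20%N]/(10 + 10)%N expnD; ring.
by rewrite leq_mul2l Nn.
Qed.

(** The squares differ by [O (n ^ 18)] and the roots are at least [n ^ 10 / D], so the gap is at
    most [3 * D * n ^ 8]; [large] makes this small against [n ^ 10 / D]. *)
Lemma root_gap : 8 * (M1 - M0)%:R <= eta * M0%:R.
Proof.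
have [_ lt] := andP (isqrtP S); rewrite -/M0 in lt.
have [le _] := andP (isqrtP (S + n ^ 18 + n ^ 15)%N).
have n8 : (0 < n ^ 8)%N by rewrite expn_gt0 n0.
have gap : (M1 - M0 <= 3 * (D * n ^ 8))%N.
  rewrite /M1; move: le; set m := isqrt _ => le.
  pose de := (m - M0.+1)%N.
  have deM : (de * M0 <= n ^ 18)%N.
    case: (leqP m M0.+1) => [mM|mM]; first by rewrite /de (eqP (mM : (m - M0.+1 == 0)%N)).
    have mE : (m = M0.+1 + de)%N by rewrite /de subnKC // ltnW.
    have : (M0.+1 ^ 2 + 2 * (de * M0) <= m ^ 2)%N.
      by rewrite mE; move: (M0) (de); clear => x y; rewrite !expnS !expn0; nia.
    by move: le lt n15; move: (n ^ 18)%N (n ^ 15)%N (m ^ 2)%N (M0.+1 ^ 2)%N (de * M0)%N; clear; lia.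
  have de8 : (de <= D * n ^ 8)%N.
    have n10 : (0 < n ^ 10)%N by rewrite expn_gt0 n0.
    rewrite -(leq_pmul2r n10); apply: leq_trans (_ : de * (D * M0) <= _)%N.
      by rewrite leq_mul2l lower_root_ge orbT.
    by rewrite mulnCA -mulnA -expnD leq_mul2l deM orbT.
  have D8 : (0 < D * n ^ 8)%N by rewrite muln_gt0 n8 /D muln_gt0 D00.
  by move: de8 D8; rewrite /de; move: (D * n ^ 8)%N; clear; lia.
have D' : 0 < D%:R :> R by rewrite ltr0n /D muln_gt0 D00.
rewrite -(ler_pM2l D').
apply: (@le_trans _ _ (eta * n%:R ^+ 10)); last first.
  by rewrite [leRHS]mulrCA; apply: ler_wpM2l; rewrite ?(ltW eta0) // -natrX -natrM ler_nat; exact: lower_root_ge.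
apply: (@le_trans _ _ (100 * (D ^ 2)%:R * n%:R ^+ 8)).
  have : (M1 - M0)%:R <= 3 * (D%:R * n%:R ^+ 8) :> R by rewrite -natrX -!natrM ler_nat.
  have -> : (D ^ 2)%:R = D%:R * D%:R :> R by rewrite natrX expr2.
  have p : 0 <= D%:R * D%:R * n%:R ^+ 8 :> R by rewrite !mulr_ge0 // exprn_ge0.
  by move/(ler_wpM2l (ltW D')); lra.
have n1 : 1 <= n%:R :> R by rewrite ler1n.
apply: le_trans (_ : eta * n%:R * n%:R ^+ 8 <= _).
  by apply: ler_wpM2r large; rewrite exprn_ge0.
rewrite -mulrA -exprS; apply: ler_wpM2l; first exact: ltW.
by rewrite ler_weXn2l.
Qed.

End RootBrackets.

Lemma card_fiber_mod (b Q v : nat) : (128 %| Q)%N -> (v < 128)%N ->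
  (#|[pred z : 'I_b * 'I_Q | z.2 %% 128 == v]| * 128 = #|{: 'I_b * 'I_Q}|)%N.
Proof.
move=> /dvdnP[q ->] v128.
rewrite (eq_card (_ : _ =i [predX predT & [pred s : 'I_(q * 128) | s %% 128 == v]%N])) //.
rewrite cardX card_prod !card_ord -mulnA; congr (_ * _)%N.
suff -> : #|[pred s : 'I_(q * 128) | s %% 128 == v]%N| = q by [].
rewrite -sum1_card big_mkcond /= (sum_ord_mul (fun s => if s %% 128 == v then 1 else 0)%N q 128).
rewrite -[RHS]card_ord -sum1_card; apply: eq_bigr => j _.
rewrite (bigD1 (Ordinal v128)) //= modnMDl (modn_small v128) eqxx big1 // => c cv.
by rewrite modnMDl (modn_small (ltn_ord c)); case: eqP => // E; rewrite -val_eqE /= E eqxx in cv.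
Qed.

Lemma sum_cell_densities (R : fieldType) (F : nat -> R) (b Q k : nat) :
  \sum_(z : 'I_b * 'I_Q) k%:R^-1 * \sum_(i < k) F (z.1 * (Q * k) + z.2 + Q * i)%N =
  k%:R^-1 * \sum_(x < b * (Q * k)) F x.
Proof.
rewrite -big_distrr /= sum_cells; congr (_ * _).
by rewrite (pair_bigA _ (fun (j : 'I_b) (c : 'I_Q) => \sum_(i < k) F (j * (Q * k) + c + Q * i)%N)).
Qed.

Lemma sum_truncated_ge (R : numDomainType) (T : finType) (f : T -> R) (G : pred T) :
  (forall z, f z <= 1) -> \sum_z f z - #|[predC G]|%:R <= \sum_z (if G z then f z else 0).
Proof.
move=> f1; rewrite lerBlDr -sum1_card natr_sum [X in _ + X]big_mkcond -big_split /=.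
apply: ler_sum => z _; rewrite (_ : (z \in predC G) = ~~ G z) //.
by case: (G z); rewrite /= ?addr0 ?add0r.
Qed.

Lemma card_fst_le (b Q m : nat) (P : pred nat) : (forall i, P i -> (i < m)%N) ->
  (#|[pred z : 'I_b * 'I_Q | P z.1]| <= m * Q)%N.
Proof.
move=> Pm; rewrite (eq_card (_ : _ =i [predX [pred i : 'I_b | P i] & predT])); last first.
  by move=> z; rewrite !inE andbT.
rewrite cardX card_ord leq_mul2r; apply/orP; right.
rewrite cardE -(size_map val) -[leqRHS](size_iota 0); apply: uniq_leq_size.
  by rewrite map_inj_uniq ?enum_uniq //; exact: val_inj.
by move=> _ /mapP[i + ->]; rewrite mem_enum inE mem_iota add0n => /Pm.
Qed.

(** * Summation over rich pairs of cells for a fixed modulus *)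

Section Assembly.

Variables (R : realType) (N : nat) (A B : {set 'I_N.+1}) (e U n c0 D0 : nat) (eps eta theta : R).
Let Q := (2 ^ e)%N.
Hypotheses (Q128 : (128 %| Q)%N) (U3 : (3 <= U)%N) (c00 : (0 < c0)%N) (D00 : (0 < D0)%N).
Hypothesis nE : n = (4 * Q ^ 2 * U`! * c0)%N.
Hypotheses (eps0 : 0 < eps) (eps1 : eps <= 1) (eta0 : 0 < eta) (eta1 : eta <= 1 / 10).
Hypotheses (theta0 : 0 < theta) (thetaE : theta ^+ 2 = eta) (theta_small : 7 * theta <= eps / 36).
Hypothesis etaU : 1 <= eta * U%:R.
Hypothesis large : 100 * (Q ^ 2 * U * (2 * D0) ^ 2)%:R <= eta * n%:R.
Hypotheses (nN : (n ^ 20 <= N)%N) (Nn : (N <= 4 * n ^ 20)%N).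
Hypotheses (D0_large : 12 <= eps * D0%:R ^+ 2) (n_large : 30 <= eps * n%:R ^+ 2).
Hypotheses (A_large : (3 / 8 + eps) * N%:R <= #|A|%:R) (B_large : (3 / 8 + eps) * N%:R <= #|B|%:R).

Let chiA : nat -> R := char_fun R A.
Let chiB : nat -> R := char_fun R B.
Let k' := (U`! * c0 * n ^ 6)%N.
Let k1 := (4 * Q * k')%N.
Let kJ := (n ^ 4 * (n ^ 4 * k1))%N.
Let kI := (n ^ 3 * kJ)%N.
Let bA := (N %/ n ^ 18).+1.
Let bB := (N %/ n ^ 15).+1.
Let drift x := cell_avg k' (Q * (4 * Q)) chiB x - cell_avg k1 Q chiB x.
(** By Markov's inequality, the cells of [B] with energy above [eta * kJ] then make up at most a
    proportion [eps / 12]. *)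
Hypothesis energy : \sum_(x < bB * (Q * kJ)) drift x ^+ 2 <= eps * eta / 12 * (bB * n ^ 15)%:R.

Let Q0 : (0 < Q)%N. Proof. by rewrite expn_gt0. Qed.
Let n0 : (0 < n)%N. Proof. by rewrite nE !muln_gt0 Q0 fact_gt0 c00. Qed.
Let QkJ : (Q * kJ = n ^ 15)%N.
Proof.
have Qk1 : (Q * k1 = n ^ 7)%N by rewrite /k1 /k' (expnS n 6) {2}nE; ring.
by rewrite /kJ mulnCA [(Q * (_ * k1))%N]mulnCA Qk1 -!expnD.
Qed.
Let QkI : (Q * kI = n ^ 18)%N.
Proof. by rewrite /kI mulnCA QkJ -expnD. Qed.
Let kJ0 : (0 < kJ)%N.
Proof. by rewrite -(ltn_pmul2l Q0) muln0 QkJ expn_gt0 n0. Qed.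
Let kI0 : (0 < kI)%N.
Proof. by rewrite -(ltn_pmul2l Q0) muln0 QkI expn_gt0 n0. Qed.

Let alpha (z : 'I_bA * 'I_Q) := kI%:R^-1 * \sum_(i < kI) chiA (z.1 * (Q * kI) + z.2 + Q * i)%N.
Let beta (z : 'I_bB * 'I_Q) := kJ%:R^-1 * \sum_(i < kJ) chiB (z.1 * (Q * kJ) + z.2 + Q * i)%N.
Let drift_energy (j t : nat) := \sum_(x < j.+1 * (Q * kJ)) ((in_cell kJ Q j t x)%:R * drift x) ^+ 2.
Let good_A (z : 'I_bA * 'I_Q) := (n ^ 20 <= D0 ^ 2 * (z.1 * n ^ 18))%N.
Let good_B (z : 'I_bB * 'I_Q) := (0 < z.1)%N && (drift_energy z.1 z.2 <= eta * kJ%:R).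
(** Cells of [A] too close to 0 and cells of [B] with large drift or block index 0 are given density
    0. Their [edge_gain] is then at most 0, so they never occur in a rich pair. *)
Let a z := if good_A z then alpha z else 0.
Let b z := if good_B z then beta z else 0.

Let avg01 (F : nat -> R) k (g : nat -> nat) : (forall x, 0 <= F x <= 1) ->
  0 <= k%:R^-1 * \sum_(i < k) F (g i) <= 1.
Proof.
move=> F01; rewrite mulr_ge0 ?invr_ge0 ?ler0n ?sumr_ge0 //=; last first.
  by move=> i _; case/andP: (F01 (g i)).
case: (posnP k) => [->|k0]; first by rewrite big_ord0 mulr0 ler01.
rewrite mulrC ler_pdivrMr ?ltr0n // mul1r.
apply: (@le_trans _ _ (\sum_(i < k) 1)); last by rewrite sumr_const card_ord.
by apply: ler_sum => i _; case/andP: (F01 (g i)).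
Qed.

Let alpha01 z : 0 <= alpha z <= 1.
Proof. by apply: (@avg01 _ _ (fun i => z.1 * (Q * kI) + z.2 + Q * i)%N) => x; exact: char_fun_ge0_le1. Qed.
Let beta01 z : 0 <= beta z <= 1.
Proof. by apply: (@avg01 _ _ (fun i => z.1 * (Q * kJ) + z.2 + Q * i)%N) => x; exact: char_fun_ge0_le1. Qed.
Let a01 z : 0 <= a z <= 1.
Proof. by rewrite /a; case: ifP => _ //; rewrite lexx ler01. Qed.
Let b01 z : 0 <= b z <= 1.
Proof. by rewrite /b; case: ifP => _ //; rewrite lexx ler01. Qed.

Let NbA : (N < bA * n ^ 18)%N. Proof. by rewrite ltn_ceil // expn_gt0 n0. Qed.
Let NbB : (N < bB * n ^ 15)%N. Proof. by rewrite ltn_ceil // expn_gt0 n0. Qed.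
Let bAN : (bA * n ^ 18 <= N + n ^ 18)%N.
Proof. by rewrite mulSn addnC leq_add2r leq_trunc_div. Qed.
Let bBN : (bB * n ^ 15 <= N + n ^ 15)%N.
Proof. by rewrite mulSn addnC leq_add2r leq_trunc_div. Qed.

Let n18N : 30 * n%:R ^+ 18 <= eps * N%:R.
Proof.
apply: le_trans (_ : eps * n%:R ^+ 20 <= _); last first.
  by rewrite ler_pM2l // -natrX ler_nat.
rewrite -[20%N]/(2 + 18)%N exprD mulrA; apply: ler_wpM2r n_large.
by rewrite exprn_ge0.
Qed.

Let n15_18 : n%:R ^+ 15 <= n%:R ^+ 18 :> R.
Proof. by rewrite ler_weXn2l // ler1n. Qed.

Let kIR : 0 < kI%:R :> R. Proof. by rewrite ltr0n. Qed.
Let kJR : 0 < kJ%:R :> R. Proof. by rewrite ltr0n. Qed.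
Let QkIR : kI%:R * Q%:R = n%:R ^+ 18 :> R. Proof. by rewrite -natrM mulnC QkI natrX. Qed.
Let QkJR : kJ%:R * Q%:R = n%:R ^+ 15 :> R. Proof. by rewrite -natrM mulnC QkJ natrX. Qed.

(** Of the excess [eps], the part [eps / 2] serves as density threshold and [eps / 3] as margin in
    the gain. The remaining [eps / 6] covers discarded cells, about [eps / 12], and the rounding to
    whole blocks. *)
Let average_A : #|{: 'I_bA * 'I_Q}|%:R * (3 / 8 + eps / 2 + eps / 3) <= \sum_z a z.
Proof.
have alphaS : \sum_z alpha z = kI%:R^-1 * #|A|%:R.
  by rewrite /alpha (sum_cell_densities chiA) sum_char_fun // QkI.
have := sum_truncated_ge good_A (fun z => proj2 (andP (alpha01 z))).
rewrite alphaS => /(le_trans _); apply.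
pose m := (n ^ 2 %/ D0 ^ 2).+1.
have D2 : (0 < D0 ^ 2)%N by rewrite expn_gt0 D00.
have bad : (#|[predC good_A]| <= m * Q)%N.
  apply: leq_trans (card_fst_le _ _ (P := fun i => ~~ (n ^ 20 <= D0 ^ 2 * (i * n ^ 18))%N) _); first exact: leqnn.
  move=> i; rewrite -ltnNge -[20%N]/(2 + 18)%N expnD mulnA ltn_pmul2r ?expn_gt0 ?n0 // => h.
  by rewrite ltnS leq_divRL // mulnC ltnW.
have mE : m%:R * n%:R ^+ 18 <= eps / 12 * N%:R + n%:R ^+ 18.
  have mD : D0%:R ^+ 2 * m%:R <= n%:R ^+ 2 + D0%:R ^+ 2 :> R.
    by rewrite -!natrX -natrM -natrD ler_nat mulnC /m mulSn addnC leq_add2r leq_trunc_div.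
  have h1 : m%:R <= eps / 12 * n%:R ^+ 2 + 1.
    have d2 : 0 < D0%:R ^+ 2 :> R by rewrite exprn_gt0 ?ltr0n.
    rewrite -(ler_pM2l d2); apply: le_trans mD _; rewrite mulrDr mulr1 lerD2r.
    have : 0 <= n%:R ^+ 2 :> R by rewrite exprn_ge0.
    by move/ler_wpM2r => /(_ _ _ D0_large); lra.
  have p18 : 0 <= n%:R ^+ 18 :> R by rewrite exprn_ge0.
  apply: le_trans (ler_wpM2r p18 h1) _; rewrite mulrDl mul1r lerD2r -[leLHS]mulrA -exprD.
  by rewrite ler_pM2l ?divr_gt0 // -natrX ler_nat.
rewrite -(ler_pM2l kIR) mulrBr (mulVKf (lt0r_neq0 kIR)) card_prod !card_ord natrM.
have -> : kI%:R * (bA%:R * Q%:R * (3 / 8 + eps / 2 + eps / 3)) =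
   (bA%:R * n%:R ^+ 18) * (3 / 8 + eps / 2 + eps / 3) by rewrite -QkIR; ring.
have h1 : kI%:R * #|[predC good_A]|%:R <= m%:R * n%:R ^+ 18 :> R.
  by rewrite -QkIR mulrCA; apply: ler_wpM2l; [exact: ltW|rewrite -natrM ler_nat].
have h2 : bA%:R * n%:R ^+ 18 <= N%:R + n%:R ^+ 18 :> R by rewrite -natrX -natrM -natrD ler_nat.
have h3 : (bA%:R * n%:R ^+ 18) * (3 / 8 + eps / 2 + eps / 3) <= (N%:R + n%:R ^+ 18) * (3 / 8 + eps / 2 + eps / 3).
  by apply: ler_wpM2r h2; move: eps0; lra.
have h4 : eps * n%:R ^+ 18 <= n%:R ^+ 18 by rewrite ler_piMl // exprn_ge0.
have p18 : 0 <= n%:R ^+ 18 :> R by rewrite exprn_ge0.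
by move: A_large mE h1 h3 h4 n18N p18; lra.
Qed.

Let drift_energyE (z : 'I_bB * 'I_Q) :
  drift_energy z.1 z.2 = \sum_(i < kJ) drift (z.1 * (Q * kJ) + z.2 + Q * i)%N ^+ 2.
Proof.
rewrite /drift_energy -(sum_in_cell (fun x => drift x ^+ 2) kJ (ltnSn z.1) (ltn_ord z.2)).
by apply: eq_bigr => x _; rewrite exprMn; case: (in_cell _ _ _ _ _); rewrite ?expr1n ?expr0n.
Qed.

Let average_B : #|{: 'I_bB * 'I_Q}|%:R * (3 / 8 + eps / 2 + eps / 3) <= \sum_z b z.
Proof.
have betaS : \sum_z beta z = kJ%:R^-1 * #|B|%:R.
  by rewrite /beta (sum_cell_densities chiB) sum_char_fun // QkJ.
have := sum_truncated_ge good_B (fun z => proj2 (andP (beta01 z))).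
rewrite betaS => /(le_trans _); apply.
pose E := [pred z : 'I_bB * 'I_Q | eta * kJ%:R < drift_energy z.1 z.2].
have bad : (#|[predC good_B]| <= 1 * Q + #|E|)%N.
  have card0 := @card_fst_le bB Q 1 (fun i => i == 0)%N (fun i => ltac:(by move=> /eqP ->)).
  apply: leq_trans (leq_add card0 (leqnn _)).
  rewrite -cardUI; apply: leq_trans (leq_addr _ _); apply: subset_leq_card.
  apply/fintype.subsetP => z; rewrite !inE /good_B /= negb_and -ltNge.
  by rewrite lt0n negbK.
have ES : eta * (kJ%:R * #|E|%:R) <= eps * eta / 12 * (bB%:R * n%:R ^+ 15).
  apply: (@le_trans _ _ (\sum_(z : 'I_bB * 'I_Q) drift_energy z.1 z.2)).
    rewrite [leRHS](bigID E) /= mulrA mulr_natr -sumr_const -[leLHS]addr0; apply: lerD.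
      by apply: ler_sum => z /ltW.
    by apply: sumr_ge0 => z _; apply: sumr_ge0 => x _; exact: sqr_ge0.
  rewrite (eq_bigr _ (fun z _ => drift_energyE z)).
  rewrite -(pair_bigA _ (fun (j : 'I_bB) (c : 'I_Q) => \sum_(i < kJ) drift (j * (Q * kJ) + c + Q * i)%N ^+ 2)) /=.
  rewrite -(sum_cells (fun x => drift x ^+ 2)); apply: le_trans energy _.
  by rewrite natrM natrX.
rewrite -(ler_pM2l kJR) mulrBr (mulVKf (lt0r_neq0 kJR)) card_prod !card_ord natrM.
have -> : kJ%:R * (bB%:R * Q%:R * (3 / 8 + eps / 2 + eps / 3)) =
   (bB%:R * n%:R ^+ 15) * (3 / 8 + eps / 2 + eps / 3) by rewrite -QkJR; ring.
have {}ES : kJ%:R * #|E|%:R <= eps / 12 * (bB%:R * n%:R ^+ 15).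
  by rewrite -(ler_pM2l eta0); move: ES; lra.
have h1 : kJ%:R * #|[predC good_B]|%:R <= n%:R ^+ 15 + kJ%:R * #|E|%:R :> R.
  rewrite -QkJR -mulrDr; apply: ler_wpM2l; first exact: ltW.
  by rewrite -natrD ler_nat -[X in (X + _)%N]mul1n.
have h2 : bB%:R * n%:R ^+ 15 <= N%:R + n%:R ^+ 15 :> R by rewrite -natrX -natrM -natrD ler_nat.
have h3 : (bB%:R * n%:R ^+ 15) * (3 / 8 + eps / 2 + eps / 3 + eps / 12) <=
    (N%:R + n%:R ^+ 15) * (3 / 8 + eps / 2 + eps / 3 + eps / 12).
  by apply: ler_wpM2r h2; move: eps0; lra.
have p15 : 0 <= n%:R ^+ 15 :> R by rewrite exprn_ge0.
have h4 : eps * n%:R ^+ 15 <= n%:R ^+ 15 by rewrite ler_piMl.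
by move: B_large h1 h3 h4 n18N p15 n15_18 ES; lra.
Qed.

Let sN : R := Num.sqrt N%:R.
Let sN2 : sN ^+ 2 = N%:R. Proof. by rewrite sqr_sqrtr. Qed.
Let sN0 : 0 < sN.
Proof. by rewrite sqrtr_gt0 ltr0n; apply: leq_trans nN; rewrite expn_gt0 n0. Qed.

(** A lower bound for the squares per rich pair and root: [kI * w0] is [n ^ 33 / (2 * Q ^ 2 * M1)]
    and [2 * M1 <= 3 * sN]. A gain of [2 * (eps / 3)], divided by 6 and reduced by [eps / 36],
    leaves [eps / 12]. *)
Let lam := n%:R ^+ 33 / (3 * Q%:R ^+ 2 * sN) * (eps / 12).

Let rich_local (z : ('I_bA * 'I_Q) * ('I_bB * 'I_Q)) (r : 'I_Q) :
  2 * (eps / 3) <= edge_gain (a z.1) (b z.2) -> (r ^ 2 = z.1.2 + z.2.2 %[mod Q])%N ->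
  lam <= \sum_(p in square_pair_set A B)
    [&& in_cell kI Q z.1.1 z.1.2 p.1, in_cell kJ Q z.2.1 z.2.2 p.2 & isqrt (p.1 + p.2) %% Q == r]%N%:R.
Proof.
move=> rich rE.
have gA : good_A z.1.
  apply: contraTT rich => /negbTE gA; rewrite -ltNge /a gA /edge_gain.
  by have /andP[_] := b01 z.2; move: eps0; lra.
have gB : good_B z.2.
  apply: contraTT rich => /negbTE gB; rewrite -ltNge /b gB /edge_gain.
  by have /andP[_] := a01 z.1; move: eps0; lra.
rewrite /a /b gA gB in rich; have /andP[J0 energyJ] := gB.
pose S := (z.1.1 * n ^ 18 + z.2.1 * n ^ 15)%N.
have S_large : (n ^ 20 <= D0 ^ 2 * S)%N.
  by apply: leq_trans gA _; rewrite leq_mul2l leq_addr orbT.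
have SN : (S <= 2 * N)%N.
  rewrite mul2n -addnn; apply: leq_add.
    by apply: leq_trans (leq_trunc_div N (n ^ 18)); rewrite leq_mul2r -ltnS ltn_ord orbT.
  by apply: leq_trans (leq_trunc_div N (n ^ 15)); rewrite leq_mul2r -ltnS ltn_ord orbT.
have large' : 100 * ((2 * D0) ^ 2)%:R <= eta * n%:R.
  apply: le_trans large; rewrite ler_pM2l // ler_nat leq_pmull // muln_gt0 expn_gt0 Q0.
  exact: leq_trans U3.
pose M0 := isqrt S; pose M1 := (isqrt (S + n ^ 18 + n ^ 15)).+1.
pose w0 : R := n%:R ^+ 15 / (2 * Q%:R * M1%:R).
have i0_large : (n ^ 20 <= (2 * D0) ^ 2 * (z.1.1 * n ^ 18))%N.
  by apply: leq_trans gA _; rewrite leq_mul2r leq_sqr leq_pmull ?orbT.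
have D'0 : (0 < 2 * D0)%N by rewrite muln_gt0 D00.
have [Z [K local]] := @scaled_local_count R chiA chiB (@char_fun01 R N A) (@char_fun01 R N B)
   Q U n c0 (2 * D0) M0 M1 r z.1.2 z.2.2 z.1.1 z.2.1 eta theta (ltn_ord _) (ltn_ord _) (ltn_ord _) J0 U3 c00 D'0 nE
   (esym rE) eta0 eta1 theta0 thetaE etaU large i0_large (lower_root_sqr S) (upper_root_sqr n S)
   (lower_root_ge D00 eta1 large' S_large) (upper_root_le_n D00 eta1 large' SN nN Nn)
   (lower_root_le_upper n S) (root_gap D00 eta0 eta1 large' S_large) w0 erefl energyJ.
apply: le_trans (local_sum_le R A B kI kJ _ _ _ Z K J0 (ltn_ord r)).
apply: le_trans local; rewrite -/kJ -/kI.
have M1N := upper_root_le D00 eta1 large' SN nN Nn; rewrite -/M1 in M1N.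
have m10 : 0 < M1%:R :> R by rewrite ltr0n.
have q0 : 0 < Q%:R :> R by rewrite ltr0n.
have w00 : 0 < w0 by rewrite divr_gt0 ?exprn_gt0 ?mulr_gt0 ?ltr0n.
have w0E : w0 * (2 * Q%:R * M1%:R) = n%:R ^+ 15 by rewrite divfK // gt_eqF // !mulr_gt0.
have M1s : 2 * M1%:R <= 3 * sN.
  apply: ler_of_sqr; first by rewrite mulr_ge0 // ltW.
  by rewrite [leRHS]exprMn sN2 -natrX -!natrM -natrX ler_nat.
have gain : eps / 12 <= edge_gain (alpha z.1) (beta z.2) / 6 - 7 * theta.
  by move: rich theta_small; lra.
rewrite /lam; apply: ler_pM gain; [|by rewrite divr_ge0 // ltW|].
  by rewrite divr_ge0 ?exprn_ge0 // !mulr_ge0 // ?exprn_ge0 // ltW.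
rewrite ler_pdivrMr; last by rewrite !mulr_gt0 // exprn_gt0.
have -> : n%:R ^+ 33 = kI%:R * w0 * Q%:R ^+ 2 * (2 * M1%:R).
  by rewrite -[33%N]/(18 + 15)%N exprD -QkIR -w0E; ring.
have -> : kI%:R * w0 * (3 * Q%:R ^+ 2 * sN) = kI%:R * w0 * Q%:R ^+ 2 * (3 * sN) by ring.
by apply: ler_wpM2l => //; rewrite mulr_ge0 ?sqr_ge0 // mulr_ge0 // ltW.
Qed.

(** Every rich pair is used once for each square root of its residue sum, and the number of roots
    compensates [V ^ 2] at the price 2048. The factor 144 is 4 * 12 * 3, from [(eps / 2) ^+ 2],
    [eps / 12] and [2 * M1 <= 3 * sN]. *)
Lemma assembled_count : eps ^+ 3 * (N%:R * Num.sqrt N%:R) <= 2048 * 144 * (square_pairs A B)%:R.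
Proof.
have TA0 : (0 < #|{: 'I_bA * 'I_Q}|)%N by rewrite card_prod !card_ord muln_gt0 Q0.
have TB0 : (0 < #|{: 'I_bB * 'I_Q}|)%N by rewrite card_prod !card_ord muln_gt0 Q0.
have [V [c [v [w [Vc vw rich_many]]]]] := @many_rich_pairs R ('I_bA * 'I_Q)%type ('I_bB * 'I_Q)%type (fun z => z.2 : nat) (fun z => z.2 : nat) a b
  (eps / 2) (eps / 3) TA0 TB0 (fun v => @card_fiber_mod bA Q v Q128) (fun v => @card_fiber_mod bB Q v Q128)
  (divr_gt0 eps0 (ltr0n _ 2)) (divr_gt0 eps0 (ltr0n _ 3)) a01 b01 average_A average_B.
set Rich := [pred z | _] in rich_many.
have lam0 : 0 <= lam.
  by rewrite mulr_ge0 ?divr_ge0 ?exprn_ge0 ?mulr_ge0 ?exprn_ge0 // ltW.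
have count : lam * (V ^ 2 * #|Rich|)%:R <= 2048 * (square_pairs A B)%:R.
  pose T := ((('I_bA * 'I_Q) * ('I_bB * 'I_Q)) * 'I_Q)%type.
  pose root (z : ('I_bA * 'I_Q) * ('I_bB * 'I_Q)) (r : 'I_Q) := (r ^ 2 == z.1.2 + z.2.2 %[mod Q])%N.
  have upper := @sum_local_le R N A B bA bB kI kJ Q (fun x => Rich x.1 && root x.1 x.2).
  apply: le_trans (ler_wpM2l (ler0n R 2048) upper).
  rewrite -(pair_big_dep Rich root (fun z r => \sum_(p in square_pair_set A B)
    [&& in_cell kI Q z.1.1 z.1.2 p.1, in_cell kJ Q z.2.1 z.2.2 p.2 & isqrt (p.1 + p.2) %% Q == r]%N%:R : R)) /=.
  rewrite -sum1_card big_distrr natr_sum big_distrr [leRHS]big_distrr /=; apply: ler_sum => z zR.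
  apply: le_trans (_ : 2048 * \sum_(r | root z r) lam <= _).
    rewrite sumr_const -[lam *+ _]mulr_natl mulrCA [leRHS]mulrA [leRHS]mulrC -natrM; apply: ler_wpM2l => //.
    rewrite ler_nat muln1 mulnC.
    have stc : (z.1.2 + z.2.2 = c %[mod V])%N.
      by move: zR => /and3P[/eqP E1 /eqP E2 _]; rewrite -modnDm E1 E2 modnDm.
    exact: (pow2_square_roots Q128 Vc stc).
  apply: ler_wpM2l => //; apply: ler_sum => r /eqP rE; apply: rich_local rE.
  by move: zR => /and3P[].
have main := le_trans (ler_wpM2l lam0 rich_many) count.
have lamE : lam * ((eps / 2) ^+ 2 * (#|{: 'I_bA * 'I_Q}| * #|{: 'I_bB * 'I_Q}|)%:R) * (144 * sN) =
   eps ^+ 3 * ((bA * n ^ 18)%:R * (bB * n ^ 15)%:R).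
  rewrite !card_prod !card_ord (natrM _ (_ * _) (_ * _)) (natrM _ bA Q) (natrM _ bB Q).
  rewrite (natrM _ bA (n ^ _)) (natrM _ bB (n ^ _)) (natrX _ n 18) (natrX _ n 15) /lam.
  have := lt0r_neq0 sN0; have : Q%:R != 0 :> R by rewrite pnatr_eq0 -lt0n.
  move: (Q%:R : R) sN (bA%:R : R) (bB%:R : R) => q s x y qn0 sn0; field.
  by rewrite qn0 sn0.
have NN : N%:R * N%:R <= (bA * n ^ 18)%:R * (bB * n ^ 15)%:R :> R.
  by apply: ler_pM; rewrite // ler_nat ltnW.
have e3 : 0 <= eps ^+ 3 by rewrite exprn_ge0 // ltW.
have s0 : 0 <= 144 * sN by rewrite mulr_ge0 // ltW.
have := ler_wpM2r s0 main; rewrite lamE => main'.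
have := le_trans (ler_wpM2l e3 NN) main'; rewrite -/sN -{1 2}sN2 => h.
rewrite -(ler_pM2r sN0) -sN2; move: h; lra.
Qed.

End Assembly.

(** * Choice of parameters and conclusion *)

Lemma exists_nat_mul_ge (R : archiRealFieldType) (c x : R) (k : nat) : 0 < c ->
  exists2 m, (k <= m)%N & x <= c * m%:R.
Proof.
move=> c0; exists (Num.bound `|x / c| + k)%N; first exact: leq_addl.
rewrite -ler_pdivrMl // mulrC; apply: le_trans (ler_norm _) _.
by rewrite natrD; apply: le_trans (ltW (archi_boundP (normr_ge0 _))) _; rewrite lerDl.
Qed.

Lemma ler_exp20 (R : realFieldType) (x y : R) :
  0 <= x -> 0 <= y -> x <= 41 / 40 * y -> x ^+ 20 <= 4 * y ^+ 20.
Proof.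
move=> x0 y0 h1.
have h5 : x ^+ 5 <= 6 / 5 * y ^+ 5.
  have y1 : 0 <= 41 / 40 * y by lra.
  apply: le_trans (lerXn2r 5 x0 y1 h1) _.
  by rewrite [leLHS]exprMn; apply: ler_wpM2r; [rewrite exprn_ge0|lra].
rewrite -[20%N]/(5 * 4)%N !exprM; have y5 : 0 <= 6 / 5 * y ^+ 5 by rewrite mulr_ge0 ?exprn_ge0 //; lra.
apply: le_trans (lerXn2r 4 (exprn_ge0 5 x0) y5 h5) _.
by rewrite [leLHS]exprMn; apply: ler_wpM2r; [rewrite !exprn_ge0|lra].
Qed.

Lemma leq_exp20 (q : nat) : (40 <= q)%N -> (q.+1 ^ 20 <= 4 * q ^ 20)%N.
Proof.
move=> q40; suff real_bound (R : realFieldType) : (q.+1 ^ 20 <= 4 * q ^ 20)%N by exact: (real_bound rat).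
rewrite -(ler_nat R) natrM !natrX; apply: ler_exp20; rewrite ?ler0n //.
have : 40 <= q%:R :> R by rewrite ler_nat.
by rewrite -[q.+1%:R]natr1; lra.
Qed.

(** The scale has to be a multiple of [W], so its 20th power can only approximate [N]. For [q >= 40]
    the ratio of consecutive candidates is at most (41/40)^20 < 4. *)
Lemma exists_max_scale (W N qmin : nat) : (0 < W)%N -> (40 <= qmin)%N -> ((W * qmin) ^ 20 <= N)%N ->
  exists2 q, (qmin <= q)%N & ((W * q) ^ 20 <= N <= 4 * (W * q) ^ 20)%N.
Proof.
move=> W0 q40 hq.
have ub q : ((W * q) ^ 20 <= N)%N -> (q <= N)%N.
  apply: leq_trans; apply: leq_trans (leq_pmull q W0) _.
  by rewrite -{1}[(W * q)%N]expn1; case: (W * q)%N => [|x] //; rewrite leq_pexp2l.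
have [q qN qmax] := ex_maxnP (ex_intro (fun q => ((W * q) ^ 20 <= N)%N) qmin hq) ub.
have qq := qmax _ hq.
exists q => //; rewrite qN /=.
have NS : (N < (W * q.+1) ^ 20)%N.
  by rewrite ltnNge; apply/negP => /qmax; rewrite ltnn.
apply: leq_trans (ltnW NS) _; rewrite !expnMn mulnCA leq_mul2l; apply/orP; right.
exact: leq_exp20 (leq_trans q40 qq).
Qed.

Lemma square_pairs_lower_bound (R : realType) (eps : R) : 0 < eps -> eps <= 1 ->
  exists N0 : nat, forall N, (N0 <= N)%N -> forall A B : {set 'I_N.+1},
    (3 / 8 + eps) * N%:R <= #|A|%:R -> (3 / 8 + eps) * N%:R <= #|B|%:R ->
    eps ^+ 3 * (N%:R * Num.sqrt N%:R) <= 2048 * 144 * (square_pairs A B)%:R.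
Proof.
(* Since 252 = 7 * 36, the error [7 * theta] of a local count is [eps / 36]. *)
move=> eps0 eps1; pose theta := eps / 252; pose eta := theta ^+ 2.
have theta0 : 0 < theta by rewrite divr_gt0.
have eta0 : 0 < eta by rewrite exprn_gt0.
have eta1 : eta <= 1 / 10.
  have t1 : theta <= 1 / 10 by rewrite /theta; lra.
  by rewrite /eta expr2; apply: le_trans (ler_pM _ _ t1 t1) _; rewrite ?ltW //; lra.
have [U U3 etaU] := exists_nat_mul_ge 1 3 eta0.
have [D0 D00 epsD] := exists_nat_mul_ge 12 1 eps0.
have [T T0 etaT] := exists_nat_mul_ge 12 1 (mulr_gt0 eta0 eps0).
have [m1 _ m1P] := exists_nat_mul_ge (100 * (scale_chain T ^ 2 * U * (2 * D0) ^ 2)%:R) 0 eta0.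
have [m2 _ m2P] := exists_nat_mul_ge 30 1 eps0.
pose W := (scale_chain T * U`!)%N.
have chain0 i : (0 < scale_chain i)%N by have [e [-> _]] := scale_chain_pow2 i; rewrite expn_gt0.
have W0 : (0 < W)%N by rewrite muln_gt0 chain0 fact_gt0.
exists ((W * (m1 + m2 + 40)) ^ 20)%N => N /exists_max_scale => /(_ W0 (leq_addl _ _)) [q qmin /andP[nN Nn]] A B Abig Bbig.
pose n := (W * q)%N.
have q0 : (0 < q)%N by apply: leq_trans qmin; rewrite addn_gt0 orbT.
have qn : (m1 + m2 + 40 <= n)%N by apply: leq_trans qmin _; exact: leq_pmull.
have m1n : (m1 <= n)%N by move: qn; clear; lia.
have m2n : (m2 <= n)%N by move: qn; clear; lia.
have n1 : (1 <= n)%N by move: qn; clear; lia.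
have Tn : (scale_chain T %| n)%N by rewrite /n /W -mulnA dvdn_mulr.
have [i iT drift] := energy_pigeonhole ((N %/ n ^ 15).+1 * n ^ 8) (@char_fun_ge0_le1 R N B) T0 Tn.
have [e [Qe e7]] := scale_chain_pow2 i.
have Q128 : (128 %| 2 ^ e)%N by rewrite -[128%N]/(2 ^ 7)%N dvdn_Pexp2l.
have /dvdnP[c cE] := scale_chain_dvd iT.
have cE' : scale_chain T = (4 * (2 ^ e) ^ 2 * c)%N by rewrite cE /= Qe; ring.
have c0 : (0 < c)%N by have := chain0 T; rewrite cE muln_gt0 => /andP[].
pose c0' := (c * q)%N.
have nE : n = (4 * (2 ^ e) ^ 2 * U`! * c0')%N by rewrite /n /W cE' /c0'; ring.
have n1R : 1 <= n%:R :> R by rewrite ler1n.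
apply: (@assembled_count R N A B e U n c0' D0 eps eta theta) => //.
- by rewrite muln_gt0 c0.
- by rewrite /theta; lra.
- apply: le_trans (_ : eta * m1%:R <= _); last by rewrite ler_pM2l // ler_nat.
  apply: le_trans m1P; rewrite ler_pM2l // ler_nat leq_mul2r; apply/orP; right.
  rewrite leq_mul2r leq_sqr -Qe; apply/orP; right; apply: dvdn_leq; first exact: chain0.
  exact: scale_chain_dvd (ltnW iT).
- apply: le_trans epsD _; rewrite ler_pM2l // expr2 ler_peMr // ler1n //.
- apply: le_trans m2P _; rewrite ler_pM2l // expr2; apply: le_trans (_ : n%:R <= _).
    by rewrite ler_nat.
  by rewrite ler_peMr.
have n7 : (n ^ 7 = 4 * (2 ^ e) ^ 2 * U`! * c0' * n ^ 6)%N by rewrite (expnS n 6) {1}nE.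
have k'E : (n ^ 7 %/ scale_chain i.+1 = U`! * c0' * n ^ 6)%N.
  rewrite n7 /= Qe.
  have -> : (4 * (2 ^ e) ^ 2 * U`! * c0' * n ^ 6 = (2 ^ e * (4 * 2 ^ e)) * (U`! * c0' * n ^ 6))%N by ring.
  by rewrite mulKn // !muln_gt0 expn_gt0.
have k1E : (n ^ 7 %/ scale_chain i = 4 * 2 ^ e * (U`! * c0' * n ^ 6))%N.
  rewrite n7 Qe.
  have -> : (4 * (2 ^ e) ^ 2 * U`! * c0' * n ^ 6 = 2 ^ e * (4 * 2 ^ e * (U`! * c0' * n ^ 6)))%N by ring.
  by rewrite mulKn // expn_gt0.
rewrite k'E k1E /= Qe in drift.
have XE : ((N %/ n ^ 15).+1 * (2 ^ e * (n ^ 4 * (n ^ 4 * (4 * 2 ^ e * (U`! * c0' * n ^ 6))))) = (N %/ n ^ 15).+1 * n ^ 8 * n ^ 7)%N.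
  by rewrite n7 (expnD n 4 4); ring.
have X15 : ((N %/ n ^ 15).+1 * n ^ 15 = (N %/ n ^ 15).+1 * n ^ 8 * n ^ 7)%N by rewrite -mulnA -expnD.
rewrite XE X15.
set E := \sum_(x < _) _ in drift *.
have E0 : 0 <= E by apply: sumr_ge0 => x _; exact: sqr_ge0.
have ee : 0 < eta * eps / 12 by rewrite divr_gt0 // mulr_gt0.
have := ler_wpM2l (ltW ee) drift; have := ler_wpM2r E0 etaT; lra.
Qed.

Theorem theorem1p1 (R : realType) (eps : R) (heps : 0 < eps) :
  exists N0 : nat, forall N : nat, (N0 <= N)%N ->
    forall A B : {set 'I_N.+1},
      subset_1N A -> subset_1N B ->
      (3 / 8 + eps) * N%:R <= #|A|%:R ->
      (3 / 8 + eps) * N%:R <= #|B|%:R ->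
      (exists a b : 'I_N.+1, [/\ a \in A, b \in B & is_pos_square (a + b)%N])
      /\ (10 ^- 6) * eps ^+ 3 * (N%:R * Num.sqrt N%:R) <= (square_pairs A B)%:R.
Proof.
have [eps1|eps1] := leP eps 1; last first.
  (* For [eps > 1] the density hypothesis is impossible: a set has at most [N + 1] elements, fewer
     than [11 / 8 * N] once [N >= 3]. *)
  exists 3%N => N N3 A B _ _ hA _; exfalso.
  have N3' : 3 <= N%:R :> R by rewrite ler_nat.
  have : #|A|%:R <= N%:R + 1 :> R.
    by rewrite natr1 ler_nat; apply: leq_trans (max_card _) _; rewrite card_ord.
  have : 1 * N%:R <= eps * N%:R by apply: ler_wpM2r => //; exact: ltW.
  by move: hA N3'; lra.
have [N0 count] := square_pairs_lower_bound heps eps1.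
exists (maxn N0 1) => N; rewrite geq_max => /andP[N0N N1] A B _ _ hA hB.
have {}count := count N N0N A B hA hB.
have pos : 0 < eps ^+ 3 * (N%:R * Num.sqrt N%:R).
  have N0R : 0 < N%:R :> R by rewrite ltr0n.
  by rewrite mulr_gt0 ?exprn_gt0 // mulr_gt0 // sqrtr_gt0.
split; last first.
  (* The constant suffices because 2048 * 144 = 294912 is below 10^6. *)
  rewrite -mulrA mulrC ler_pdivrMr ?exprn_gt0 //.
  by move: count pos; lra.
have : (0 < square_pairs A B)%N.
  by rewrite -(ltr0n R); move: count pos; lra.
rewrite card_gt0 => /set0Pn[[a b]]; rewrite inE => /andP[/andP[aA bB] ab].
by exists a, b.
Qed.
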